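(* Let $d\ge2$, $\lambda_n>0$, $\beta_n\in\mathbb{R}$ ($n\ge0$), and assume the Jacobi operator $J$ on $\ell^2(\Gamma_d)$ is not essentially selfadjoint. Then none of the Jacobi matrices $J^r_n$, $n\ge0$, is essentially selfadjoint; each $J^r_n$ has a selfadjoint extension, and the spectrum of every selfadjoint extension of $J^r_n$ is a discrete set. For each $n\ge 0$ let $\tilde J_n$ be a selfadjoint extension of $J^r_n$. For $x\in\Gamma_d$ let $\tilde J_x$ be the operator with domain $D(\tilde J_x)\subseteq H_x$ associated with the selfadjoint extension $\tilde J_{|x|+1}$, and for the index $x=0$ let $\tilde J_x$ be the operator in $H_0$ associated with the selfadjoint extension of $J^r_0$. Then each $\tilde J_x$ has a pure point spectrum (i.e. there exists a basis consisting of eigenvectors). Define $\tilde J$ by $$\tilde J(f)=\sum_{x\in\Gamma_d\cup\{0\}}\tilde J_x(f),\qquad D(\tilde J)=\bigoplus_{x\in\Gamma_d\cup\{0\}} D(\tilde J_x)=\operatorname{lin}\{f\in\ell^2(\Gamma_d):\ f\in D(\tilde J_x)\text{ for some }x\in\Gamma_d\cup\{0\}\}.$$ Then $\tilde J$ is a selfadjoint extension of $J$, and its spectrum $$\sigma(\tilde J)=\overline{\bigcup_{x\in\Gamma_d\cup\{0\}}\sigma(\tilde J_x)}$$ is also a pure point spectrum.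
   Context: $\Gamma_d$ is the vertex set of the infinite rooted tree with root $e$ in which every vertex $x$ has exactly $d$ successors $x_1,\dots,x_d$ and every $x\ne e$ has exactly one predecessor $x_0$; $|x|$ is the distance from $x$ to $e$; $\Gamma_x$ is the subtree with root $x$, consisting of $x$ and all its descendants. A function on $\Gamma_d$ (or on a subtree $\Gamma_y$) is radial if it is constant on each level, i.e. on each set of vertices of the tree (subtree) of a fixed length $|\cdot|$. $J$ has domain $D(J)$, the finitely supported functions in $\ell^2(\Gamma_d)$, and acts by $J\delta_x=\lambda_{n-1}\delta_{x_0}+\beta_n\delta_x+\lambda_n(\delta_{x_1}+\dots+\delta_{x_d})$, $n=|x|$, with the first term absent for $x=e$ ($\lambda_{-1}=0$). For $n\ge0$, $J^r_n$ is the symmetric operator on the finitely supported sequences in $\ell^2(\mathbb{N}_0)$ given by the Jacobi matrix with diagonal entries $\beta_n,\beta_{n+1},\beta_{n+2},\dots$ and off-diagonal entries $\sqrt d\,\lambda_n,\sqrt d\,\lambda_{n+1},\dots$. Let $0\notin\Gamma_d$ be an extra index. $H_0$ is the space of radial functions in $\ell^2(\Gamma_d)$. For $x\in\Gamma_d$, $H_x$ is the linear subspace of $\ell^2(\Gamma_d)$ consisting of those $f\in\ell^2(\Gamma_d)$ which satisfy: (1) $\operatorname{supp} f\subset\Gamma_x\setminus\{x\}$; (2) $\sum_{i=1}^d f(x_i)=0$; (3) $f$ is radial on each subtree $\Gamma_{x_i}$; (4) the value of $f$ on a level of $\Gamma_{x_i}$ is proportional to its value on the corresponding level of $\Gamma_{x_j}$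 with the coefficient $f(x_i)/f(x_j)$. The spaces $H_x$, $x\in\Gamma_d\cup\{0\}$, are pairwise orthogonal. The restriction of $J$ to $H_x\cap D(J)$ is expressed by the matrix $J^r_0$ when $x=0$ and its action is associated with the matrix $J^r_{|x|+1}$ when $x\in\Gamma_d$. Concretely, for $x=0$ put $u_m=d^{-m/2}\mathbf 1_{\{|y|=m\}}$ and $n=0$; for $x\in\Gamma_d$ and $a\in\mathbb{C}^d$ with $\sum_i a_i=0$ put $u_m=d^{-m/2}\sum_{i=1}^d a_i\mathbf 1_{\{y\in\Gamma_{x_i}:\ |y|=|x|+1+m\}}$ and $n=|x|+1$. Then $J u_m=\sqrt d\,\lambda_{n+m-1}u_{m-1}+\beta_{n+m}u_m+\sqrt d\,\lambda_{n+m}u_{m+1}$ for $m\ge0$, with the first term absent for $m=0$. The operator $\tilde J_x$ corresponds to the selfadjoint extension of $J^r_n$ under the same identification of $u_m$ with the $m$-th unit vector of $\ell^2(\mathbb{N}_0)$.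
   Formalization: Since D(J̃) consists of finite sums, J̃ itself is not closed, hence not selfadjoint; J̃ is shown to be a well-defined operator extending J, and ''selfadjoint extension'', σ(J̃) and ''pure point spectrum'' are stated for the closure of J̃. *)

(* Defs.v *)
From HB Require Import structures.
From mathcomp Require Import all_boot all_order all_algebra.
From mathcomp Require Import complex.
From mathcomp Require Import all_classical all_reals all_analysis.

Set Implicit Arguments.
Unset Strict Implicit.
Unset Printing Implicit Defensive.

Import Order.TTheory GRing.Theory Num.Theory.
Import numFieldNormedType.Exports.

Local Open Scope classical_set_scope.
Local Open Scope ring_scope.
Local Open Scope complex_scope.

Definition linear_span (K : pzRingType) (V : lmodType K) (S : set V) : set V :=
  [set v | exists (n : nat) (c : 'I_n -> K) (s : 'I_n -> V),
     (forall i, S (s i)) /\ v = \sum_(i < n) c i *: s i].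

Section HilbertSpace.
Variables (R : realType) (T : choiceType).
Implicit Types (f g h : T -> R[i]) (H S : set (T -> R[i])).

Definition l2 : set (T -> R[i]) :=
  [set f | summable [set: T] (fun x => (Normc.normc (f x) ^+ 2)%:E)].

Definition l2norm f : R :=
  Num.sqrt (fine (\esum_(x in [set: T]) (Normc.normc (f x) ^+ 2)%:E)).

(* The sum of an absolutely summable family, through its positive and negative
   parts (real case) and its real and imaginary parts (complex case). *)
Definition rsum (u : T -> R) : R :=
  fine (\esum_(x in [set: T]) ((EFin \o u)^\+ x)%E) -
  fine (\esum_(x in [set: T]) ((EFin \o u)^\- x)%E).

Definition csum f : R[i] :=
  Complex (rsum (fun x => complex.Re (f x))) (rsum (fun x => complex.Im (f x))).

Definition inner f g : R[i] := csum (fun x => f x * (g x)^*).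

Definition l2_closure S : set (T -> R[i]) :=
  [set f | l2 f /\
     forall e : R, 0 < e -> exists2 g, S g & l2norm (f - g) < e].

Definition delta (x : T) : T -> R[i] := fun y => (y == x)%:R.

(* An unbounded operator is represented by its graph. The argument H below is
   the Hilbert space in which the operator acts, a closed subspace of l2. *)
Definition graph := set ((T -> R[i]) * (T -> R[i])).
Implicit Type A : graph.

Definition domain A : set (T -> R[i]) := [set f | exists g, A (f, g)].

Definition is_operator H A : Prop :=
  [/\ A `<=` H `*` H, linear_span A `<=` A
    & forall f g h, A (f, g) -> A (f, h) -> g = h].

Definition adjoint H A : graph :=
  [set p | [/\ H p.1, H p.2
             & forall q, A q -> inner q.2 p.1 = inner q.1 p.2]].

Definition selfadjoint H A : Prop :=
  [/\ is_operator H A, H `<=` l2_closure (domain A) & adjoint H A = A].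

Definition op_closure A : graph :=
  [set p | [/\ l2 p.1, l2 p.2
             & forall e : R, 0 < e -> exists2 q, A q &
                 l2norm (p.1 - q.1) < e /\ l2norm (p.2 - q.2) < e]].

Definition essentially_selfadjoint H A : Prop := selfadjoint H (op_closure A).

Definition selfadjoint_extension H (A B : graph) : Prop :=
  A `<=` B /\ selfadjoint H B.

(* A - z is a bijection of the domain of A onto H with a bounded inverse. *)
Definition resolvent_set H A : set R[i]^o :=
  [set z | exists M : R, forall h, H h -> exists f,
     [/\ A (f, h + z *: f), l2norm f <= M * l2norm h
       & forall f', A (f', h + z *: f') -> f' = f]].

Definition spectrum H A : set R[i]^o := ~` resolvent_set H A.

Definition eigenvector A f : Prop := f <> 0 /\ exists z : R[i], A (f, z *: f).

(* H has an orthonormal Hilbert basis consisting of eigenvectors of A. *)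
Definition pure_point_spectrum H A : Prop :=
  exists B : set (T -> R[i]),
    [/\ forall f, B f -> H f /\ eigenvector A f,
        forall f, B f -> inner f f = 1,
        forall f g, B f -> B g -> f <> g -> inner f g = 0
      & H `<=` l2_closure (linear_span B)].

(* The operator on finitely supported functions mapping delta x to c x. *)
Definition finsupp_operator (c : T -> T -> R[i]) : graph :=
  linear_span (range (fun x => (delta x, c x))).

(* The operator f |-> \sum_x A x f_x whose domain is the algebraic direct sum
   of the domains of the A x. *)
Definition sum_operator (I : eqType) (A : I -> graph) : graph :=
  [set p | exists (s : seq I) (F G : I -> T -> R[i]),
     [/\ uniq s, forall x, x \in s -> A x (F x, G x),
         p.1 = \sum_(x <- s) F x & p.2 = \sum_(x <- s) G x]].

End HilbertSpace.

Definition discrete_set (R : realType) (S : set R[i]^o) : Prop :=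
  forall z, S z -> isolated S z.

(* The vertices of the d-ary tree are the words over 'I_d: the root is [::],
   the successors of x are the rcons x i, the length is size, and the subtree
   with root x consists of the words having x as a prefix. *)
Section Tree.
Variables (R : realType) (d : nat) (lam bet : nat -> R).
Notation vertex := (seq 'I_d).
Implicit Types (x y z : vertex) (f : vertex -> R[i]).

(* For x = i :: s, the predecessor of x is belast i s and |x| - 1 is size s. *)
Definition J_column x : vertex -> R[i] :=
  (if x is i :: s then (lam (size s))%:C *: delta R (belast i s) else 0)
  + (bet (size x))%:C *: delta R x
  + (lam (size x))%:C *: \sum_(i < d) delta R (rcons x i).

Definition J_op : graph R vertex := finsupp_operator J_column.

Definition jacobi_matrix (b a : nat -> R) (i j : nat) : R[i] :=
  (if i == j then b j
   else if i == j.+1 then a j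
   else if j == i.+1 then a i
   else 0)%:C.

Definition Jr (n : nat) : graph R nat :=
  finsupp_operator (fun j i =>
    jacobi_matrix (fun k => bet (n + k))
                  (fun k => Num.sqrt d%:R * lam (n + k)) i j).

Definition radial_on x f : Prop :=
  forall y z, prefix x y -> prefix x z -> size y = size z -> f y = f z.

(* A nonzero f with f (x_i) = 0 for all i is excluded, since then the
   coefficients f (x_i) / f (x_j) are all undefined. *)
Definition proportional_on_subtrees x f : Prop :=
  (exists i, f (rcons x i) <> 0) /\
  forall (i j : 'I_d) y z, f (rcons x j) <> 0 ->
    prefix (rcons x i) y -> prefix (rcons x j) z -> size y = size z ->
    f y = f (rcons x i) / f (rcons x j) * f z.

Definition H_generators x : set (vertex -> R[i]) :=
  [set f | [/\ l2 f,
     forall y, f y <> 0 -> prefix x y /\ y <> x,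
     \sum_(i < d) f (rcons x i) = 0,
     forall i, radial_on (rcons x i) f
   & proportional_on_subtrees x f]].

(* The extra index is None. For d > 2 the functions with proportional values
   are not closed under addition; the linear subspace is the one they span. *)
Definition H_space (x : option vertex) : set (vertex -> R[i]) :=
  if x is Some x then linear_span (H_generators x)
  else [set f | l2 f /\ radial_on [::] f].

Definition u_radial (m : nat) : vertex -> R[i] :=
  fun y => (Num.sqrt d%:R ^- m)%:C * (size y == m)%:R.

Definition u_vec x (a : 'I_d -> R[i]) (m : nat) : vertex -> R[i] :=
  fun y => (Num.sqrt d%:R ^- m)%:C *
    \sum_(i < d) a i *
      (prefix (rcons x i) y && (size y == (size x).+1 + m)%N)%:R.

(* g |-> \sum_m g m *: u m, when u m y = 0 for all m > size y. *)
Definition embed (u : nat -> vertex -> R[i]) (g : nat -> R[i]) :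
    vertex -> R[i] :=
  fun y => \sum_(m < (size y).+1) g m * u m y.

Definition transport (u : nat -> vertex -> R[i]) (A : graph R nat) :
    graph R vertex :=
  [set (embed u p.1, embed u p.2) | p in A].

(* Jt_part Jt None acts in H_space None as Jt 0. For x a vertex, H_space x is
   the tensor product of {a | \sum_i a i = 0} with l2(nat), and Jt_part Jt x
   acts there as Jt (|x| + 1) for each fixed a. *)
Definition Jt_part (Jt : nat -> graph R nat) (x : option vertex) :
    graph R vertex :=
  if x is Some x then
    linear_span (\bigcup_(a in [set a : 'I_d -> R[i] | \sum_(i < d) a i = 0])
                   transport (u_vec x a) (Jt (size x).+1))
  else transport u_radial (Jt 0%N).

(* The domain consists of finite sums, so that Jt_sum Jt is not closed; it is
   its closure that can be selfadjoint or have a nontrivial spectrum. *)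
Definition Jt_sum (Jt : nat -> graph R nat) : graph R vertex :=
  sum_operator (Jt_part Jt).

End Tree.

Arguments J_op [R] d lam bet.
Arguments Jr [R] d lam bet n.
Arguments H_space R [d] x.
Arguments Jt_part [R] d Jt x.
Arguments Jt_sum [R] d Jt.

(* Main.v *)
(* A deficiency vector of J has a nonzero coefficient along some u_m, and its
   coefficients along that family (u_m) form a square summable solution at i or
   -i of the recurrence of the corresponding J^r_n. Von Neumann's construction
   then gives a selfadjoint extension of J^r_n, whose resolvent at i applied to
   the first unit vector is, beyond index 0, a second independent solution. So
   every solution at i is square summable, for this n and hence for all n,
   because the recurrences are shifts of one another. Variation of constants
   turns this into a bound |f k| <= w k * (||f|| + ||g||), with w square summable,
   for all (f, g) in the graph of the adjoint. Hence the resolvents of a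
   selfadjoint extension are compact: it has an orthonormal basis of eigenvectors
   and its eigenvalues are isolated.

   Every H_x is a finite orthogonal sum of isometric copies of l2(N) on which J
   acts as J^r_n, and the H_x are pairwise orthogonal with dense span. The union
   of the eigenbases of the operators in the H_x is therefore an orthonormal
   basis, and the closure of their sum is the diagonal operator of this basis. *)
Require Import Defs.
From mathcomp Require Import all_boot all_order all_algebra.
From mathcomp Require Import complex.
From mathcomp Require Import all_classical all_reals all_analysis.
From mathcomp Require Import ring lra zify.

Set Implicit Arguments.
Unset Strict Implicit.
Unset Printing Implicit Defensive.

Import Order.TTheory GRing.Theory Num.Theory.
Import numFieldNormedType.Exports.

Local Open Scope classical_set_scope.
Local Open Scope ring_scope.
Local Notation normc := Normc.normc.

(** Off the real line only the points [i] and [-i] are used. There symmetry alone gives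
    [||g - z f||^2 = ||g||^2 + ||f||^2], which closes the range of the shifted operator and reduces
    selfadjointness to the absence of eigenvectors of the adjoint at [i] and [-i]. Eigenvectors come
    from a variational problem in which the coordinatewise bound confines the relevant vectors to a
    Hilbert cube. The same bound limits the number of orthonormal eigenvectors with bounded
    eigenvalues, which isolates the eigenvalues. From then on operators are identified with diagonal
    operators of orthonormal sets, explicit graphs whose selfadjointness, spectrum and closure are
    computed once: any linear graph that contains the eigenpairs and lies in the diagonal operator
    has that operator as its closure. This settles both the given extensions and the algebraic
    direct sum, which is not closed. On the tree, radial and sum-zero families are instances of
    [level_system]. An orthonormal basis of the sum-zero vectors turns the span over all coefficient
    vectors [a] into a finite orthogonal sum. *)

Section SquareModulus.
Variable R : realType.
Implicit Types z w : R[i].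

Lemma sqr_normcE z : normc z ^+ 2 = complex.Re z ^+ 2 + complex.Im z ^+ 2.
Proof. by case: z => a b /=; rewrite sqr_sqrtr // addr_ge0 ?sqr_ge0. Qed.

Lemma normc_ge0 z : 0 <= normc z.
Proof. by case: z => a b; apply: sqrtr_ge0. Qed.

Lemma normc_eq0 z : normc z = 0 -> z = 0.
Proof. exact: Normc.eq0_normc. Qed.

Lemma normc_conj z : normc z^* = normc z.
Proof. by case: z => a b /=; rewrite sqrrN. Qed.

Lemma normc_real (a : R) : normc a%:C%C = `|a|.
Proof. by rewrite /= expr0n addr0 sqrtr_sqr. Qed.

Lemma mulc_conj z : z * z^* = (normc z ^+ 2)%:C%C.
Proof.
by rewrite sqr_normcE; case: z => a b; apply/eqP; rewrite eq_complex /=;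
  apply/andP; split; apply/eqP; ring.
Qed.

Lemma conjc_realE (a : R) : (a%:C%C : R[i])^* = a%:C%C.
Proof. exact: conjc_real. Qed.

Lemma normc_triangle z w : normc (z + w) <= normc z + normc w.
Proof. exact: le_normcD. Qed.

Lemma normc_mul z w : normc (z * w) = normc z * normc w.
Proof. exact: Normc.normcM. Qed.

Lemma normc_opp z : normc (- z) = normc z.
Proof. exact: normcN. Qed.

Lemma normc_zero : normc (0 : R[i]) = 0.
Proof. exact: Normc.normc0. Qed.

Lemma normc_sum (I : Type) (s : seq I) (F : I -> R[i]) :
  normc (\sum_(i <- s) F i) <= \sum_(i <- s) normc (F i).
Proof.
elim: s => [|i s IH]; first by rewrite !big_nil normc_zero.
by rewrite !big_cons (le_trans (normc_triangle _ _)) // lerD2l.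
Qed.

Lemma Re_le_normc z : `|complex.Re z| <= normc z.
Proof.
rewrite -(@ler_pXn2r _ 2) ?nnegrE ?normr_ge0 ?normc_ge0//.
by rewrite sqr_normcE real_normK ?num_real// lerDl sqr_ge0.
Qed.

Lemma Im_le_normc z : `|complex.Im z| <= normc z.
Proof.
rewrite -(@ler_pXn2r _ 2) ?nnegrE ?normr_ge0 ?normc_ge0//.
by rewrite sqr_normcE real_normK ?num_real// lerDr sqr_ge0.
Qed.

Lemma conjc_i : ('i%C : R[i])^* = - 'i%C.
Proof. by rewrite /= -[RHS]/(Complex (- 0) (- 1)) oppr0. Qed.

Lemma normc_i : normc ('i%C : R[i]) = 1.
Proof. by rewrite /= expr0n add0r expr1n sqrtr1. Qed.

End SquareModulus.

(** * Square summable functions *)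

Section NonnegativeSums.
Variables (R : realType) (T : choiceType).
Implicit Types (a b u v : T -> R) (X : seq T).

Local Notation summ a := (summable [set: T] (fun x => (a x)%:E)).
Local Notation tsum a := (fine (\esum_(x in [set: T]) (a x)%:E)).

(** With [summ_ub], characterises the extended-real sum of a nonnegative family as the least upper
    bound of its sums over duplicate-free lists. Later estimates are made on such lists. *)
Lemma summ_lub a M : (forall x, 0 <= a x) ->
  (forall X, uniq X -> \sum_(x <- X) a x <= M) -> summ a /\ tsum a <= M.
Proof.
move=> a0 aM.
have E : (\esum_(x in [set: T]) (a x)%:E <= M%:E)%E.
  apply: ub_ereal_sup => y [F [/finite_seqP[s ->] _] <-].
  have -> : [set` s] = [set` undup s].
    by apply/seteqP; split=> x /=; rewrite mem_undup.
  by rewrite -fsbig_seq ?undup_uniq// sumEFin lee_fin aM ?undup_uniq.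
have E0 : (0 <= \esum_(x in [set: T]) (a x)%:E)%E.
  by apply: esum_ge0 => x _; rewrite lee_fin.
split; last first.
  rewrite -lee_fin fineK// ge0_fin_numE//; exact: le_lt_trans E (ltry _).
rewrite /summable; under eq_esum do rewrite gee0_abs ?lee_fin//.
exact: le_lt_trans E (ltry _).
Qed.

Lemma summ_ub a X : (forall x, 0 <= a x) -> summ a -> uniq X ->
  \sum_(x <- X) a x <= tsum a.
Proof.
move=> a0; rewrite /summable; under eq_esum do rewrite gee0_abs ?lee_fin//.
move=> sa uX.
have E0 : (0 <= \esum_(x in [set: T]) (a x)%:E)%E.
  by apply: esum_ge0 => x _; rewrite lee_fin.
rewrite -lee_fin fineK ?ge0_fin_numE// -sumEFin fsbig_seq//.
by apply: esum_ge; exists [set` X].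
Qed.

Lemma summ_approx a e : (forall x, 0 <= a x) -> summ a -> 0 < e ->
  exists2 X, uniq X & tsum a - e < \sum_(x <- X) a x.
Proof.
move=> a0 sa e0; apply: contrapT => N.
have [] := @summ_lub a (tsum a - e) a0 _.
  move=> X uX; rewrite leNgt; apply/negP => h; by apply: N; exists X.
by move=> _; rewrite lerBrDr gerDl leNgt e0.
Qed.

Lemma summ_le a b : (forall x, `|a x| <= b x) -> summ b -> summ a.
Proof.
move=> ab sb; have b0 x : 0 <= b x by apply: le_trans (ab x).
have [] := @summ_lub (fun x => `|a x|) (tsum b) _ _ => //.
  move=> X uX; apply: le_trans (summ_ub b0 sb uX).
  by apply: ler_sum => x _; apply: ab.
move=> + _; rewrite /summable; under eq_esum do rewrite abse_EFin normr_id.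
by under [X in _ -> is_true (X < _)%E]eq_esum do rewrite abse_EFin.
Qed.

Lemma summD a b : summ a -> summ b -> summ (fun x => a x + b x).
Proof.
by move=> sa sb; have := summableD sa sb; rewrite /summable.
Qed.

Lemma summN a : summ a -> summ (fun x => - a x).
Proof. by rewrite summableN. Qed.

Lemma summ_abs a : summ a -> summ (fun x => `|a x|).
Proof. by rewrite /summable; under [X in _ -> is_true (X < _)%E]eq_esum do rewrite abse_EFin normr_id -abse_EFin. Qed.

Lemma summZ c a : summ a -> summ (fun x => c * a x).
Proof.
move=> /summ_abs sa; have [] := @summ_lub (fun x => `|c| * `|a x|) (`|c| * tsum (fun x => `|a x|)) _ _.
- by move=> x; rewrite mulr_ge0.
- move=> X uX; rewrite -mulr_sumr ler_wpM2l// summ_ub//.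
by move=> + _; apply: summ_le => x; rewrite normrM.
Qed.

Lemma tsum_ge0 a : (forall x, 0 <= a x) -> 0 <= tsum a.
Proof. by move=> a0; apply: fine_ge0; apply: esum_ge0 => x _; rewrite lee_fin. Qed.

Lemma tsumD a b : (forall x, 0 <= a x) -> (forall x, 0 <= b x) ->
  summ a -> summ b -> tsum (fun x => a x + b x) = tsum a + tsum b.
Proof.
move=> a0 b0 sa sb; under eq_esum do rewrite EFinD.
rewrite esumD; try by move=> x _; rewrite lee_fin.
rewrite fineD//.
- move: sa; rewrite summableE; by under eq_esum do rewrite gee0_abs ?lee_fin//.
- move: sb; rewrite summableE; by under eq_esum do rewrite gee0_abs ?lee_fin//.
Qed.

Lemma tsumZ c a : 0 <= c -> (forall x, 0 <= a x) -> summ a ->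
  tsum (fun x => c * a x) = c * tsum a.
Proof.
move=> c0 a0 sa; have [->|cN] := eqVneq c 0.
  under eq_esum do rewrite mul0r.
  by rewrite mul0r esum1.
have cp : 0 < c by rewrite lt_def cN.
have ca0 x : 0 <= c * a x by rewrite mulr_ge0.
apply/eqP; rewrite eq_le; apply/andP; split.
  apply: (summ_lub ca0 _).2 => X uX.
  by rewrite -mulr_sumr ler_pM2l// summ_ub.
rewrite -ler_pdivlMl//; apply: (summ_lub a0 _).2 => X uX.
rewrite ler_pdivlMl// mulr_sumr; apply: summ_ub => //.
exact: summZ.
Qed.

(** Positive parts are not additive, so additivity of [rsum] needs the freedom to write [u] as any
    difference of nonnegative summable functions. *)
Lemma rsum_split u v w : (forall x, 0 <= v x) -> (forall x, 0 <= w x) ->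
  summ v -> summ w -> (forall x, u x = v x - w x) ->
  rsum u = tsum v - tsum w.
Proof.
move=> v0 w0 sv sw /funext ->; rewrite /rsum.
have su : summ (fun x => v x - w x) by apply: summD => //; apply: summN.
have := esumB sv sw (fun x _ => v0 x) (fun x _ => w0 x).
have -> : (fun x => (v x)%:E - (w x)%:E)%E = EFin \o (fun x => v x - w x) by [].
move=> E.
have F (D : set T) (f : T -> \bar R) : summable D f ->
    (forall x, 0 <= f x)%E -> (\esum_(x in D) f x)%E \is a fin_num.
  move=> + f0; rewrite summableE; by under eq_esum do rewrite gee0_abs//.
rewrite -!fineB ?E//; apply: F => //.
- exact: summable_funepos.
- exact: summable_funeneg.
Qed.

Lemma rsum_posneg u : summ u ->
  rsum u = tsum (fun x => Num.max (u x) 0) - tsum (fun x => Num.max (- u x) 0).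
Proof.
move=> su; apply: rsum_split.
- by move=> x; rewrite le_max lexx orbT.
- by move=> x; rewrite le_max lexx orbT.
- apply: (summ_le _ (summ_abs su)) => x; rewrite ger0_norm ?le_max ?lexx ?orbT//.
  by rewrite ge_max normr_ge0 ler_norm.
- apply: (summ_le _ (summ_abs su)) => x; rewrite ger0_norm ?le_max ?lexx ?orbT//.
  by rewrite ge_max normr_ge0 -normrN ler_norm.
by move=> x; rewrite !maxEle; case: ifP; case: ifP; lra.
Qed.

Lemma rsumD u v : summ u -> summ v ->
  rsum (fun x => u x + v x) = rsum u + rsum v.
Proof.
move=> su sv; rewrite (rsum_posneg su) (rsum_posneg sv).
have P (w : T -> R) x : 0 <= Num.max (w x : R) 0 by rewrite le_max lexx orbT.
have Q (w : T -> R) x : 0 <= Num.max (- w x : R) 0 by rewrite le_max lexx orbT.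
have SP (w : T -> R) : summ w -> summ (fun x => Num.max (w x) 0).
  move=> sw; apply: (summ_le _ (summ_abs sw)) => x; rewrite ger0_norm//.
  by rewrite ge_max normr_ge0 ler_norm.
have SQ (w : T -> R) : summ w -> summ (fun x => Num.max (- w x) 0).
  by move=> /summN/SP.
rewrite (@rsum_split _ (fun x => Num.max (u x) 0 + Num.max (v x) 0)
  (fun x => Num.max (- u x) 0 + Num.max (- v x) 0)).
- rewrite (tsumD (P u) (P v)) ?SP// (tsumD (Q u) (Q v)) ?SQ//.
  by rewrite opprD addrACA.
- by move=> x; rewrite addr_ge0.
- by move=> x; rewrite addr_ge0.
- by apply: summD; apply: SP.
- by apply: summD; apply: SQ.
have E (r : R) : r = Num.max r 0 - Num.max (- r) 0.
  by rewrite !maxEle; case: ifP; case: ifP; lra.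
by move=> x; rewrite {1}(E (u x)) {1}(E (v x)); ring.
Qed.

Lemma rsum_ge0E u : (forall x, 0 <= u x) -> summ u -> rsum u = tsum u.
Proof.
move=> u0 su; rewrite (@rsum_split _ u (fun=> 0))//.
- by rewrite [X in _ - fine X]esum1// subr0.
- by rewrite /summable esum1// => x _; rewrite abse0.
by move=> x; rewrite subr0.
Qed.

Lemma rsum0 : rsum (fun _ : T => 0 : R) = 0.
Proof.
rewrite rsum_ge0E//; first by rewrite esum1.
by rewrite /summable esum1// => x _; rewrite abse0.
Qed.

Lemma rsumN u : summ u -> rsum (fun x => - u x) = - rsum u.
Proof.
move=> su; apply/eqP; rewrite -addr_eq0 -rsumD//; last exact: summN.
by under eq_fun do rewrite addNr; rewrite rsum0.
Qed.

Lemma rsumZ c u : summ u -> rsum (fun x => c * u x) = c * rsum u.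
Proof.
(* Only a nonnegative factor commutes with positive and negative parts; a negative one is reduced to
   it through [rsumN]. *)
wlog c0 : c / 0 <= c => [W su|su].
  have [c0|/ltW c0] := leP 0 c; first exact: W.
  have -> : (fun x => c * u x) = (fun x => - ((- c) * u x)).
    by apply/funext => x; rewrite mulNr opprK.
  rewrite rsumN; last exact: summZ.
  by rewrite W ?oppr_ge0// mulNr opprK.
have P x : 0 <= Num.max (u x : R) 0 by rewrite le_max lexx orbT.
have Q x : 0 <= Num.max (- u x : R) 0 by rewrite le_max lexx orbT.
have SP (w : T -> R) : summ w -> summ (fun x => Num.max (w x) 0).
  move=> sw; apply: (summ_le _ (summ_abs sw)) => x.
  by rewrite ger0_norm ?le_max ?lexx ?orbT// ge_max normr_ge0 ler_norm.
rewrite (rsum_posneg su) mulrBr -!tsumZ//; try exact: SP.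
  apply: rsum_split.
  - by move=> x; rewrite mulr_ge0.
  - by move=> x; rewrite mulr_ge0.
  - by apply: summZ; apply: SP.
  - by apply: summZ; apply: SP; apply: summN.
  by move=> x; rewrite -mulrBr; congr (_ * _); rewrite !maxEle; case: ifP; case: ifP; lra.
by apply: SP; apply: summN.
Qed.

Lemma rsum_supp1 u x : (forall y, y != x -> u y = 0) -> rsum u = u x.
Proof.
have K (w : T -> R) : 0 <= w x -> (forall y, y != x -> w y = 0) -> summ w /\ tsum w = w x.
  move=> wx wy; have w0 y : 0 <= w y by have [->//|/wy->] := eqVneq y x.
  have [|sw le] := @summ_lub w (w x) w0.
    move=> X uX; have [xX|xX] := boolP (x \in X); last first.
      rewrite big1_seq// => y /= yX; apply: wy; apply: contraNneq xX => <- //.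
    rewrite (bigD1_seq x)//= big1 ?addr0// => y; exact: wy.
  split=> //; apply/eqP; rewrite eq_le le/=.
  by have := @summ_ub w [:: x] w0 sw isT; rewrite big_seq1.
move=> uy.
have [|y yx|s1 e1] := K (fun y => Num.max (u y) 0); first by rewrite le_max lexx orbT.
  by rewrite uy// maxxx.
have [|y yx|s2 e2] := K (fun y => Num.max (- u y) 0); first by rewrite le_max lexx orbT.
  by rewrite uy// oppr0 maxxx.
rewrite (@rsum_split _ (fun y => Num.max (u y) 0) (fun y => Num.max (- u y) 0))//.
- by rewrite e1 e2 !maxEle; case: ifP; case: ifP; lra.
- by move=> y; rewrite le_max lexx orbT.
- by move=> y; rewrite le_max lexx orbT.
by move=> y; rewrite !maxEle; case: ifP; case: ifP; lra.
Qed.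

End NonnegativeSums.

(** * The Hilbert space structure of square summable functions *)

Section SquareSummable.
Variables (R : realType) (T : choiceType).
Local Notation C := R[i].
Implicit Types (f g h : T -> C) (X : seq T).

Local Notation summ a := (summable [set: T] (fun x => (a x)%:E)).
Local Notation tsum a := (fine (\esum_(x in [set: T]) (a x)%:E)).

Lemma ReD (z w : C) : complex.Re (z + w) = complex.Re z + complex.Re w.
Proof. by case: z => a b; case: w. Qed.
Lemma ImD (z w : C) : complex.Im (z + w) = complex.Im z + complex.Im w.
Proof. by case: z => a b; case: w. Qed.
Lemma ReM (z w : C) : complex.Re (z * w) =
  complex.Re z * complex.Re w - complex.Im z * complex.Im w.
Proof. by case: z => a b; case: w. Qed.
Lemma ImM (z w : C) : complex.Im (z * w) =
  complex.Re z * complex.Im w + complex.Im z * complex.Re w.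
Proof. by case: z => a b; case: w. Qed.

Lemma l2D f g : l2 f -> l2 g -> l2 (f + g).
Proof.
rewrite /l2 /= => sf sg.
apply: (@summ_le _ _ _ (fun x => 2 * normc (f x) ^+ 2 + 2 * normc (g x) ^+ 2)).
  move=> x; rewrite ger0_norm ?exprn_ge0 ?normc_ge0//.
  rewrite (@le_trans _ _ ((normc (f x) + normc (g x)) ^+ 2))//.
    by rewrite ler_pXn2r ?nnegrE ?addr_ge0 ?normc_ge0 ?normc_triangle.
  have : 0 <= (normc (f x) - normc (g x)) ^+ 2 by rewrite sqr_ge0.
  by rewrite sqrrB sqrrD; lra.
by apply: summD; apply: summZ.
Qed.

Lemma l2Z (c : C) f : l2 f -> l2 (c *: f).
Proof.
rewrite /l2 /= => sf.
apply: (@summ_le _ _ _ (fun x => normc c ^+ 2 * normc (f x) ^+ 2)).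
  by move=> x; rewrite ger0_norm ?exprn_ge0 ?normc_ge0// normc_mul exprMn.
exact: summZ.
Qed.

Lemma l2N f : l2 f -> l2 (- f).
Proof. by move=> /(@l2Z (-1)); rewrite scaleN1r. Qed.

Lemma l2B f g : l2 f -> l2 g -> l2 (f - g).
Proof. by move=> lf lg; apply: l2D => //; apply: l2N. Qed.

Lemma l20 : l2 (0 : T -> C).
Proof.
suff -> : (0 : T -> C) = fun=> 0.
  rewrite /l2 /= /summable esum1// => x _.
  by rewrite expr0n/= addr0 sqrtr0 expr0n/= normr0.
by [].
Qed.

Lemma l2_sum (I : Type) (s : seq I) (P : pred I) (F : I -> T -> C) :
  (forall i, P i -> l2 (F i)) -> l2 (\sum_(i <- s | P i) F i).
Proof.
move=> lF; elim: s => [|i s IH]; first by rewrite big_nil; apply: l20.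
by rewrite big_cons; case: ifP => // Pi; apply: l2D => //; apply: lF.
Qed.

Lemma l2_conj f : l2 f -> l2 (fun x => (f x)^*).
Proof. by rewrite /l2 /=; under [X in _ -> summable _ X]eq_fun do rewrite normc_conj. Qed.

Lemma l2_sumlub f M : (forall X, uniq X -> \sum_(x <- X) normc (f x) ^+ 2 <= M) ->
  l2 f /\ l2norm f ^+ 2 <= M.
Proof.
have P x : 0 <= normc (f x) ^+ 2 by rewrite exprn_ge0 ?normc_ge0.
move=> /(summ_lub P)[sf ?]; split=> //.
by rewrite sqr_sqrtr// tsum_ge0.
Qed.

Lemma l2norm_ge0 f : 0 <= l2norm f.
Proof. exact: sqrtr_ge0. Qed.

Lemma l2norm_sqr f : l2norm f ^+ 2 = tsum (fun x => normc (f x) ^+ 2).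
Proof. by rewrite sqr_sqrtr// tsum_ge0// => x; rewrite exprn_ge0 ?normc_ge0. Qed.

Lemma l2_sumub f X : l2 f -> uniq X -> \sum_(x <- X) normc (f x) ^+ 2 <= l2norm f ^+ 2.
Proof.
move=> lf uX; rewrite l2norm_sqr; apply: summ_ub => //.
by move=> x; rewrite exprn_ge0 ?normc_ge0.
Qed.

Lemma normc_le_l2norm f x : l2 f -> normc (f x) <= l2norm f.
Proof.
move=> lf; rewrite -(@ler_pXn2r _ 2) ?nnegrE ?normc_ge0 ?l2norm_ge0//.
by have := @l2_sumub f [:: x] lf isT; rewrite big_seq1.
Qed.

Lemma l2norm_eq0 f : l2 f -> l2norm f = 0 -> f = 0.
Proof.
move=> lf f0; apply/funext => x; apply: normc_eq0; apply/eqP.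
by rewrite eq_le normc_ge0 andbT -f0 normc_le_l2norm.
Qed.

Lemma summ_inner f g : l2 f -> l2 g ->
  summ (fun x => complex.Re (f x * (g x)^*)) /\
  summ (fun x => complex.Im (f x * (g x)^*)).
Proof.
rewrite /l2 /= => sf sg; have K x : normc (f x * (g x)^*) <= normc (f x) ^+ 2 + normc (g x) ^+ 2.
  rewrite normc_mul normc_conj.
  have : 0 <= (normc (f x) - normc (g x)) ^+ 2 by rewrite sqr_ge0.
  have : 0 <= normc (f x) ^+ 2 by rewrite sqr_ge0.
  have : 0 <= normc (g x) ^+ 2 by rewrite sqr_ge0.
  by rewrite sqrrB; lra.
split; apply: (summ_le _ (summD sf sg)) => x.
- exact: le_trans (Re_le_normc _) (K x).
- exact: le_trans (Im_le_normc _) (K x).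
Qed.

Lemma innerDl f g h : l2 f -> l2 g -> l2 h ->
  inner (f + g) h = inner f h + inner g h.
Proof.
move=> lf lg lh; have [r1 i1] := summ_inner lf lh; have [r2 i2] := summ_inner lg lh.
apply/eqP; rewrite eq_complex /= -!rsumD//.
by apply/andP; split; apply/eqP; congr rsum; apply/funext => x;
  rewrite mulrDl ?ReD ?ImD.
Qed.

Lemma innerZl (c : C) f g : l2 f -> l2 g -> inner (c *: f) g = c * inner f g.
Proof.
move=> lf lg; have [r1 i1] := summ_inner lf lg.
apply/eqP; rewrite eq_complex ReM ImM /=.
have K (a : R) u : summ u -> summ (fun x => a * u x) by apply: summZ.
rewrite -!rsumZ// -rsumN ?K// -!rsumD ?K//; last by apply/summN/K.
by apply/andP; split; apply/eqP; congr rsum; apply/funext => x;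
  rewrite -[(c *: f) x]/(c * f x) -mulrA; [exact: ReM|exact: ImM].
Qed.

Lemma innerC f g : l2 f -> l2 g -> inner g f = (inner f g)^*.
Proof.
move=> lf lg; have [r1 i1] := summ_inner lf lg.
apply/eqP; rewrite eq_complex /= -rsumN//.
apply/andP; split; apply/eqP; congr rsum; apply/funext => x;
  rewrite ?ReM ?ImM; case: (f x) => a b; case: (g x) => c d /=; ring.
Qed.

Lemma innerNl f g : l2 f -> l2 g -> inner (- f) g = - inner f g.
Proof. by move=> lf lg; rewrite -scaleN1r innerZl// mulN1r. Qed.

Lemma innerBl f g h : l2 f -> l2 g -> l2 h ->
  inner (f - g) h = inner f h - inner g h.
Proof. by move=> lf lg lh; rewrite innerDl ?innerNl//; apply: l2N. Qed.

Lemma innerDr f g h : l2 f -> l2 g -> l2 h ->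
  inner f (g + h) = inner f g + inner f h.
Proof.
move=> lf lg lh; rewrite innerC ?innerDl// ?rmorphD/=; last exact: l2D.
by rewrite -!innerC.
Qed.

Lemma innerZr (c : C) f g : l2 f -> l2 g -> inner f (c *: g) = c^* * inner f g.
Proof.
move=> lf lg; rewrite innerC// ?innerZl// ?rmorphM/=; last exact: l2Z.
by rewrite -!innerC.
Qed.

Lemma innerNr f g : l2 f -> l2 g -> inner f (- g) = - inner f g.
Proof. by move=> lf lg; rewrite -scaleN1r innerZr// rmorphN1 mulN1r. Qed.

Lemma innerBr f g h : l2 f -> l2 g -> l2 h ->
  inner f (g - h) = inner f g - inner f h.
Proof. by move=> lf lg lh; rewrite innerDr ?innerNr//; apply: l2N. Qed.

Lemma csum_eq0 f : (forall x, f x = 0) -> csum f = 0.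
Proof.
move=> f0; rewrite /csum; have -> : f = fun=> 0 by apply/funext.
by rewrite /= rsum0.
Qed.

Lemma inner0l f : inner 0 f = 0.
Proof. by apply: csum_eq0 => x; apply: mul0r. Qed.

Lemma inner0r f : inner f 0 = 0.
Proof. by apply: csum_eq0 => x; rewrite [X in X^*]/(0 : C) rmorph0 mulr0. Qed.

Lemma inner_suml (I : Type) (s : seq I) (P : pred I) (F : I -> T -> C) g :
  (forall i, P i -> l2 (F i)) -> l2 g ->
  inner (\sum_(i <- s | P i) F i) g = \sum_(i <- s | P i) inner (F i) g.
Proof.
move=> lF lg; elim: s => [|i s IH]; first by rewrite !big_nil inner0l.
rewrite !big_cons; case: ifP => // Pi; rewrite innerDl ?IH//; first exact: lF.
exact: l2_sum.
Qed.

Lemma inner_sumr (I : Type) (s : seq I) (P : pred I) (F : I -> T -> C) g :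
  (forall i, P i -> l2 (F i)) -> l2 g ->
  inner g (\sum_(i <- s | P i) F i) = \sum_(i <- s | P i) inner g (F i).
Proof.
move=> lF lg; elim: s => [|i s IH]; first by rewrite !big_nil inner0r.
rewrite !big_cons; case: ifP => // Pi; rewrite innerDr ?IH//; first exact: lF.
exact: l2_sum.
Qed.

Lemma inner_self f : l2 f -> inner f f = (l2norm f ^+ 2)%:C%C.
Proof.
move=> lf; rewrite l2norm_sqr /inner /csum; congr Complex.
  have -> : (fun x => complex.Re (f x * (f x)^*)) = fun x => normc (f x) ^+ 2.
    by apply/funext => x; rewrite mulc_conj.
  by rewrite rsum_ge0E// => x; rewrite exprn_ge0 ?normc_ge0.
by under eq_fun do rewrite mulc_conj; rewrite rsum0.
Qed.

Lemma inner_self_eq0 f : l2 f -> inner f f = 0 -> f = 0.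
Proof.
move=> lf; rewrite inner_self// => -[] /eqP.
by rewrite expf_eq0 /= => /eqP /(l2norm_eq0 lf).
Qed.

Lemma deltaxx (x : T) : delta R x x = 1 :> C.
Proof. by rewrite /delta eqxx. Qed.

Lemma delta_neq (x y : T) : y != x -> delta R x y = 0 :> C.
Proof. by rewrite /delta => /negbTE ->. Qed.

Lemma scale_fctE (c : C) f x : (c *: f) x = c * f x.
Proof. by []. Qed.

Lemma inner_delta f x : inner f (delta R x) = f x.
Proof.
rewrite /inner /csum (@rsum_supp1 _ _ _ x) ?(@rsum_supp1 _ _ _ x).
- by rewrite /delta eqxx rmorph1 mulr1; case: (f x).
- by move=> y yx; rewrite /delta (negbTE yx) rmorph0 mulr0.
- by move=> y yx; rewrite /delta (negbTE yx) rmorph0 mulr0.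
Qed.

Lemma delta_l2 x : l2 (delta R x : T -> C).
Proof.
suff K X : uniq X -> \sum_(y <- X) normc (delta R x y : C) ^+ 2 <= 1.
  exact: (l2_sumlub K).1.
move=> uX; have d y : y != x -> normc (delta R x y) ^+ 2 = 0 :> R.
  by move=> yx; rewrite /delta (negbTE yx) normc_zero expr0n.
have [xX|xX] := boolP (x \in X).
  rewrite (bigD1_seq x)//= big1 ?addr0//.
  by rewrite /delta eqxx Normc.normc1 expr1n.
rewrite big1_seq// => y /= yX; apply: d; apply: contraNneq xX => <- //.
Qed.

Lemma l2normN f : l2norm (- f) = l2norm f.
Proof.
rewrite /l2norm; congr (Num.sqrt (fine _)); apply: eq_esum => x _.
by rewrite -[(- f) x]/(- f x) normc_opp.
Qed.

Lemma l2normBC f g : l2norm (f - g) = l2norm (g - f).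
Proof. by rewrite -l2normN opprB. Qed.

Lemma l2norm0 : l2norm (0 : T -> C) = 0.
Proof.
have := inner_self l20; rewrite inner0l => -[] /esym/eqP.
by rewrite expf_eq0 => /eqP.
Qed.

Lemma l2normZ (c : C) f : l2 f -> l2norm (c *: f) = normc c * l2norm f.
Proof.
move=> lf; apply/eqP; rewrite -(@eqrXn2 _ 2) ?mulr_ge0 ?l2norm_ge0 ?normc_ge0//.
apply/eqP; apply: (@complexI R); rewrite -inner_self; last exact: l2Z.
rewrite innerZl ?innerZr ?inner_self//; last exact: l2Z.
by rewrite mulrA mulc_conj -rmorphM exprMn.
Qed.

Lemma l2norm_sqrD f g : l2 f -> l2 g ->
  l2norm (f + g) ^+ 2 = l2norm f ^+ 2 + l2norm g ^+ 2 + 2 * complex.Re (inner f g).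
Proof.
move=> lf lg; have lfg := l2D lf lg.
have := inner_self lfg; rewrite innerDl ?innerDr ?inner_self// (innerC lf lg).
by case: (inner f g) => a b; case=> <- _ /=; ring.
Qed.

Lemma l2norm_sqrB f g : l2 f -> l2 g ->
  l2norm (f - g) ^+ 2 = l2norm f ^+ 2 + l2norm g ^+ 2 - 2 * complex.Re (inner f g).
Proof.
move=> lf lg; rewrite l2norm_sqrD ?l2normN ?innerNr//; last exact: l2N.
by case: (inner f g) => a b /=; ring.
Qed.

Lemma pythagoras f g : l2 f -> l2 g -> inner f g = 0 ->
  l2norm (f + g) ^+ 2 = l2norm f ^+ 2 + l2norm g ^+ 2.
Proof. by move=> lf lg fg; rewrite l2norm_sqrD// fg mulr0 addr0. Qed.

(** The exact defect in the Cauchy-Schwarz inequality: the coefficient is that of the orthogonal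
    projection of [f] on the line of [g]. Nonnegativity of the left side gives the inequality; the
    identity also measures the gain of a projection step in [orthogonal_vector]. *)
Lemma l2norm_sqr_proj f g : l2 f -> l2 g -> l2norm g != 0 ->
  l2norm (f - (inner f g / (l2norm g ^+ 2)%:C%C) *: g) ^+ 2 =
  l2norm f ^+ 2 - normc (inner f g) ^+ 2 / l2norm g ^+ 2.
Proof.
move=> lf lg gN.
have gp : 0 < l2norm g by rewrite lt_def gN l2norm_ge0.
set z := inner f g; set n := l2norm g ^+ 2; set c := z / _.
have np : 0 < n by rewrite exprn_gt0.
have nC : n%:C%C != 0 :> C by rewrite (inj_eq (@complexI R) _ 0) gt_eqF.
rewrite l2norm_sqrB ?l2normZ//; last exact: l2Z.
have -> : normc c = normc z / n.
  by rewrite /c normc_mul Normc.normcV normc_real gtr0_norm.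
have cc : c^* = z^* * (n%:C%C)^-1.
  by rewrite /c rmorphM fmorphV; congr (_ * _^-1); exact: conjc_realE.
rewrite innerZr// -/z exprMn -/n cc.
have -> : z^* * n%:C%C^-1 * z = (normc z ^+ 2 / n)%:C%C.
  rewrite mulrAC [z^* * z]mulrC mulc_conj; apply: (mulIf nC).
  by rewrite mulfVK// -rmorphM/= mulfVK// gt_eqF.
by rewrite /=; have nN := gt_eqF np; field; exact/negbT.
Qed.

Lemma cauchy_schwarz f g : l2 f -> l2 g ->
  normc (inner f g) <= l2norm f * l2norm g.
Proof.
move=> lf lg; have [g0|gN] := eqVneq (l2norm g) 0.
  by rewrite (l2norm_eq0 lg g0) inner0r normc_zero l2norm0 mulr0.
have gp : 0 < l2norm g by rewrite lt_def gN l2norm_ge0.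
rewrite -(@ler_pXn2r _ 2) ?nnegrE ?mulr_ge0 ?l2norm_ge0 ?normc_ge0//.
rewrite exprMn -ler_pdivrMr ?exprn_gt0// -subr_ge0 -l2norm_sqr_proj//.
by rewrite exprn_ge0 ?l2norm_ge0.
Qed.

Lemma l2normD f g : l2 f -> l2 g -> l2norm (f + g) <= l2norm f + l2norm g.
Proof.
move=> lf lg; rewrite -(@ler_pXn2r _ 2) ?nnegrE ?addr_ge0 ?l2norm_ge0//.
rewrite l2norm_sqrD// sqrrD.
have := cauchy_schwarz lf lg; have := Re_le_normc (inner f g).
have := ler_norm (complex.Re (inner f g)); lra.
Qed.

Lemma l2normB f g : l2 f -> l2 g -> l2norm (f - g) <= l2norm f + l2norm g.
Proof. by move=> lf lg; rewrite -(l2normN g) l2normD//; apply: l2N. Qed.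

Lemma l2norm_dist g f h : l2 f -> l2 g -> l2 h ->
  l2norm (f - h) <= l2norm (f - g) + l2norm (g - h).
Proof.
move=> lf lg lh; have -> : f - h = (f - g) + (g - h) by rewrite addrA subrK.
by apply: l2normD; apply: l2B.
Qed.

Lemma le0_eps (a : R) : (forall e, 0 < e -> a <= e) -> a <= 0.
Proof. by move=> ae; apply/ler_addgt0Pr => e e0; rewrite add0r ae. Qed.

(** The squared distance from [f] to its restriction to [X] is the part of the sum that [X] misses,
    so [X] is taken to catch all but [e ^+ 2] of it. *)
Lemma finsupp_approx f e : l2 f -> 0 < e ->
  exists2 X : seq T, uniq X & l2norm (f - \sum_(x <- X) f x *: delta R x) < e.
Proof.
move=> lf e0; have P x : 0 <= normc (f x) ^+ 2 by rewrite exprn_ge0 ?normc_ge0.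
have [X uX XS] := summ_approx P lf (exprn_gt0 2 e0).
exists X => //; rewrite -(@ltr_pXn2r _ 2) ?nnegrE ?l2norm_ge0 ?ltW//.
set S := \sum_(x <- X) _.
have lS : l2 S by apply: l2_sum => x _; apply/l2Z/delta_l2.
have E : inner f S = \sum_(x <- X) (normc (f x) ^+ 2)%:C%C.
  rewrite inner_sumr//; last by move=> x _; apply/l2Z/delta_l2.
  apply: eq_bigr => x _; rewrite innerZr//; last exact: delta_l2.
  by rewrite inner_delta mulrC mulc_conj.
have SE x : x \in X -> S x = f x.
  move=> xX; rewrite /S -inner_delta inner_suml; last exact: delta_l2.
    rewrite (bigD1_seq x)//= big1 ?addr0.
      by rewrite inner_delta scale_fctE deltaxx mulr1.
    by move=> y yx; rewrite inner_delta scale_fctE delta_neq ?mulr0// eq_sym.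
  by move=> y _; apply/l2Z/delta_l2.
have E2 : inner S S = \sum_(x <- X) (normc (f x) ^+ 2)%:C%C.
  rewrite {2}/S inner_sumr//; last by move=> x _; apply/l2Z/delta_l2.
  rewrite !big_seq; apply: eq_bigr => x xX; rewrite innerZr//; last exact: delta_l2.
  by rewrite inner_delta SE// mulrC mulc_conj.
rewrite l2norm_sqrB// E -rmorph_sum/=.
have -> : l2norm S ^+ 2 = \sum_(x <- X) normc (f x) ^+ 2.
  by apply: (@complexI R); rewrite -inner_self// E2 rmorph_sum.
rewrite l2norm_sqr; move: XS; rewrite !ltrBDr; lra.
Qed.

End SquareSummable.

Arguments Normc.normc : simpl never.
Arguments inner : simpl never.
Arguments l2norm : simpl never.

(** * Subspaces, completeness and orthogonal complements *)

Section Subspaces.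
Variables (K : pzRingType) (V : lmodType K).
Implicit Types (S : set V) (u v : V).

Lemma subspaceP S : S 0 -> (forall c u v, S u -> S v -> S (c *: u + v)) ->
  linear_span S `<=` S.
Proof.
move=> S0 SD v [n [c [s [Ss ->]]]].
elim: n c s Ss => [|n IH] c s Ss; first by rewrite big_ord0.
rewrite big_ord_recl; apply: SD; first exact: Ss.
by apply: IH => i; apply: Ss.
Qed.

Lemma sub_linear_span S : S `<=` linear_span S.
Proof.
move=> v Sv; exists 1%N, (fun=> 1), (fun=> v); split => //.
by rewrite big_ord1 scale1r.
Qed.

Lemma subspace0 S : linear_span S `<=` S -> S 0.
Proof.
move=> SS; apply: SS; exists 0%N, (fun=> 0), (fun=> 0).
by split; [case|rewrite big_ord0].
Qed.

Lemma subspace_lin S c u v : linear_span S `<=` S -> S u -> S v -> S (c *: u + v).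
Proof.
move=> SS Su Sv; apply: SS.
exists 2%N, (fun i => if i == ord0 then c else 1), (fun i => if i == ord0 then u else v).
split; first by move=> i; case: ifP.
by rewrite big_ord_recl big_ord1 /= scale1r.
Qed.

Lemma subspaceD S u v : linear_span S `<=` S -> S u -> S v -> S (u + v).
Proof. by move=> SS Su Sv; rewrite -[u]scale1r; apply: subspace_lin. Qed.

Lemma subspaceZ S c u : linear_span S `<=` S -> S u -> S (c *: u).
Proof.
move=> SS Su; rewrite -[_ *: _]addr0; apply: subspace_lin => //.
exact: subspace0.
Qed.

Lemma subspaceB S u v : linear_span S `<=` S -> S u -> S v -> S (u - v).
Proof. by move=> SS Su Sv; rewrite addrC -scaleN1r; apply: subspace_lin. Qed.

Lemma subspace_sum S (I : eqType) (s : seq I) (F : I -> V) :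
  linear_span S `<=` S -> (forall i, i \in s -> S (F i)) -> S (\sum_(i <- s) F i).
Proof.
move=> SS SF; rewrite big_seq; apply: (big_ind S) => //; first exact: subspace0.
by move=> u v; apply: subspaceD.
Qed.

Lemma linear_span_subspace S : linear_span (linear_span S) `<=` linear_span S.
Proof.
apply: subspaceP.
  by exists 0%N, (fun=> 0), (fun=> 0); split; [case|rewrite big_ord0].
move=> c u v [n [a [s [Ss ->]]]] [m [b [t [St ->]]]].
exists (n + m)%N, (fun i => match fintype.split i with inl j => c * a j | inr j => b j end),
  (fun i => match fintype.split i with inl j => s j | inr j => t j end).
split; first by move=> i; case: (fintype.split i).
rewrite big_split_ord /= scaler_sumr; congr (_ + _); apply: eq_bigr => i _.
- by rewrite -[lshift m i]/(unsplit (inl i)) unsplitK scalerA.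
- by rewrite -[rshift n i]/(unsplit (inr i)) unsplitK.
Qed.

Lemma linear_span_min S S' : S `<=` S' -> linear_span S' `<=` S' ->
  linear_span S `<=` S'.
Proof.
move=> SS' S'S' v [n [c [s [Ss ->]]]]; apply: S'S'.
by exists n, c, s; split => // i; apply/SS'.
Qed.

Lemma linear_spanS S S' : S `<=` S' -> linear_span S `<=` linear_span S'.
Proof.
move=> SS' v [n [c [s [Ss ->]]]].
by exists n, c, s; split => // i; apply/SS'.
Qed.

(** Collects the coefficients of repeated vectors, because orthonormality can only be used on sums
    over distinct vectors. *)
Lemma linear_span_seq S v : linear_span S v ->
  exists (L : seq V) (c : V -> K),
    [/\ uniq L, forall u, u \in L -> S u & v = \sum_(u <- L) c u *: u].
Proof.
move=> [n [c [s [Ss ->]]]].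
exists (undup [seq s i | i <- enum 'I_n]), (fun u => \sum_(i < n | s i == u) c i).
split; first exact: undup_uniq.
  by move=> u; rewrite mem_undup => /mapP[i _ ->].
under [RHS]eq_bigr do rewrite scaler_suml.
rewrite [RHS](exchange_big_dep xpredT) //=; apply: eq_bigr => i _.
rewrite big_mkcond (bigD1_seq (s i)) ?undup_uniq//=; last first.
  by rewrite mem_undup; apply: map_f; rewrite mem_enum.
rewrite eqxx big1 ?addr0// => u us.
by rewrite eq_sym (negbTE us).
Qed.

End Subspaces.

Section Completeness.
Variables (R : realType) (T : choiceType).
Local Notation C := R[i].
Implicit Types (f g h : T -> C) (F : nat -> T -> C).

Lemma real_cauchy_cvg (u : nat -> R) :
  (forall e : R, 0 < e -> exists N, forall n, (N <= n)%N -> `|u N - u n| < e) ->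
  exists l, forall e : R, 0 < e -> exists N, forall n, (N <= n)%N -> `|l - u n| < e.
Proof.
move=> cu.
have /cvg_ex [l ul] : cvg (u @ \oo).
  apply: cauchy_cvg; apply: cauchy_exP => e /= e0.
  have [N uN] := cu e e0; by exists (u N); exists N.
exists l => e e0; move/cvgrPdist_lt: ul => /(_ e e0)[N _ uN].
by exists N => n Nn; apply: uN.
Qed.

Lemma normc_le_ReIm (z : C) : normc z <= `|complex.Re z| + `|complex.Im z|.
Proof.
rewrite -(@ler_pXn2r _ 2) ?nnegrE ?addr_ge0 ?normr_ge0 ?normc_ge0//.
rewrite sqr_normcE sqrrD !real_normK ?num_real// lerD2r lerDl.
by rewrite mulrn_wge0// mulr_ge0.
Qed.

Lemma complex_cauchy_cvg (u : nat -> C) :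
  (forall e : R, 0 < e -> exists N, forall n, (N <= n)%N -> normc (u N - u n) < e) ->
  exists l, forall e : R, 0 < e -> exists N, forall n, (N <= n)%N -> normc (l - u n) < e.
Proof.
move=> cu.
have [a ua] : exists a, forall e : R, 0 < e ->
    exists N, forall n, (N <= n)%N -> `|a - complex.Re (u n)| < e.
  apply: real_cauchy_cvg => e /cu[N uN]; exists N => n /uN.
  apply: le_lt_trans; apply: le_trans (Re_le_normc _).
  by case: (u N) => x y; case: (u n).
have [b ub] : exists b, forall e : R, 0 < e ->
    exists N, forall n, (N <= n)%N -> `|b - complex.Im (u n)| < e.
  apply: real_cauchy_cvg => e /cu[N uN]; exists N => n /uN.
  apply: le_lt_trans; apply: le_trans (Im_le_normc _).
  by case: (u N) => x y; case: (u n).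
exists (Complex a b) => e e0; have e2 : 0 < e / 2 by rewrite divr_gt0.
have [N uN] := ua _ e2; have [M uM] := ub _ e2.
exists (maxn N M) => n; rewrite geq_max => /andP[/uN h1 /uM h2].
apply: le_lt_trans (normc_le_ReIm _) _.
by case: (u n) h1 h2 => x y /=; lra.
Qed.

Definition l2cvg F f := forall e : R, 0 < e ->
  exists N, forall n, (N <= n)%N -> l2norm (F n - f) < e.

(** A bound on a finite sum survives coordinatewise convergence. Applied to every finite set, this
    plays the part of Fatou's lemma in the proof of completeness. *)
Lemma fin_sum_limit_le (X : seq T) F f g (M : R) (N : nat) :
  (forall x (e : R), 0 < e -> exists N, forall n, (N <= n)%N -> normc (f x - F n x) < e) ->
  (forall n, (N <= n)%N -> \sum_(x <- X) normc (g x - F n x) ^+ 2 <= M) ->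
  \sum_(x <- X) normc (g x - f x) ^+ 2 <= M.
Proof.
move=> Ff FM; pose u n := \sum_(x <- X) normc (g x - F n x) ^+ 2.
apply: (@cvgr_to_le _ \oo _ R u).
  rewrite /u; elim: X {FM u} => [|x X IH].
    rewrite big_nil; under eq_fun do rewrite big_nil; exact: cvg_cst.
  rewrite big_cons; under eq_fun do rewrite big_cons.
  apply: cvgD => //.
  suff K : (normc (g x - F n x))@[n --> \oo] --> normc (g x - f x).
    by rewrite expr2; under eq_fun do rewrite expr2; apply: cvgM.
  apply/cvgrPdist_lt => e e0; have [k Fk] := Ff x e e0.
  exists k => // n /= /Fk; apply: le_lt_trans.
  have D (a b : C) : normc a - normc b <= normc (a - b).
    by rewrite lerBlDr -{1}(subrK b a) normc_triangle.
  rewrite ler_norml; apply/andP; split.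
    rewrite lerNl opprB; apply: le_trans (D _ _) _.
    by rewrite opprB addrC subrKA.
  apply: le_trans (D _ _) _.
  by rewrite -normc_opp !opprB addrC addrA subrK.
by exists N.
Qed.

Lemma l2_complete F : (forall n, l2 (F n)) ->
  (forall e : R, 0 < e -> exists N, forall m n, (N <= m)%N -> (N <= n)%N ->
     l2norm (F m - F n) < e) ->
  exists2 f, l2 f & l2cvg F f.
Proof.
move=> lF cF.
have /choice[f Ff] : forall x, exists l, forall e : R, 0 < e ->
    exists N, forall n, (N <= n)%N -> normc (l - F n x) < e.
  move=> x; apply: complex_cauchy_cvg => e /cF[N FN]; exists N => n Nn.
  apply: le_lt_trans (FN N n (leqnn N) Nn).
  exact: (@normc_le_l2norm _ _ (F N - F n) x (l2B (lF N) (lF n))).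
have K (e : R) : 0 < e -> exists N, forall n, (N <= n)%N -> l2 (F n - f) /\ l2norm (F n - f) <= e.
  move=> e0; have [N FN] := cF e e0; exists N => n Nn.
  have [] // := @l2_sumlub _ _ (F n - f) (e ^+ 2).
    move=> X uX; apply: (@fin_sum_limit_le _ F f (F n) _ N) => //.
    move=> m Nm; apply: le_trans (_ : l2norm (F n - F m) ^+ 2 <= _).
      by apply: (@l2_sumub _ _ (F n - F m)) => //; apply: l2B.
    by rewrite ler_pXn2r ?nnegrE ?l2norm_ge0 ?ltW// FN.
  move=> lN eN; split; first exact: lN.
  by rewrite -(@ler_pXn2r _ 2) ?nnegrE ?l2norm_ge0 ?(ltW e0).
have lf : l2 f.
  have [N /(_ N (leqnn N)) [lN _]] := K 1 ltr01.
  by have := l2B (lF N) lN; rewrite opprB addrC subrK.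
exists f => // e e0; have e2 : 0 < e / 2 by rewrite divr_gt0.
have [N FN] := K _ e2; exists N => n /FN[_]; lra.
Qed.

Lemma l2cvg_inner F f g : (forall n, l2 (F n)) -> l2 f -> l2 g -> l2cvg F f ->
  forall e : R, 0 < e -> exists N, forall n, (N <= n)%N ->
    normc (inner (F n) g - inner f g) < e.
Proof.
move=> lF lf lg Ff e e0.
have p : 0 < l2norm g + 1 by rewrite ltr_wpDl// l2norm_ge0.
have [N FN] := Ff _ (divr_gt0 e0 p); exists N => n /FN.
rewrite ltr_pdivlMr// => h; rewrite -innerBl//.
apply: le_lt_trans (cauchy_schwarz (l2B (lF n) lf) lg) (le_lt_trans _ h).
by rewrite ler_wpM2l ?l2norm_ge0// lerDl.
Qed.

Lemma normc_eps_eq (z w : C) : (forall e : R, 0 < e -> normc (z - w) <= e) -> z = w.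
Proof.
move=> h; apply/eqP; rewrite -subr_eq0; apply/eqP; apply: normc_eq0; apply/eqP.
by rewrite eq_le normc_ge0 andbT le0_eps.
Qed.

Lemma l2norm_eps_eq f g : l2 f -> l2 g ->
  (forall e : R, 0 < e -> l2norm (f - g) <= e) -> f = g.
Proof.
move=> lf lg h; apply/eqP; rewrite -subr_eq0; apply/eqP; apply: l2norm_eq0.
  exact: l2B.
by apply/eqP; rewrite eq_le l2norm_ge0 andbT le0_eps.
Qed.

End Completeness.

Section Closures.
Variables (R : realType) (T : choiceType).
Local Notation C := R[i].
Implicit Types (f g h : T -> C) (S M : set (T -> C)).

Lemma sub_l2_closure S : S `<=` @l2 R T -> S `<=` l2_closure S.
Proof.
move=> Sl f Sf; split; first exact: Sl.
by move=> e e0; exists f => //; rewrite subrr l2norm0.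
Qed.

Lemma l2_closureS S S' : S `<=` S' -> l2_closure S `<=` l2_closure S'.
Proof.
move=> SS f [lf cf]; split=> // e /cf[g Sg fg]; exists g => //.
exact: SS.
Qed.

Lemma l2_closure_closed S : S `<=` @l2 R T ->
  l2_closure (l2_closure S) `<=` l2_closure S.
Proof.
move=> Sl f [lf cf]; split=> // e e0; have e2 : 0 < e / 2 by rewrite divr_gt0.
have [g [lg cg] fg] := cf _ e2; have [h Sh gh] := cg _ e2.
exists h => //; apply: le_lt_trans (l2norm_dist lf lg (Sl _ Sh)) _; lra.
Qed.

Lemma l2_closure_subspace S : S `<=` @l2 R T -> linear_span S `<=` S ->
  linear_span (l2_closure S) `<=` l2_closure S.
Proof.
move=> Sl SS; apply: subspaceP.
  by apply: sub_l2_closure => //; apply: subspace0.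
move=> c u v [lu cu] [lv cv]; split; first by apply: l2D => //; apply: l2Z.
move=> e e0; have p : 0 < normc c + 1 by rewrite ltr_wpDl// normc_ge0.
have e2 : 0 < e / 2 by rewrite divr_gt0.
have [u' Su uu] := cu _ (divr_gt0 e2 p); have [v' Sv vv] := cv _ e2.
have lu' := Sl _ Su; have lv' := Sl _ Sv.
exists (c *: u' + v'); first exact: subspace_lin.
rewrite opprD addrACA -scalerBr.
apply: le_lt_trans (l2normD (l2Z c (l2B lu lu')) (l2B lv lv')) _.
rewrite l2normZ; last exact: l2B.
move: uu; rewrite ltr_pdivlMr// mulrDr mulr1 => uu.
have := l2norm_ge0 (u - u'); rewrite mulrC; lra.
Qed.

Lemma l2_closure_inner0 S h : S `<=` @l2 R T -> l2 h ->
  (forall g, S g -> inner g h = 0) -> forall f, l2_closure S f -> inner f h = 0.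
Proof.
move=> Sl lh Sh f [lf cf]; apply: normc_eps_eq => e e0; rewrite subr0.
have p : 0 < l2norm h + 1 by rewrite ltr_wpDl// l2norm_ge0.
have [g Sg fg] := cf _ (divr_gt0 e0 p); have lg := Sl _ Sg.
have -> : inner f h = inner (f - g) h by rewrite innerBl// (Sh g Sg) subr0.
apply: le_trans (cauchy_schwarz (l2B lf lg) lh) _.
move: fg; rewrite ltr_pdivlMr// => /ltW; apply: le_trans.
by rewrite ler_wpM2l ?l2norm_ge0// lerDl.
Qed.

Lemma subspace_inner0 (h : T -> C) : l2 h ->
  linear_span [set f | l2 f /\ inner f h = 0] `<=` [set f | l2 f /\ inner f h = 0].
Proof.
move=> lh; apply: subspaceP; first by split; [exact: l20|rewrite inner0l].
move=> c u v [lu uh] [lv vh]; split; first by apply: l2D => //; apply: l2Z.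
by rewrite innerDl ?innerZl ?uh ?vh ?mulr0 ?addr0//; apply: l2Z.
Qed.

Lemma l2_span S : S `<=` @l2 R T -> linear_span S `<=` @l2 R T.
Proof.
move=> Sl; apply: linear_span_min => //; apply: subspaceP; first exact: l20.
by move=> c u v lu lv; apply: l2D => //; apply: l2Z.
Qed.

Lemma span_inner0 S h : S `<=` @l2 R T -> l2 h ->
  (forall g, S g -> inner g h = 0) -> forall f, linear_span S f -> inner f h = 0.
Proof.
move=> Sl lh Sh f Sf.
have [] // := @linear_span_min _ _ S [set f | l2 f /\ inner f h = 0] _ (subspace_inner0 lh) f Sf.
by move=> g Sg; split; [exact: Sl|exact: Sh].
Qed.

Lemma l2_invSn (e : R) : 0 < e -> exists N, forall n, (N <= n)%N -> n.+1%:R^-1 < e.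
Proof.
move=> e0; exists (Num.bound e^-1) => n Nn.
rewrite invf_plt ?posrE ?ltr0n//.
have := archi_boundP (ltW (_ : 0 < e^-1)); rewrite invr_gt0 => /(_ e0) h.
by apply: lt_le_trans h _; rewrite ler_nat (leq_trans Nn).
Qed.

(* The distance from h to M is approached by a Cauchy sequence of M, whose
   limit differs from h by a vector orthogonal to M. *)
Lemma orthogonal_vector M h : M `<=` @l2 R T -> linear_span M `<=` M ->
  l2_closure M `<=` M -> l2 h -> ~ M h ->
  exists u, [/\ l2 u, u <> 0 & forall m, M m -> inner m u = 0].
Proof.
move=> Ml MM Mc lh Mh.
pose q m := l2norm (h - m) ^+ 2.
pose s := inf [set q m | m in M].
have hlb : has_lbound [set q m | m in M].
  by exists 0 => _ [m _ <-]; rewrite exprn_ge0 ?l2norm_ge0.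
have hi : has_inf [set q m | m in M].
  by split=> //; exists (q 0), 0 => //; apply: subspace0.
have sq m : M m -> s <= q m.
  by move=> Mm; apply: ge_inf => //; exists m.
have /choice[m mP] : forall n : nat, exists m, M m /\ q m < s + n.+1%:R^-1.
  move=> n; have n0 : 0 < n.+1%:R^-1 :> R by rewrite invr_gt0 ltr0n.
  by have [_ [m Mm <-] lt] := inf_adherent n0 hi; exists m.
have Mm n : M (m n) by case: (mP n).
have lm n : l2 (m n) by apply: Ml.
have qm n : q (m n) < s + n.+1%:R^-1 by case: (mP n).
(* Parallelogram law: the midpoint of [a] and [b] lies in [M], hence at squared distance at least
   [s] from [h]. *)
have par a b : M a -> M b -> l2norm (a - b) ^+ 2 <= 2 * q a + 2 * q b - 4 * s.
  move=> Ma Mb; have la := Ml _ Ma; have lb := Ml _ Mb.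
  have lha := l2B lh la; have lhb := l2B lh lb.
  have := sq (2^-1 *: (a + b)) (subspaceZ _ MM (subspaceD MM Ma Mb)).
  have e1 : h - 2^-1 *: (a + b) = 2^-1 *: ((h - a) + (h - b)).
    apply/funext => x; rewrite -[LHS]/(h x - 2^-1 * (a x + b x)).
    by rewrite -[RHS]/(2^-1 * ((h x - a x) + (h x - b x))); field.
  have e2 : a - b = (h - b) - (h - a) by rewrite opprB [RHS]addrC addrA subrK.
  have n2 : normc (2^-1 : C) ^+ 2 = 4^-1.
    have -> : (2^-1 : C) = (2^-1 : R)%:C%C.
      by rewrite fmorphV; congr (_^-1); rewrite -[2%:R in RHS]/(1 + 1) rmorphD.
    by rewrite normc_real gtr0_norm ?invr_gt0// exprVn; congr (_^-1); ring.
  have -> : q (2^-1 *: (a + b)) =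
      4^-1 * (q a + q b + 2 * complex.Re (inner (h - a) (h - b))).
    rewrite /q e1 (l2normZ _ (l2D lha lhb)) exprMn n2.
    by rewrite (l2norm_sqrD lha lhb).
  have -> : l2norm (a - b) ^+ 2 = q b + q a - 2 * complex.Re (inner (h - a) (h - b)).
    rewrite e2 (l2norm_sqrB lhb lha) (innerC lha lhb) /q.
    by congr (_ - 2 * _); case: (inner _ _).
  lra.
have [f lf mf] : exists2 f, l2 f & l2cvg m f.
  apply: l2_complete => // e e0.
  have [N HN] := l2_invSn (divr_gt0 (exprn_gt0 2 e0) (ltr0n R 4)).
  exists N => i j /HN hi' /HN hj.
  rewrite -(@ltr_pXn2r _ 2) ?nnegrE ?l2norm_ge0 ?ltW//.
  apply: le_lt_trans (par _ _ (Mm i) (Mm j)) _.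
  have := qm i; have := qm j; move: hi' hj.
  by move: (i.+1%:R^-1) (j.+1%:R^-1) (q (m i)) (q (m j)) (e ^+ 2) => *; lra.
have Mf : M f.
  apply: Mc; split=> // e /mf[N /(_ N (leqnn N)) mN].
  by exists (m N) => //; rewrite l2normBC.
exists (h - f); split; first exact: l2B.
  by move=> /eqP; rewrite subr_eq0 => /eqP hf; apply: Mh; rewrite hf.
move=> v Mv; have lv := Ml _ Mv; have lhf := l2B lh lf.
have [v0|vN] := eqVneq (l2norm v) 0; first by rewrite (l2norm_eq0 lv v0) inner0l.
have vp : 0 < l2norm v by rewrite lt_def vN l2norm_ge0.
rewrite innerC//; apply/eqP; rewrite conjC_eq0; apply/eqP.
(* Moving [m n] along [v] to the optimal point stays in [M], so it cannot lower the squared distance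
   below [s]; the gain is at most the slack of [m n]. *)
have K n : normc (inner (h - m n) v) ^+ 2 <= l2norm v ^+ 2 * n.+1%:R^-1.
  rewrite -ler_pdivrMl ?exprn_gt0// mulrC.
  have := l2norm_sqr_proj (l2B lh (lm n)) lv vN.
  set c := (_ / _) => E.
  have := sq (m n + c *: v) (subspaceD MM (Mm n) (subspaceZ _ MM Mv)).
  by rewrite {1}/q opprD addrA E; have := qm n; rewrite /q;
    move: (_ / l2norm v ^+ 2) (n.+1%:R^-1) => x t; lra.
apply: normc_eps_eq => e e0; rewrite subr0.
have e2 : 0 < e / 2 by rewrite divr_gt0.
have [N1 H1] := l2_invSn (divr_gt0 (exprn_gt0 2 e2) (exprn_gt0 2 vp)).
have [N2 H2] := mf _ (divr_gt0 e2 vp).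
pose n := maxn N1 N2.
have h1 := H1 n (leq_maxl _ _); have h2 := H2 n (leq_maxr _ _).
have -> : h - f = (h - m n) + (m n - f) by rewrite addrA subrK.
rewrite innerDl//; try exact: l2B.
apply: le_trans (normc_triangle _ _) _.
have -> : e = e / 2 + e / 2 by rewrite -splitr.
apply: lerD.
  rewrite -(@ler_pXn2r R 2) ?nnegrE ?normc_ge0 ?(ltW e2)//.
  have := K n => /le_trans; apply; rewrite mulrC -ler_pdivlMr ?exprn_gt0//.
  exact: ltW.
apply: le_trans (cauchy_schwarz (l2B (lm n) lf) lv) _.
by rewrite -ler_pdivlMr// ltW.
Qed.

(** The annihilator test for density: a vector outside the closed span would yield, by
    [orthogonal_vector], a nonzero vector orthogonal to [S]. *)
Lemma l2_total S : S `<=` @l2 R T ->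
  (forall u, l2 u -> (forall f, S f -> inner f u = 0) -> u = 0) ->
  @l2 R T `<=` l2_closure (linear_span S).
Proof.
move=> Sl S0 h lh; apply: contrapT => Nh.
have Ll := l2_span Sl.
have Cl : l2_closure (linear_span S) `<=` @l2 R T by move=> f [].
have CC := l2_closure_subspace Ll (@linear_span_subspace _ _ S).
have [u [lu uN uS]] := orthogonal_vector Cl CC (l2_closure_closed Ll) lh Nh.
apply: uN; apply: S0 => // f Sf; apply: uS.
by apply: sub_l2_closure => //; apply: sub_linear_span.
Qed.

Lemma finsupp_dense : @l2 R T `<=` l2_closure (linear_span (range (@delta R T))).
Proof.
apply: l2_total; first by move=> _ [x _ <-]; apply: delta_l2.
move=> u lu Hu; apply/funext => x; rewrite -inner_delta.
rewrite innerC//; last exact: delta_l2.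
by rewrite Hu ?rmorph0//; exists x.
Qed.

End Closures.

(** * Symmetric and selfadjoint operators *)

Section Operators.
Variables (R : realType) (T : choiceType).
Local Notation C := R[i].
Local Notation L2 := (@l2 R T).
Implicit Types (f g h u : T -> C) (A S : graph R T) (z : C).

Definition symmetric A := forall p q, A p -> A q -> inner p.2 q.1 = inner p.1 q.2.

(** Vanishing of the deficiency space [ker (A^* - z)], whose dimensions at [i] and [-i] are the
    deficiency indices. *)
Definition deficiency_trivial A z :=
  forall u, l2 u -> adjoint L2 A (u, z *: u) -> u = 0.

Lemma adjoint_subspace (H : set (T -> C)) A : H `<=` L2 -> linear_span H `<=` H ->
  A `<=` L2 `*` L2 -> linear_span (adjoint H A) `<=` adjoint H A.
Proof.
move=> Hl HH Al; apply: subspaceP.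
  by split; [exact: subspace0|exact: subspace0|move=> q _; rewrite !inner0r].
move=> c [u1 u2] [v1 v2] [/= hu1 hu2 uA] [/= hv1 hv2 vA].
have [lu1 lu2 lv1 lv2] := And4 (Hl _ hu1) (Hl _ hu2) (Hl _ hv1) (Hl _ hv2).
split; [exact: subspace_lin|exact: subspace_lin|move=> q Aq /=].
have [lq1 lq2] := Al _ Aq.
by rewrite !innerDr ?innerZr ?uA ?vA//; apply: l2Z.
Qed.

Lemma adjoint_closed A : A `<=` L2 `*` L2 ->
  op_closure (adjoint L2 A) `<=` adjoint L2 A.
Proof.
move=> Al [f g] [/= lf lg cfg]; split=> // q Aq; have [lq1 lq2] := Al _ Aq.
apply: normc_eps_eq => e e0 /=.
(* The errors below get multiplied by the norms of [q.1] and [q.2]; the added 1 keeps [M]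
   positive. *)
pose M := l2norm q.1 + l2norm q.2 + 1.
have Mp : 0 < M by rewrite ltr_wpDl// addr_ge0 ?l2norm_ge0.
have [[f' g'] [/= lf' lg' /(_ q Aq) /= E] [/= ff gg]] := cfg _ (divr_gt0 e0 Mp).
rewrite [X in normc X](_ : _ = inner q.2 (f - f') - inner q.1 (g - g')); last first.
  by rewrite !innerBr// E opprB addrA subrK.
apply: le_trans (normc_triangle _ _) _; rewrite normc_opp.
have := cauchy_schwarz lq2 (l2B lf lf'); have := cauchy_schwarz lq1 (l2B lg lg').
have h1 := ler_wpM2l (l2norm_ge0 q.2) (ltW ff).
have h2 := ler_wpM2l (l2norm_ge0 q.1) (ltW gg).
have eM : e = (e / M) * l2norm q.1 + (e / M) * l2norm q.2 + e / M.
  by rewrite -!mulrDr -[X in _ + X]mulr1 -!mulrDr divfK// gt_eqF.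
have := divr_gt0 e0 Mp; lra.
Qed.

Lemma op_closure_sub A : op_closure A `<=` L2 `*` L2.
Proof. by move=> p []. Qed.

Lemma sub_op_closure A : A `<=` L2 `*` L2 -> A `<=` op_closure A.
Proof.
move=> Al p Ap; have [l1 l2'] := Al _ Ap; split=> // e e0; exists p => //.
by rewrite !subrr l2norm0.
Qed.

Lemma op_closureS A B : A `<=` B -> op_closure A `<=` op_closure B.
Proof.
move=> AB p [l1 l2' pA]; split=> // e /pA[q Aq pq].
by exists q => //; apply: AB.
Qed.

Lemma op_closure_closed A : A `<=` L2 `*` L2 ->
  op_closure (op_closure A) `<=` op_closure A.
Proof.
move=> Al p [lp1 lp2 cp]; split=> // e e0; have e2 : 0 < e / 2 by rewrite divr_gt0.
have [q [lq1 lq2 cq] [pq1 pq2]] := cp _ e2; have [r Ar [qr1 qr2]] := cq _ e2.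
have [lr1 lr2] := Al _ Ar; exists r => //; split.
- apply: le_lt_trans (l2norm_dist lp1 lq1 lr1) _; lra.
- apply: le_lt_trans (l2norm_dist lp2 lq2 lr2) _; lra.
Qed.

Lemma op_closure_subspace A : A `<=` L2 `*` L2 -> linear_span A `<=` A ->
  linear_span (op_closure A) `<=` op_closure A.
Proof.
move=> Al AA; apply: subspaceP.
  by apply: sub_op_closure => //; apply: subspace0.
move=> c [u1 u2] [v1 v2] [/= lu1 lu2 cu] [/= lv1 lv2 cv].
split; [by apply: l2D => //; apply: l2Z|by apply: l2D => //; apply: l2Z|].
move=> e e0; have p : 0 < normc c + 1 by rewrite ltr_wpDl// normc_ge0.
have e2 : 0 < e / 2 by rewrite divr_gt0.
have [u' Au [uu1 uu2]] := cu _ (divr_gt0 e2 p); have [v' Av [vv1 vv2]] := cv _ e2.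
have [[lu'1 lu'2] [lv'1 lv'2]] := conj (Al _ Au) (Al _ Av).
have K (a b a' b' : T -> C) : l2 a -> l2 b -> l2 a' -> l2 b' ->
    l2norm (a - a') < e / 2 / (normc c + 1) -> l2norm (b - b') < e / 2 ->
    l2norm (c *: a + b - (c *: a' + b')) < e.
  move=> la lb la' lb' aa bb.
  rewrite opprD addrACA -scalerBr.
  apply: le_lt_trans (l2normD (l2Z c (l2B la la')) (l2B lb lb')) _.
  rewrite l2normZ; last exact: l2B.
  move: aa; rewrite ltr_pdivlMr// mulrDr mulr1 => aa.
  by have := l2norm_ge0 (a - a'); rewrite mulrC; lra.
exists (c *: u' + v'); first exact: subspace_lin.
by split; apply: K.
Qed.

Lemma adjointS (H : set (T -> C)) A B : A `<=` B -> adjoint H B `<=` adjoint H A.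
Proof. by move=> AB p [h1 h2 pB]; split=> // q /AB/pB. Qed.

Lemma adjointP_sym A : symmetric A -> A `<=` L2 `*` L2 -> A `<=` adjoint L2 A.
Proof.
move=> sA Al p Ap; have [l1 l2'] := Al _ Ap; split=> // q Aq; exact: sA.
Qed.

(** The pairing identity for [p] and [q] says that [q] lies in the adjoint of the one-point graph of
    [p]. That adjoint is closed, so the identity passes from [A] to its closure. *)
Lemma adjoint_op_closure A : A `<=` L2 `*` L2 ->
  adjoint L2 (op_closure A) = adjoint L2 A.
Proof.
move=> Al; apply/seteqP; split; first exact/adjointS/sub_op_closure.
move=> p pA; have [lp1 lp2 _] := pA; split=> // q cq.
have [lq1 lq2 _] := cq.
have : adjoint L2 [set p] q.
  apply: adjoint_closed; first by move=> _ ->.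
  apply: op_closureS cq => r Ar; have [lr1 lr2] := Al _ Ar; split=> // _ ->.
  by case: pA => _ _ /(_ r Ar) E; rewrite innerC// -E -innerC.
case=> _ _ /(_ p erefl) E.
by rewrite innerC// -E -innerC.
Qed.

Lemma symmetric_op_closure A : A `<=` L2 `*` L2 -> symmetric A ->
  symmetric (op_closure A).
Proof.
move=> Al sA p q cp cq.
have : adjoint L2 (op_closure A) q.
  rewrite adjoint_op_closure//; apply: adjoint_closed => //.
  by apply: op_closureS cq; apply: adjointP_sym.
by case=> _ _; apply.
Qed.

(** Since [inner g f] is real and [z] purely imaginary, the cross term vanishes. This gives the
    resolvent bound at [i] and [-i]. *)
Lemma symmetric_norm f g z : l2 f -> l2 g -> inner g f = inner f g -> z^* = - z ->
  l2norm (g - z *: f) ^+ 2 = l2norm g ^+ 2 + normc z ^+ 2 * l2norm f ^+ 2.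
Proof.
move=> lf lg E zN; rewrite l2norm_sqrB ?l2normZ ?innerZr//; last exact: l2Z.
have : (inner g f)^* = inner g f by rewrite -innerC.
rewrite exprMn; case: z zN => a b; case: (inner g f) => x y.
move=> [] h1 [] h2; have {h1} -> : a = 0 by move: h1; lra.
have -> : y = 0 by move: h2; lra.
by rewrite /=; ring.
Qed.

Lemma sub_scale_l2 f g z : l2 f -> l2 g -> l2 (g - z *: f).
Proof. by move=> lf lg; apply: l2B => //; apply: l2Z. Qed.

(* The range of a closed symmetric operator shifted by an imaginary number is
   closed, because symmetric_norm bounds f by g - z f. *)
Lemma range_full A z : A `<=` L2 `*` L2 -> linear_span A `<=` A -> symmetric A ->
  op_closure A `<=` A -> z^* = - z -> normc z = 1 ->
  deficiency_trivial A z^* -> forall h, l2 h -> exists f, A (f, h + z *: f).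
Proof.
move=> Al AA sA cA zN z1 dA.
pose M := [set h | l2 h /\ exists f, A (f, h + z *: f)].
have bd f h : A (f, h + z *: f) -> l2 h -> l2norm f <= l2norm h.
  move=> Af lh; have [/= lf lg] := Al _ Af.
  rewrite -(@ler_pXn2r _ 2) ?nnegrE ?l2norm_ge0//.
  have := symmetric_norm lf lg (sA _ _ Af Af) zN.
  by rewrite addrK z1 expr1n mul1r => ->; rewrite lerDr exprn_ge0 ?l2norm_ge0.
have MM : linear_span M `<=` M.
  apply: subspaceP; first by split; [exact: l20|exists 0; rewrite scaler0 addr0; exact: (subspace0 AA)].
  move=> c u v [lu [f Af]] [lv [g Ag]]; split; first by apply: l2D => //; apply: l2Z.
  exists (c *: f + g); have := subspace_lin c AA Af Ag.
  congr A; congr pair; rewrite /= !scalerDr !scalerA addrACA.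
  by rewrite [z * c]mulrC.
have Mc : l2_closure M `<=` M.
  move=> h [lh ch]; split=> //.
  have /choice[k kP] : forall n : nat, exists k, M k /\ l2norm (h - k) < n.+1%:R^-1.
    move=> n; have n0 : 0 < n.+1%:R^-1 :> R by rewrite invr_gt0 ltr0n.
    by have [k Mk hk] := ch _ n0; exists k.
  have /choice[F FP] : forall n, exists f, A (f, k n + z *: f).
    by move=> n; have [[_ ?] _] := kP n.
  have lk n : l2 (k n) by case: (kP n) => -[].
  have lF n : l2 (F n) by have [] := Al _ (FP n).
  have [f lf cf] : exists2 f, l2 f & l2cvg F f.
    apply: l2_complete => // e e0; have [N HN] := l2_invSn (divr_gt0 e0 (ltr0n R 2)).
    exists N => m n /HN hm /HN hn.
    have : l2norm (F m - F n) <= l2norm (k m - k n).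
      apply: bd; last exact: l2B.
      have := subspaceB AA (FP m) (FP n); congr A; congr pair.
      by rewrite /= opprD addrACA scalerBr.
    have := l2norm_dist (lk m) lh (lk n).
    have [[_ h1] [_ h2]] := conj (kP m) (kP n).
    rewrite (l2normBC (k m) h) => a1 a2; move: h1 h2 hm hn a1 a2.
    by move: (m.+1%:R^-1) (n.+1%:R^-1) => x y; lra.
  exists f; apply: cA; split => //=; first by apply: l2D => //; apply: l2Z.
  move=> e e0; have e2 : 0 < e / 2 by rewrite divr_gt0.
  have [N1 H1] := l2_invSn e2; have [N2 H2] := cf _ e2.
  pose n := maxn N1 N2.
  have h1 := H1 n (leq_maxl _ _); have h2 := H2 n (leq_maxr _ _).
  have [_ h3] := kP n.
  exists (F n, k n + z *: F n); first exact: FP.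
  rewrite /= l2normBC; split; first by move: h2 e0; lra.
  rewrite opprD addrACA -scalerBr.
  apply: le_lt_trans (l2normD (l2B lh (lk n)) (l2Z z (l2B lf (lF n)))) _.
  rewrite l2normZ ?z1 ?mul1r; last exact: l2B.
  by rewrite (l2normBC f); move: h1 h2 h3; move: (n.+1%:R^-1) => x; lra.
move=> h lh; apply: contrapT => Nh.
have Ml : M `<=` L2 by move=> ? [].
have NM : ~ M h by move=> [_ ?].
have [u [lu u0 uM]] := orthogonal_vector Ml MM Mc lh NM.
apply/u0/dA => //; split => //=; first exact: l2Z.
move=> [f g] Aq /=; have [/= lf lg] := Al _ Aq.
have : inner (g - z *: f) u = 0.
  apply: uM; split; first exact: sub_scale_l2.
  by exists f; rewrite subrK.
rewrite innerBl//; last exact: l2Z.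
rewrite innerZl// innerZr// => /eqP; rewrite subr_eq0 => /eqP ->.
by rewrite -[X in X * _ = _]conjCK.
Qed.

(** Trivial deficiency at [-i] makes the closure minus [i] surjective. For [(f, g)] in the adjoint,
    a preimage [f1] of [g - i f] differs from [f] by a deficiency vector at [i], which vanishes; so
    [f] was already in the domain of the closure. *)
Lemma selfadjoint_criterion S : S `<=` L2 `*` L2 -> linear_span S `<=` S ->
  symmetric S -> L2 `<=` l2_closure (domain S) ->
  deficiency_trivial S 'i%C -> deficiency_trivial S (- 'i%C) ->
  selfadjoint L2 (op_closure S).
Proof.
move=> Sl SS sS dS d1 d2.
have cl := @op_closure_sub S; have cS := op_closure_subspace Sl SS.
have sc := symmetric_op_closure Sl sS; have ss := sub_op_closure Sl.
have dom_l2 : domain S `<=` L2 by move=> f [g /Sl[]].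
split.
- split=> // f g h Cg Ch; have [/= lf lg] := cl _ Cg; have [/= _ lh] := cl _ Ch.
  apply/eqP; rewrite -subr_eq0; apply/eqP.
  have lgh := l2B lg lh.
  apply: inner_self_eq0 => //; apply: (l2_closure_inner0 dom_l2 lgh _ (dS _ lgh)).
  move=> k [k' Sk]; have [/= lk lk'] := Sl _ Sk.
  have E1 := sc _ _ (ss _ Sk) Cg; have E2 := sc _ _ (ss _ Sk) Ch.
  by rewrite innerBr//= -E1 -E2 subrr.
- by apply: subset_trans dS (l2_closureS _) => f [g Sf]; exists g; apply: ss.
apply/seteqP; split; last exact: adjointP_sym.
move=> [f g] Cfg; have [/= lf lg _] := Cfg.
have iN := conjc_i R; have i1 := normc_i R.
have [|f1 Cf1] := range_full cl cS sc (op_closure_closed Sl) iN i1 _ (sub_scale_l2 'i%C lf lg).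
  by move=> u lu; rewrite iN adjoint_op_closure//; apply: d2.
have lf1 : l2 f1 by case: (cl _ Cf1).
suff E : f - f1 = 0.
  move/eqP: E Cf1; rewrite subr_eq0 => /eqP <-.
  by rewrite subrK.
apply: d1; first exact: l2B.
rewrite -adjoint_op_closure//.
have aS := adjoint_subspace (fun _ => id) (@l2_span _ _ L2 (fun _ => id)) cl.
have := subspaceB aS Cfg (adjointP_sym sc cl Cf1).
by congr (adjoint _ _ (_, _)); rewrite /= opprD opprB addrA [g + _]addrC subrK scalerBr.
Qed.

Section Selfadjoint.
Variable A : graph R T.
Hypothesis saA : selfadjoint L2 A.

Lemma selfadjoint_sub : A `<=` L2 `*` L2. Proof. by case: saA => -[]. Qed.

Lemma selfadjoint_subspace : linear_span A `<=` A. Proof. by case: saA => -[]. Qed.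

Lemma selfadjoint_adjoint : adjoint L2 A = A. Proof. by case: saA. Qed.

Lemma selfadjoint_symmetric : symmetric A.
Proof. by move=> p q Ap; rewrite -{1}selfadjoint_adjoint => -[_ _]; apply. Qed.

Lemma selfadjoint_closed : op_closure A `<=` A.
Proof.
by rewrite -{2}selfadjoint_adjoint -{1}selfadjoint_adjoint; apply/adjoint_closed/selfadjoint_sub.
Qed.

Lemma selfadjoint_eigenvalue_real f z : A (f, z *: f) -> f <> 0 -> z^* = z.
Proof.
move=> Af f0; have [/= lf _] := selfadjoint_sub Af.
have := selfadjoint_symmetric Af Af; rewrite /= innerZl ?innerZr// => /mulIf e; apply/esym/e.
by apply/eqP => /(inner_self_eq0 lf).
Qed.

Lemma selfadjoint_deficiency z : z^* <> z -> deficiency_trivial A z.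
Proof.
move=> zN u lu; rewrite selfadjoint_adjoint => Au; apply: contrapT => u0.
exact/zN/(selfadjoint_eigenvalue_real Au).
Qed.

Lemma selfadjoint_resolvent z : z^* = - z -> normc z = 1 ->
  forall h, l2 h -> exists f, A (f, h + z *: f).
Proof.
move=> zN z1; apply: range_full => //.
- exact: selfadjoint_sub.
- exact: selfadjoint_subspace.
- exact: selfadjoint_symmetric.
- exact: selfadjoint_closed.
apply: selfadjoint_deficiency; rewrite zN rmorphN/= zN opprK => zz.
have /eqP : z + z = 0 by rewrite {2}zz addrN.
rewrite -mulr2n mulrn_eq0 /= => /eqP z0.
by move: z1; rewrite z0 normc_zero => /esym/eqP; rewrite oner_eq0.
Qed.

End Selfadjoint.

End Operators.

(** * The topology of the complex numbers through the real-valued modulus *)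

Section ComplexTopology.
Variable R : realType.
Local Notation C := (R[i]).

(** Balls of [R[i]^o] have their radius in [R[i]]; a positive radius there is real, so real radii
    suffice. *)
Lemma nbhs_normcP (z : C^o) (V : set C^o) : nbhs z V <->
  exists2 e : R, 0 < e & forall w : C, normc (z - w) < e -> V w.
Proof.
split=> [/nbhs_ballP[e /= e0 eV]|[e e0 eV]].
  have [k ek] : exists k, e = k%:C%C by apply/complex_realP; rewrite gtr0_real.
  exists k; first by rewrite -ltcR -ek.
  by move=> w zw; apply: eV; rewrite /ball/= ek; rewrite -ltcR in zw.
apply/nbhs_ballP; exists e%:C%C; first by rewrite /= ltcR.
by move=> w; rewrite /ball/= => h; apply: eV; rewrite -ltcR.
Qed.

Lemma closure_normcP (S : set C^o) (z : C^o) : closure S z <->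
  forall e : R, 0 < e -> exists2 w : C, S w & normc (z - w) < e.
Proof.
split=> [cz e e0|h V /nbhs_normcP[e e0 eV]].
  have [|w [Sw zw]] := cz [set w | normc (z - w) < e]; last by exists w.
  by apply/nbhs_normcP; exists e.
by have [w Sw /eV Vw] := h e e0; exists w.
Qed.

End ComplexTopology.

(** * Diagonal operators *)

Section Diagonal.
Variables (R : realType) (T : choiceType).
Local Notation C := R[i].
Local Notation L2 := (@l2 R T).
Variables (H B : set (T -> C)) (mu : (T -> C) -> R).
Hypotheses (Hl : H `<=` L2) (HH : linear_span H `<=` H).
Hypothesis (Hc : l2_closure H `<=` H).
Hypotheses (BH : B `<=` H) (B1 : forall b, B b -> inner b b = 1).
Hypothesis (B0 : forall b c, B b -> B c -> b <> c -> inner b c = 0).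
Implicit Types (f g h b : T -> C) (L : seq (T -> C)) (c : (T -> C) -> C).

Let Bl b : B b -> l2 b. Proof. by move/BH/Hl. Qed.

Lemma orthonormal_comb_l2 L c : (forall b, b \in L -> B b) ->
  l2 (\sum_(b <- L) c b *: b).
Proof. by move=> LB; rewrite big_seq; apply: l2_sum => b /LB /Bl; apply: l2Z. Qed.

Lemma orthonormal_comb_inner L c b0 : uniq L -> (forall b, b \in L -> B b) ->
  B b0 -> inner (\sum_(b <- L) c b *: b) b0 = if b0 \in L then c b0 else 0.
Proof.
move=> uL LB Bb0; rewrite big_seq inner_suml; last exact: Bl.
  rewrite -big_seq; case: ifP => b0L.
    rewrite (bigD1_seq b0)//= innerZl ?(B1 Bb0) ?mulr1; try exact: Bl.
    rewrite big_seq_cond big1 ?addr0// => b /andP[bL /eqP bb].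
    have lb := Bl (LB _ bL); rewrite innerZl ?(B0 (LB _ bL) Bb0 bb) ?mulr0//.
    exact: Bl.
  rewrite big1_seq// => b /= bL; have lb := Bl (LB _ bL).
  rewrite innerZl ?(B0 (LB _ bL) Bb0) ?mulr0//; last exact: Bl.
  by move=> e; rewrite e b0L in bL.
by move=> b /LB /Bl; apply: l2Z.
Qed.

Lemma orthonormal_comb_norm L c : uniq L -> (forall b, b \in L -> B b) ->
  l2norm (\sum_(b <- L) c b *: b) ^+ 2 = \sum_(b <- L) normc (c b) ^+ 2.
Proof.
move=> uL LB; have lS := orthonormal_comb_l2 c LB.
apply: (@complexI R); rewrite -inner_self// rmorph_sum/=.
rewrite [X in inner _ X]big_seq inner_sumr//.
  rewrite -big_seq [LHS]big_seq [RHS]big_seq; apply: eq_bigr => b bL.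
  have lb := Bl (LB _ bL).
  rewrite innerZr// orthonormal_comb_inner//; last exact: LB.
  by rewrite bL mulrC mulc_conj.
by move=> b /LB /Bl; apply: l2Z.
Qed.

Lemma orthonormal_residual h L c : l2 h -> uniq L -> (forall b, b \in L -> B b) ->
  inner (h - \sum_(b <- L) inner h b *: b) (\sum_(b <- L) c b *: b) = 0.
Proof.
move=> lh uL LB; have l1 := orthonormal_comb_l2 (inner h) LB.
have lr := l2B lh l1.
rewrite [X in inner _ X]big_seq inner_sumr; last exact: lr.
  rewrite -big_seq big1_seq// => b /= bL; have lb := Bl (LB _ bL).
  rewrite innerZr// innerBl// orthonormal_comb_inner//; last exact: LB.
  by rewrite bL subrr mulr0.
by move=> b /LB /Bl; apply: l2Z.
Qed.

Lemma orthonormal_best_approx h L c : l2 h -> uniq L -> (forall b, b \in L -> B b) ->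
  l2norm (h - \sum_(b <- L) inner h b *: b) <= l2norm (h - \sum_(b <- L) c b *: b).
Proof.
move=> lh uL LB; have l1 := orthonormal_comb_l2 (inner h) LB.
have l3 := orthonormal_comb_l2 (fun b => inner h b - c b) LB.
have -> : h - \sum_(b <- L) c b *: b = (h - \sum_(b <- L) inner h b *: b) +
    \sum_(b <- L) (inner h b - c b) *: b.
  have -> : \sum_(b <- L) (inner h b - c b) *: b =
      \sum_(b <- L) inner h b *: b - \sum_(b <- L) c b *: b.
    by rewrite -sumrB; apply: eq_bigr => b _; rewrite scalerBl.
  by rewrite addrA subrK.
rewrite -(@ler_pXn2r _ 2) ?nnegrE ?l2norm_ge0//.
rewrite (pythagoras (l2B lh l1) l3); first by rewrite lerDl exprn_ge0 ?l2norm_ge0.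
exact: orthonormal_residual.
Qed.

Hypothesis BT : H `<=` l2_closure (linear_span B).

(** An approximating combination is padded with zero coefficients to any larger list and then
    improved to the Fourier sum over that list. Stability under enlargement is what later permits
    one list for two vectors. *)
Lemma total_approx h (e : R) : H h -> 0 < e ->
  exists L, [/\ uniq L, forall b, b \in L -> B b &
    forall L', uniq L' -> (forall b, b \in L' -> B b) -> {subset L <= L'} ->
      l2norm (h - \sum_(b <- L') inner h b *: b) < e].
Proof.
move=> Hh e0; have [lh cl] := BT Hh; have [g Bg hg] := cl _ e0.
have [L [c [uL LB gE]]] := linear_span_seq Bg.
exists L; split=> // L' uL' LB' LL'; apply: le_lt_trans hg; rewrite gE.
have -> : \sum_(b <- L) c b *: b = \sum_(b <- L') (if b \in L then c b else 0) *: b.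
  rewrite (perm_big [seq b <- L' | b \in L]) /=.
    rewrite big_filter big_mkcond; apply: eq_bigr => b _.
    by case: ifP => //; rewrite scale0r.
  apply: uniq_perm => //; first exact: filter_uniq.
  by move=> b; rewrite mem_filter; case: (boolP (b \in L)) => // /LL' ->.
exact: orthonormal_best_approx.
Qed.

Lemma total_approx2 g h (e : R) : H g -> H h -> 0 < e ->
  exists L, [/\ uniq L, forall b, b \in L -> B b,
    l2norm (g - \sum_(b <- L) inner g b *: b) < e &
    l2norm (h - \sum_(b <- L) inner h b *: b) < e].
Proof.
move=> Hg Hh e0; have [L1 [u1 B1' a1]] := total_approx Hg e0.
have [L2 [u2 B2' a2]] := total_approx Hh e0.
have LB b : b \in undup (L1 ++ L2) -> B b.
  by rewrite mem_undup mem_cat => /orP[/B1'|/B2'].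
exists (undup (L1 ++ L2)); split=> //; first exact: undup_uniq.
- by apply: a1 => // [|b bL]; rewrite ?undup_uniq// mem_undup mem_cat bL.
- by apply: a2 => // [|b bL]; rewrite ?undup_uniq// mem_undup mem_cat bL orbT.
Qed.

Lemma total_eq0 h : H h -> (forall b, B b -> inner h b = 0) -> h = 0.
Proof.
move=> Hh h0; apply: l2norm_eps_eq; [exact: Hl|exact: l20|move=> e e0].
have [L [uL LB /(_ L uL LB (fun _ => id)) hL]] := total_approx Hh e0.
have E : \sum_(b <- L) inner h b *: b = 0.
  by rewrite big1_seq// => b /= /LB /h0 ->; rewrite scale0r.
by apply/ltW; rewrite E in hL.
Qed.

(** The vector with coefficients [m b * inner h b] is a limit of finite sums. [B] comes without
    enumeration, so the sums run over lists [L n] adapted to [h]; two of them are compared on the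
    union of their lists, where the bound on [m] acts term by term. *)
Lemma diagonal_multiplier (m : (T -> C) -> C) (M : R) h : 0 <= M ->
  (forall b, B b -> normc (m b) <= M) -> H h ->
  exists f, [/\ H f, forall b, B b -> inner f b = m b * inner h b
              & l2norm f <= M * l2norm h].
Proof.
move=> M0 mM Hh; have lh := Hl Hh.
have /choice[L LP] : forall n : nat, exists L, [/\ uniq L, forall b, b \in L -> B b
    & l2norm (h - \sum_(b <- L) inner h b *: b) < n.+1%:R^-1].
  move=> n; have n0 : 0 < n.+1%:R^-1 :> R by rewrite invr_gt0 ltr0n.
  have [L [uL LB hL]] := total_approx Hh n0.
  by exists L; split=> //; apply: hL.
pose P n := \sum_(b <- L n) inner h b *: b.
pose F n := \sum_(b <- L n) (m b * inner h b) *: b.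
have lP n : l2 (P n) by apply: orthonormal_comb_l2; case: (LP n).
have lF n : l2 (F n) by apply: orthonormal_comb_l2; case: (LP n).
have bd (c : (T -> C) -> C) s : uniq s -> (forall b, b \in s -> B b) ->
    l2norm (\sum_(b <- s) (m b * c b) *: b) <= M * l2norm (\sum_(b <- s) c b *: b).
  move=> us sB; rewrite -(@ler_pXn2r _ 2) ?nnegrE ?mulr_ge0 ?l2norm_ge0//.
  rewrite exprMn !orthonormal_comb_norm// mulr_sumr !big_seq.
  apply: ler_sum => b /sB Bb; rewrite normc_mul exprMn ler_wpM2r ?sqr_ge0//.
  by rewrite ler_pXn2r ?nnegrE ?normc_ge0// mM.
have ext (c : (T -> C) -> C) n s : uniq s -> {subset L n <= s} ->
    \sum_(b <- L n) c b *: b = \sum_(b <- s) (c b * (b \in L n)%:R) *: b.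
  move=> us Ls; have [uL _ _] := LP n; rewrite (perm_big [seq b <- s | b \in L n]) /=.
    rewrite big_filter big_mkcond; apply: eq_bigr => b _.
    by case: ifP; rewrite ?mulr1// mulr0 scale0r.
  apply: uniq_perm => //; first exact: filter_uniq.
  by move=> b; rewrite mem_filter; case: (boolP (b \in L n)) => // /Ls ->.
have FP n k : l2norm (F n - F k) <= M * l2norm (P n - P k).
  pose s := undup (L n ++ L k).
  have us : uniq s by apply: undup_uniq.
  have sn : {subset L n <= s} by move=> b bL; rewrite mem_undup mem_cat bL.
  have sk : {subset L k <= s} by move=> b bL; rewrite mem_undup mem_cat bL orbT.
  have sB b : b \in s -> B b.
    by rewrite mem_undup mem_cat; case: (LP n) (LP k) => _ h1 _ [_ h2 _] /orP[/h1|/h2].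
  pose c b := inner h b * (b \in L n)%:R - inner h b * (b \in L k)%:R.
  have -> : F n - F k = \sum_(b <- s) (m b * c b) *: b.
    rewrite /F !(ext _ n s us sn) !(ext _ k s us sk) -sumrB.
    by apply: eq_bigr => b _; rewrite -scalerBl mulrBr !mulrA.
  have -> : P n - P k = \sum_(b <- s) c b *: b.
    rewrite /P !(ext _ n s us sn) !(ext _ k s us sk) -sumrB.
    by apply: eq_bigr => b _; rewrite -scalerBl.
  exact: bd.
have FP0 n : l2norm (F n) <= M * l2norm (P n).
  by case: (LP n) => uL LB _; apply: bd.
have [f lf cf] : exists2 f, l2 f & l2cvg F f.
  apply: l2_complete => // e e0.
  have p : 0 < M + 1 by rewrite ltr_wpDl.
  have [N HN] := l2_invSn (divr_gt0 (divr_gt0 e0 p) (ltr0n R 2)).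
  exists N => i j /HN hi /HN hj; have [[_ _ h1] [_ _ h2]] := conj (LP i) (LP j).
  apply: le_lt_trans (FP i j) _; have := l2norm_dist (lP i) lh (lP j).
  rewrite (l2normBC (P i) h) -/(P i) -/(P j) => h3.
  have {}h3 : l2norm (P i - P j) < e / (M + 1).
    move: hi hj h1 h2 h3; rewrite -/(P i) -/(P j).
    by move: (i.+1%:R^-1) (j.+1%:R^-1) => x y; lra.
  move: h3; rewrite ltr_pdivlMr// mulrDr mulr1 mulrC.
  by have := l2norm_ge0 (P i - P j); lra.
have cP : l2cvg P h.
  move=> e /l2_invSn[N HN]; exists N => n /HN h1; have [_ _ h2] := LP n.
  by rewrite l2normBC; apply: lt_trans h2 h1.
exists f; split.
- apply: Hc; split=> // e /cf[N /(_ N (leqnn N)) h1]; exists (F N); last by rewrite l2normBC.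
  apply: subspace_sum => // b; have [_ LB _] := LP N => /LB /BH.
  exact: subspaceZ.
- move=> b Bb; have lb := Bl Bb; apply: normc_eps_eq => e e0.
  have p : 0 < M + 1 by rewrite ltr_wpDl.
  have [N1 H1] := l2cvg_inner lF lf lb cf (divr_gt0 e0 (ltr0n R 2)).
  have [N2 H2] := l2cvg_inner lP lh lb cP (divr_gt0 (divr_gt0 e0 (ltr0n R 2)) p).
  pose n := maxn N1 N2.
  have h1 := H1 n (leq_maxl _ _); have h2 := H2 n (leq_maxr _ _).
  have E : inner (F n) b = m b * inner (P n) b.
    have [uL LB _] := LP n; rewrite !orthonormal_comb_inner//.
    by case: ifP; rewrite ?mulr0.
  rewrite [X in normc X](_ : _ = - (inner (F n) b - inner f b) +
      m b * (inner (P n) b - inner h b)); last by rewrite E; ring.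
  apply: le_trans (normc_triangle _ _) _; rewrite normc_opp normc_mul.
  have h3 := ler_wpM2r (normc_ge0 (inner (P n) b - inner h b)) (mM _ Bb).
  move: h2; rewrite ltr_pdivlMr// mulrDr mulr1 mulrC => h2.
  have := normc_ge0 (inner (P n) b - inner h b); move: h1 h2 h3; lra.
apply/ler_addgt0Pr => e e0.
have p : 0 < M + 1 by rewrite ltr_wpDl.
have [N1 H1] := cf _ (divr_gt0 e0 (ltr0n R 2)).
have [N2 H2] := cP _ (divr_gt0 (divr_gt0 e0 (ltr0n R 2)) p).
pose n := maxn N1 N2.
have h1 := H1 n (leq_maxl _ _); have h2 := H2 n (leq_maxr _ _).
have := l2norm_dist lf (lF n) (l20 R T); rewrite !subr0 (l2normBC f) => h3.
have := l2norm_dist (lP n) lh (l20 R T); rewrite !subr0 => /(ler_wpM2l M0) h4.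
have := FP0 n; move: h2; rewrite ltr_pdivlMr// mulrDr mulr1 mulrC.
by have := l2norm_ge0 (P n - h); move: h1 h3 h4; lra.
Qed.

(** Square summability of the numbers [mu b * inner f b], the usual description of the domain, is
    carried by the existence of [p.2] in [H]. *)
Definition diagonal_operator : graph R T :=
  [set p | [/\ H p.1, H p.2
             & forall b, B b -> inner p.2 b = (mu b)%:C%C * inner p.1 b]].

Lemma diagonal_eigenvector b : B b -> diagonal_operator (b, (mu b)%:C%C *: b).
Proof.
move=> Bb; split=> /=; [exact: BH|by apply: subspaceZ => //; apply: BH|].
move=> c Bc; have [lb lc] := conj (Bl Bb) (Bl Bc); rewrite innerZl//.
by have [->//|/eqP bc] := eqVneq b c; rewrite (B0 Bb Bc bc) !mulr0.
Qed.

Lemma diagonal_subspace : linear_span diagonal_operator `<=` diagonal_operator.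
Proof.
apply: subspaceP; first by split; [exact: subspace0|exact: subspace0|move=> b _ /=; rewrite !inner0l mulr0].
move=> c u v [hu1 hu2 uB] [hv1 hv2 vB]; split=> /=.
- exact: (subspace_lin c HH hu1 hv1).
- exact: (subspace_lin c HH hu2 hv2).
move=> b Bb; have lb := Bl Bb.
have [[lu1 lu2] [lv1 lv2]] := conj (conj (Hl hu1) (Hl hu2)) (conj (Hl hv1) (Hl hv2)).
rewrite !innerDl ?innerZl ?uB ?vB//; try exact: l2Z.
by rewrite mulrDr !mulrA [c * _]mulrC.
Qed.

(** Coefficients are continuous, so the closure of [S] stays in the diagonal operator. Conversely,
    for [(f, g)] in the latter, the truncated expansions of [f] and [g] over a common list form a
    combination of eigenpairs that approximates both components at once. *)
Lemma diagonal_op_closure S : S `<=` diagonal_operator -> linear_span S `<=` S ->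
  (forall b, B b -> S (b, (mu b)%:C%C *: b)) -> H = L2 ->
  op_closure S = diagonal_operator.
Proof.
move=> SD SS SB HE; apply/seteqP; split.
  move=> [f g] [/= lf lg cfg]; split; rewrite /= ?HE// => b Bb.
  have lb := Bl Bb; apply: normc_eps_eq => e e0.
  pose M := normc (mu b)%:C%C + 1.
  have Mp : 0 < M by rewrite ltr_wpDl// normc_ge0.
  have [[f' g'] /SD [/= Hf Hg fgb] [/= ff gg]] := cfg _ (divr_gt0 e0 Mp).
  have [lf' lg'] := conj (Hl Hf) (Hl Hg).
  rewrite [X in normc X](_ : _ = inner (g - g') b - (mu b)%:C%C * inner (f - f') b).
    have b1 : l2norm b = 1.
      apply/eqP; rewrite -(@eqrXn2 _ 2) ?l2norm_ge0// expr1n; apply/eqP.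
      by apply: (@complexI R); rewrite -inner_self// B1.
    apply: le_trans (normc_triangle _ _) _; rewrite normc_opp normc_mul.
    have := cauchy_schwarz (l2B lg lg') lb; have := cauchy_schwarz (l2B lf lf') lb.
    rewrite b1 !mulr1 => /(ler_wpM2l (normc_ge0 (mu b)%:C%C)) h1 h2.
    have h3 := ler_wpM2l (normc_ge0 (mu b)%:C%C) (ltW ff).
    have h4 : normc (mu b)%:C%C * (e / M) + e / M = e.
      by rewrite -{2}[e / M]mul1r -mulrDl mulrC divfK// gt_eqF.
    move: h1 h2 h3 h4 gg; lra.
  by rewrite !innerBl// fgb//; ring.
move=> [f g] [/= Hf Hg fgb]; split; [exact: Hl|exact: Hl|move=> e e0 /=].
have [L [uL LB h1 h2]] := total_approx2 Hf Hg e0.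
exists (\sum_(b <- L) inner f b *: (b, (mu b)%:C%C *: b)).
  by apply: subspace_sum => // b /LB /SB; apply: subspaceZ.
have -> : \sum_(b <- L) inner f b *: (b, (mu b)%:C%C *: b) =
    (\sum_(b <- L) inner f b *: b, \sum_(b <- L) inner g b *: b).
  elim: L LB {uL h1 h2} => [|b L IH] LB; first by rewrite !big_nil.
  rewrite !big_cons IH; last by move=> c cL; apply: LB; rewrite in_cons cL orbT.
  rewrite (fgb b); last by apply: LB; rewrite mem_head.
  by congr pair; rewrite /= scalerA mulrC.
by split.
Qed.

(** Symmetry against the eigenpairs puts [A] inside the diagonal operator. As [A] is closed and
    contains the eigenpairs, [diagonal_op_closure] applied to [A] itself gives equality. *)
Lemma selfadjoint_diagonal A : selfadjoint L2 A -> H = L2 ->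
  (forall b, B b -> A (b, (mu b)%:C%C *: b)) -> A = diagonal_operator.
Proof.
move=> sA HE AB; rewrite -(diagonal_op_closure _ (selfadjoint_subspace sA) AB HE).
  apply/seteqP; split; first exact/sub_op_closure/selfadjoint_sub.
  exact: selfadjoint_closed.
move=> [f g] Afg; have [/= lf lg] := selfadjoint_sub sA Afg.
split; rewrite /= ?HE// => b Bb; have lb := Bl Bb.
have := selfadjoint_symmetric sA Afg (AB _ Bb); rewrite /= innerZr// => ->.
by rewrite conjc_realE.
Qed.

(** Testing the adjoint on the eigenpairs alone already forces the coefficient identities; the
    converse is the symmetry of truncated expansions, passed to the limit. *)
Lemma diagonal_selfadjoint : selfadjoint H diagonal_operator.
Proof.
split.
- split; first by move=> p [].
    exact: diagonal_subspace.
  move=> f g h [/= Hf Hg fg] [/= _ Hh fh].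
  apply/eqP; rewrite -subr_eq0; apply/eqP; apply: total_eq0.
    exact: subspaceB.
  move=> b Bb; rewrite innerBl ?fg ?fh ?subrr//; try exact: Hl.
  exact: Bl.
- move=> h /BT; apply: l2_closureS; apply: linear_span_min.
    by move=> b Bb; eexists; apply: diagonal_eigenvector.
  apply: subspaceP; first by exists 0; apply: (subspace0 diagonal_subspace).
  move=> c u v [u' Du] [v' Dv]; exists (c *: u' + v').
  exact: (subspace_lin c diagonal_subspace Du Dv).
apply/seteqP; split=> [[f g] [/= Hf Hg fg]|[f g] [/= Hf Hg fg]].
  split=> //= b Bb; have lb := Bl Bb; have [lf lg] := conj (Hl Hf) (Hl Hg).
  have := fg _ (diagonal_eigenvector Bb); rewrite /= innerZl//.
  rewrite innerC// [in RHS]innerC// => /(congr1 Num.conj).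
  by rewrite rmorphM/= !conjCK => <-; congr (_ * _); exact: conjc_realE.
split=> //= -[h k] [/= Hh Hk hk].
have [[lf lg] [lh lk]] := conj (conj (Hl Hf) (Hl Hg)) (conj (Hl Hh) (Hl Hk)).
apply: normc_eps_eq => e e0.
pose M := l2norm f + l2norm g + 1.
have Mp : 0 < M by rewrite ltr_wpDl// addr_ge0 ?l2norm_ge0.
have [L [uL LB h1 h2]] := total_approx2 Hh Hk (divr_gt0 e0 Mp).
have l1 := orthonormal_comb_l2 (inner h) LB.
have l3 := orthonormal_comb_l2 (inner k) LB.
have E : inner (\sum_(b <- L) inner k b *: b) f = inner (\sum_(b <- L) inner h b *: b) g.
  rewrite !big_seq !inner_suml//; try by move=> b /LB /Bl; apply: l2Z.
  apply: eq_bigr => b /LB Bb; have lb := Bl Bb.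
  rewrite !innerZl// hk// [inner b f]innerC// [inner b g]innerC// fg//.
  by rewrite rmorphM/= -[(mu b)%:C%C^*]/(Num.conj _) (conjc_realE (mu b)); ring.
rewrite [X in normc X](_ : _ = inner (k - \sum_(b <- L) inner k b *: b) f -
    inner (h - \sum_(b <- L) inner h b *: b) g); last first.
  by rewrite !innerBl// E; ring.
apply: le_trans (normc_triangle _ _) _; rewrite normc_opp.
have := cauchy_schwarz (l2B lk l3) lf; have := cauchy_schwarz (l2B lh l1) lg.
have h3 := ler_wpM2r (l2norm_ge0 f) (ltW h2).
have h4 := ler_wpM2r (l2norm_ge0 g) (ltW h1).
have eM : e = (e / M) * l2norm f + (e / M) * l2norm g + e / M.
  by rewrite -!mulrDr -[X in _ + X]mulr1 -!mulrDr divfK// gt_eqF.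
have := divr_gt0 e0 Mp; lra.
Qed.

(** At distance [e] from all [mu b], the multiplier [(mu b - z)^-1] is bounded by [e^-1] and gives
    the resolvent. If instead [mu b] comes within [(|M| + 1)^-1] of [z], then the unit vector [b],
    as the preimage of [(mu b - z) b], violates a resolvent bound [M]. *)
Lemma diagonal_spectrum :
  spectrum H diagonal_operator = closure [set ((mu b)%:C%C : R[i]^o) | b in B].
Proof.
apply/seteqP; split=> z.
  move=> Sz; apply: contrapT => Nz; apply: Sz.
  have [e e0 eN] : exists2 e : R, 0 < e & forall b, B b -> e <= normc ((mu b)%:C%C - z).
    apply: contrapT => h; apply: Nz; apply/closure_normcP => e e0.
    apply: contrapT => h2; apply: h; exists e => // b Bb; rewrite leNgt; apply/negP => lt.
    by apply: h2; exists (mu b)%:C%C; [exists b|rewrite -normc_opp opprB].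
  have nz b : B b -> (mu b)%:C%C - z != 0.
    move=> /eN; apply: contraTneq => ->; by rewrite normc_zero -ltNge.
  exists e^-1 => h Hh.
  have [|||f [Hf fB fn]] := @diagonal_multiplier (fun b => ((mu b)%:C%C - z)^-1) e^-1 h.
  - by rewrite invr_ge0 ltW.
  - move=> b Bb; rewrite Normc.normcV lef_pV2 ?posrE//; first exact: eN.
    exact: lt_le_trans (eN _ Bb).
  - exact: Hh.
  exists f; split=> //.
    split=> //=; first by apply: subspaceD => //; apply: subspaceZ.
    move=> b Bb; have lb := Bl Bb; have [lf lh] := conj (Hl Hf) (Hl Hh).
    rewrite innerDl ?innerZl ?fB//; last exact: l2Z.
    have := nz _ Bb; move: (inner h b) => w n; field.
    exact: n.
  move=> f' [/= Hf' _ f'B]; apply/eqP; rewrite -subr_eq0; apply/eqP.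
  apply: total_eq0; first exact: subspaceB.
  move=> b Bb; have lb := Bl Bb; have [[lf lh] lf'] := conj (conj (Hl Hf) (Hl Hh)) (Hl Hf').
  have := f'B _ Bb; rewrite innerDl ?innerZl//; last exact: l2Z.
  move=> E; apply: (mulfI (nz _ Bb)); rewrite mulr0 innerBl// fB//.
  rewrite mulrBr mulrA divff ?nz// mul1r mulrBl -E; ring.
move=> /closure_normcP cz [M zM].
have p : 0 < `|M| + 1 by rewrite ltr_wpDl.
have q : 0 < (`|M| + 1)^-1 by rewrite invr_gt0.
have [_ [b Bb <-] zb] := cz _ q.
have lb := Bl Bb; have Hb := BH Bb.
have [f [_ fn fu]] := zM (((mu b)%:C%C - z) *: b) (subspaceZ _ HH Hb).
have fb : b = f.
  by apply: fu; rewrite -scalerDl subrK; apply: diagonal_eigenvector.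
have b1 : l2norm b = 1.
  apply/eqP; rewrite -(@eqrXn2 _ 2) ?l2norm_ge0// expr1n; apply/eqP.
  by apply: (@complexI R); rewrite -inner_self// B1.
move: fn; rewrite -fb l2normZ// b1 mulr1 -normc_opp opprB => fn.
suff : M * normc (z - (mu b)%:C%C) < 1 by rewrite ltNge fn.
apply: le_lt_trans (ler_wpM2r (normc_ge0 _) (ler_norm M)) _.
move: zb; rewrite -[_^-1]mul1r ltr_pdivlMr// mulrDr mulr1 mulrC.
by have := normc_ge0 (z - (mu b)%:C%C); lra.
Qed.

End Diagonal.

(** * Compact resolvents *)

Section HilbertCube.
Variables (R : realType) (T : choiceType).
Local Notation C := R[i].
Import ArrowAsProduct.

Lemma product_nbhs (I : choiceType) (g : I -> R) (s : seq I) (eta : R) : 0 < eta ->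
  nbhs g [set h : I -> R | forall i, i \in s -> `|g i - h i| < eta].
Proof.
move=> e0; elim: s => [|i s IH]; first by apply: filterS (filterT) => h _ i.
have N1 : nbhs g [set h : I -> R | `|g i - h i| < eta].
  by apply: (@proj_continuous I (fun=> R) i g (ball (g i) eta)); apply: nbhsx_ballx.
apply: filterS (filterI N1 IH) => h [h1 h2] j.
by rewrite in_cons => /orP[/eqP ->//|/h2].
Qed.

(** Compactness of the Hilbert cube. Tychonoff's theorem for the real and imaginary coordinates
    provides a cluster point for coordinatewise convergence. It is one in norm too, since outside a
    finite set carrying most of [w] all vectors are uniformly small. *)
Lemma hilbert_cube_cluster (F : nat -> T -> C) (w : T -> C) : l2 w ->
  (forall n x, normc (F n x) <= normc (w x)) ->
  exists2 f, l2 f & forall (e : R) N, 0 < e ->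
    exists2 n, (N <= n)%N & l2norm (F n - f) < e.
Proof.
move=> lw Fw.
pose G n : T * bool -> R := fun i => if i.2 then complex.Re (F n i.1) else complex.Im (F n i.1).
pose A (i : T * bool) : set R := `[- normc (w i.1), normc (w i.1)]%classic.
have cA : compact [set g : T * bool -> R | forall i, A i (g i)].
  by apply: (@tychonoff _ (fun=> R)) => i; apply: segment_compact.
have [|g [gA cg]] := cA (G @ \oo) _.
  exists 0%N => // n _ [x b]; rewrite /A /G /= in_itv /= -ler_norml.
  by case: b; apply: le_trans (Fw n x); [exact: Re_le_normc|exact: Im_le_normc].
pose f x : C := Complex (g (x, true)) (g (x, false)).
have fw x : normc (f x) <= 2 * normc (w x).
  apply: le_trans (normc_le_ReIm _) _.
  have := gA (x, true); have := gA (x, false); rewrite /A /= !in_itv /= -!ler_norml; lra.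
have lf : l2 f.
  apply: (@summ_le _ _ _ (fun x => 4 * normc (w x) ^+ 2)); last exact: summZ.
  move=> x; rewrite ger0_norm ?sqr_ge0//.
  have -> : 4 * normc (w x) ^+ 2 = (2 * normc (w x)) ^+ 2 by ring.
  by rewrite ler_pXn2r ?nnegrE ?mulr_ge0 ?normc_ge0.
exists f => // e N e0.
(* From [|f| <= 2 |w|] the difference is at most [3 |w|] off [X], so a tail below [e / 6] costs less
   than [9 * (e / 6) ^+ 2 = e ^+ 2 / 4]. The tolerance [eta] is chosen so that the points of [X]
   cost at most [e ^+ 2 / 4] as well. *)
have d0 : 0 < e / 6 by rewrite divr_gt0.
have [X uX wX] := finsupp_approx lw d0.
set wx := \sum_(x <- X) _ in wX.
have lwx : l2 wx by apply: l2_sum => x _; apply/l2Z/delta_l2.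
pose k : R := (size X)%:R + 1.
have k0 : 0 < k by rewrite ltr_wpDl// ler0n.
pose eta := e / (4 * k).
have k1 : 1 <= k by rewrite lerDr ler0n.
have eta0 : 0 < eta by rewrite divr_gt0// mulr_gt0.
pose s := [seq (x, b) | x <- X, b <- [:: true; false]].
have [_ [[n Nn <-] Us]] := cg [set G n | n in [set n | (N <= n)%N]] _
  (ex_intro2 _ _ N I (fun n Nn => ex_intro2 _ _ n Nn erefl)) (product_nbhs g s eta0).
exists n => //.
have Fx x : x \in X -> normc ((F n - f) x) <= 2 * eta.
  move=> xX; apply: le_trans (normc_le_ReIm _) _.
  have h1 : `|g (x, true) - complex.Re (F n x)| < eta.
    by apply: (Us (x, true)); apply/allpairsP; exists (x, true).
  have h2 : `|g (x, false) - complex.Im (F n x)| < eta.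
    by apply: (Us (x, false)); apply/allpairsP; exists (x, false).
  rewrite -[(F n - f) x]/(F n x - f x); move: h1 h2; rewrite /f.
  case: (F n x) => a b /=; rewrite distrC => h1; rewrite distrC => h2.
  by rewrite mulrDl !mul1r; apply: lerD; apply: ltW.
have Fy x : x \notin X -> normc ((F n - f) x) ^+ 2 <= 9 * normc ((w - wx) x) ^+ 2.
  move=> xX; have -> : (w - wx) x = w x.
    rewrite -[LHS]/(w x - wx x).
    rewrite -[wx x]inner_delta inner_suml; last exact: delta_l2.
      rewrite big1_seq ?subr0// => y /= yX; rewrite inner_delta scale_fctE delta_neq ?mulr0//.
      by apply: contraNneq xX => ->.
    by move=> y _; apply/l2Z/delta_l2.
  have -> : 9 * normc (w x) ^+ 2 = (3 * normc (w x)) ^+ 2 by ring.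
  rewrite ler_pXn2r ?nnegrE ?mulr_ge0 ?normc_ge0//.
  apply: le_trans (normc_triangle (F n x) (- f x)) _; rewrite normc_opp.
  have := fw x; have := Fw n x; lra.
have [Y uY|_ le] := @l2_sumlub _ _ (F n - f) (k * (2 * eta) ^+ 2 + 9 * l2norm (w - wx) ^+ 2).
  rewrite (bigID (mem X)) /=; apply: lerD.
    rewrite -big_filter; apply: le_trans (_ : \sum_(i <- [seq x <- Y | x \in X]) (2 * eta) ^+ 2 <= _).
      rewrite big_seq [leRHS]big_seq; apply: ler_sum => x; rewrite mem_filter => /andP[xX _].
      by apply: lerXn2r; rewrite ?nnegrE ?normc_ge0//; [lra|exact: Fx].
    rewrite big_const_seq count_predT iter_addr_0 -[X in X <= _]mulr_natl.
    rewrite ler_wpM2r ?sqr_ge0// (le_trans _ (_ : (size X)%:R <= k)) ?lerDl// ler_nat.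
    apply: uniq_leq_size; first exact: filter_uniq.
    by move=> x; rewrite mem_filter => /andP[].
  rewrite -big_filter.
  apply: le_trans (_ : \sum_(i <- [seq x <- Y | x \notin X]) 9 * normc ((w - wx) i) ^+ 2 <= _).
    by rewrite big_seq [leRHS]big_seq; apply: ler_sum => x; rewrite mem_filter => /andP[xX _]; apply: Fy.
  rewrite -mulr_sumr ler_pM2l//; apply: l2_sumub; first exact: l2B.
  exact: filter_uniq.
rewrite -(@ltr_pXn2r _ 2) ?nnegrE ?l2norm_ge0 ?(ltW e0)//.
apply: le_lt_trans le _.
have E1 : k * (2 * eta) ^+ 2 <= e ^+ 2 / 4.
  have -> : k * (2 * eta) ^+ 2 = e ^+ 2 / 4 / k by rewrite /eta; field; rewrite gt_eqF.
  by rewrite ler_pdivrMr// ler_peMr// divr_ge0// sqr_ge0.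
have E2 : l2norm (w - wx) ^+ 2 < (e / 6) ^+ 2.
  by rewrite ltr_pXn2r ?nnegrE ?l2norm_ge0 ?(ltW d0).
have E3 : (e / 6) ^+ 2 = e ^+ 2 / 36 by field.
have := exprn_gt0 2 e0; move: E1 E2; rewrite E3; lra.
Qed.

End HilbertCube.

(** * Eigenvectors of a selfadjoint operator with a coordinatewise bound *)

Section DominatedOperators.
Variables (R : realType) (T : choiceType).
Local Notation C := R[i].
Local Notation L2 := (@l2 R T).
Variables (A : graph R T) (w : T -> C).
Hypotheses (saA : selfadjoint L2 A) (lw : l2 w).
Hypothesis Aw : forall f g, A (f, g) ->
  forall x, normc (f x) <= normc (w x) * (l2norm f + l2norm g).
Implicit Types (f g h u e : T -> C) (z : C).

Let Al : A `<=` L2 `*` L2 := selfadjoint_sub saA.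
Let AA : linear_span A `<=` A := selfadjoint_subspace saA.
Let As : symmetric A := selfadjoint_symmetric saA.

Lemma shifted_norm f h z : A (f, h + z *: f) -> l2 h -> z^* = - z -> normc z = 1 ->
  l2norm h ^+ 2 = l2norm (h + z *: f) ^+ 2 + l2norm f ^+ 2.
Proof.
move=> Af lh zN z1; have [/= lf lg] := Al Af.
have := symmetric_norm lf lg (As Af Af) zN.
by rewrite addrK z1 expr1n mul1r.
Qed.

Lemma shifted_norm_le f h z : A (f, h + z *: f) -> l2 h -> z^* = - z -> normc z = 1 ->
  l2norm f <= l2norm h.
Proof.
move=> Af lh zN z1; rewrite -(@ler_pXn2r _ 2) ?nnegrE ?l2norm_ge0//.
by rewrite (shifted_norm Af lh zN z1) lerDr exprn_ge0 ?l2norm_ge0.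
Qed.

Lemma imaginary_neq z : z^* = - z -> normc z = 1 -> z != 0.
Proof.
by move=> _ z1; apply/eqP => z0; move: z1; rewrite z0 normc_zero => /esym/eqP; rewrite oner_eq0.
Qed.

(** Pairing with [e] gives [(z - mu) * inner f e = 0], and [z] differs from the real number [mu]. So
    the resolvent preserves the orthogonal complement of an eigenvector. *)
Lemma shifted_orthogonal f h e z mu : A (f, h + z *: f) -> l2 h -> z^* = - z -> normc z = 1 ->
  A (e, mu *: e) -> e <> 0 -> inner h e = 0 -> inner f e = 0.
Proof.
move=> Af lh zN z1 Ae e0 he; have [/= lf _] := Al Af; have [/= le _] := Al Ae.
have muR := selfadjoint_eigenvalue_real saA Ae e0.
have := As Af Ae; rewrite /= innerDl ?innerZl ?innerZr// ?he ?add0r; last exact: l2Z.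
rewrite muR => /eqP; rewrite -subr_eq0 -mulrBl mulf_eq0 => /orP[|/eqP//].
rewrite subr_eq0 => /eqP zmu; have := imaginary_neq zN z1.
move: zN; rewrite zmu muR => /eqP; rewrite -subr_eq0 opprK -mulr2n mulrn_eq0 /=.
by move=> ->.
Qed.

(** The orthogonal complement of all eigenvectors. The variational problem below is posed inside it,
    where any solution is contradictory. *)
Let M := [set u | l2 u /\ forall e, eigenvector A e -> inner u e = 0].

Lemma orthogonal_eigen_subspace : linear_span M `<=` M.
Proof.
have le e : eigenvector A e -> l2 e by move=> [_ [z /Al[]]].
apply: subspaceP; first by split; [exact: l20|move=> e _; rewrite inner0l].
move=> c u v [lu uM] [lv vM]; split; first by apply: l2D => //; apply: l2Z.
move=> e Ee; have lE := le _ Ee.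
by rewrite innerDl ?innerZl ?uM ?vM ?mulr0 ?addr0//; apply: l2Z.
Qed.

Lemma shifted_orthogonal_eigen f h z : A (f, h + z *: f) -> z^* = - z -> normc z = 1 ->
  M h -> M f.
Proof.
move=> Af zN z1 [lh hM]; split; first by have [] := Al Af.
move=> e Ee; have := hM _ Ee; case: Ee => e0 [mu Ae].
exact: shifted_orthogonal Af lh zN z1 Ae e0.
Qed.

Local Notation i := ('i%C : C).

Let iN : i^* = - i := conjc_i R.
Let i1 : normc i = 1 := normc_i R.
Let niN : (- i)^* = - - i. Proof. by rewrite rmorphN/= iN. Qed.
Let ni1 : normc (- i) = 1. Proof. by rewrite normc_opp. Qed.

(** The resolvents at [i] and [-i] are adjoint to each other: here [f = (A - i)^-1 h],
    [t = (A + i)^-1 f] and [k = (A - i)^-1 h']. *)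
Lemma resolvent_inner f h t k h' : l2 h -> l2 h' ->
  A (f, h + i *: f) -> A (t, f + - i *: t) -> A (k, h' + i *: k) ->
  inner t h' = inner f k.
Proof.
move=> lh lh' Af At Ak; have [[lf _] [lt _]] := conj (Al Af) (Al At).
have [lk _] := Al Ak; have := As At Ak.
rewrite /= innerDl ?innerDr ?innerZl ?innerZr//; try exact: l2Z.
by rewrite iN => /addIr.
Qed.

(* An eigenvector orthogonal to all eigenvectors is found by maximising the norm
   of (A - i)^-1 h over the unit vectors h of M: maximising vectors converge by
   compactness, to an eigenvector of (A^2 + 1)^-1. *)
Lemma eigenvectors_total u0 : M u0 -> u0 = 0.
Proof.
move=> Mu0; apply: contrapT => u0N.
have Ml : M `<=` L2 by move=> ? [].
have lu0 := Ml _ Mu0; have MM := orthogonal_eigen_subspace.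
(* The values of [||(A - i)^-1 h||] on the unit sphere of [M]; their supremum [sg] is the norm of
   the resolvent restricted to [M]. *)
pose D := [set r | exists f h, [/\ M h, l2norm h = 1, A (f, h + i *: f) & r = l2norm f]].
have ex h : l2 h -> exists f, A (f, h + i *: f) by apply: selfadjoint_resolvent.
have ex' h : l2 h -> exists f, A (f, h + - i *: f) by apply: selfadjoint_resolvent.
have norm_pos f : l2 f -> f <> 0 -> 0 < l2norm f.
  by move=> lf f0; rewrite lt_def l2norm_ge0 andbT; apply/eqP => /(l2norm_eq0 lf).
have scaled f h : M h -> h <> 0 -> A (f, h + i *: f) -> D (l2norm f / l2norm h).
  move=> Mh h0 Af; have lh := Ml _ Mh; have hp := norm_pos _ lh h0.
  have [/= lf _] := Al Af; pose c : C := ((l2norm h)^-1)%:C%C.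
  have nc : normc c = (l2norm h)^-1 by rewrite normc_real gtr0_norm ?invr_gt0.
  exists (c *: f), (c *: h); split.
  - exact: subspaceZ.
  - by rewrite l2normZ// nc mulVf// gt_eqF.
  - have := subspaceZ c AA Af; congr (A (_, _)).
    by rewrite /= scalerDr !scalerA [c * _]mulrC.
  - by rewrite l2normZ// nc mulrC.
have D1 : ubound D 1.
  by move=> _ [f [h [Mh h1 Af ->]]]; rewrite -h1; apply: shifted_norm_le Af (Ml _ Mh) iN i1.
have [f0 Af0] := ex _ lu0.
have D0 := scaled _ _ Mu0 u0N Af0.
have sD : has_sup D by split; [eexists; exact: D0|exists 1].
pose sg := sup D.
have sg_ub r : D r -> r <= sg by apply: ub_le_sup; exists 1.
have sg0 : 0 < sg.
  apply: lt_le_trans (sg_ub _ D0); rewrite divr_gt0 ?norm_pos//; first by have [] := Al Af0.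
  move=> f00; move: Af0; rewrite f00 scaler0 addr0 => A0.
  apply: u0N; apply: inner_self_eq0 => //.
  have [[_ _ su] _ _] := saA; apply: etrans (inner0r u0); congr inner.
  exact: su A0 (subspace0 AA).
have sg1 : sg <= 1 by apply: ge_sup => //; case: sD.
have sgM f h : M h -> A (f, h + i *: f) -> l2norm f <= sg * l2norm h.
  move=> Mh Af; have lh := Ml _ Mh; have [h0|h0] := EM (h = 0).
    have := shifted_norm_le Af lh iN i1; rewrite h0 l2norm0 mulr0//.
  by rewrite -ler_pdivrMr ?norm_pos// sg_ub//; apply: scaled.
have /choice[hf hfP] : forall n : nat, exists p : (T -> C) * (T -> C),
    [/\ M p.1, l2norm p.1 = 1, A (p.2, p.1 + i *: p.2) & sg - n.+1%:R^-1 < l2norm p.2].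
  move=> n; have n0 : 0 < n.+1%:R^-1 :> R by rewrite invr_gt0 ltr0n.
  by have [_ [f [h [Mh h1 Af ->]]] lt] := sup_adherent n0 sD; exists (h, f).
pose h n := (hf n).1; pose f n := (hf n).2.
have Mh n : M (h n) by case: (hfP n).
have h1 n : l2norm (h n) = 1 by case: (hfP n).
have Af n : A (f n, h n + i *: f n) by case: (hfP n).
have fs n : sg - n.+1%:R^-1 < l2norm (f n) by case: (hfP n).
have lh n : l2 (h n) := Ml _ (Mh n).
have lf n : l2 (f n) by have [] := Al (Af n).
have Mf n : M (f n) := shifted_orthogonal_eigen (Af n) iN i1 (Mh n).
have /choice[t At] : forall n, exists t, A (t, f n + - i *: t) by move=> n; apply: ex'.
have lt n : l2 (t n) by have [] := Al (At n).
have Mt n : M (t n) := shifted_orthogonal_eigen (At n) niN ni1 (Mf n).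
have fsg n : l2norm (f n) <= sg by rewrite -[sg]mulr1 -(h1 n); apply: sgM.
(* Apply [resolvent_inner] with [h'] equal to [t n] itself: [||t||^2 = inner f k], where
   [||f|| <= sg] and [||k|| <= sg * ||t||]. *)
have tn n : l2norm (t n) <= sg ^+ 2.
  have [t0|t0] := EM (t n = 0); first by rewrite t0 l2norm0 sqr_ge0.
  have tp := norm_pos _ (lt n) t0.
  have [k Ak] := ex _ (lt n); have [/= lk _] := Al Ak.
  have := resolvent_inner (lh n) (lt n) (Af n) (At n) Ak.
  rewrite inner_self// => /(congr1 (@Normc.normc R)).
  rewrite normc_real ger0_norm ?sqr_ge0// => E.
  rewrite -(ler_pM2r tp) -expr2 E.
  apply: le_trans (cauchy_schwarz (lf n) lk) _.
  rewrite expr2 -mulrA; apply: ler_pM; rewrite ?l2norm_ge0//.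
  exact: sgM.
(* Expand the square. The cross term is [inner (t n) (h n) = ||f n||^2], at least [sg^2 - 2 sg x]
   with [x = 1/(n+1)], and [||t n|| <= sg^2]; what remains is [4 sg^3 x <= 4 x], because
   [sg <= 1]. *)
have tsh n : l2norm (t n - (sg ^+ 2)%:C%C *: h n) ^+ 2 <= 4 * n.+1%:R^-1.
  rewrite l2norm_sqrB//; last exact: l2Z.
  rewrite l2normZ// h1 mulr1 normc_real (ger0_norm (sqr_ge0 _)) innerZr//.
  rewrite (resolvent_inner (lh n) (lh n) (Af n) (At n) (Af n)) inner_self//.
  rewrite conjc_realE -rmorphM/=.
  have := tn n; have := l2norm_ge0 (t n); have := fs n; have := l2norm_ge0 (f n).
  have : 0 < n.+1%:R^-1 :> R by rewrite invr_gt0 ltr0n.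
  move: (n.+1%:R^-1) (l2norm (t n)) (l2norm (f n)) => x a b x0 b0 bx a0 aS.
  have p1 : a ^+ 2 <= sg ^+ 2 * sg ^+ 2 by rewrite expr2; apply: ler_pM.
  have p2 : sg ^+ 2 - 2 * sg * x <= b ^+ 2.
    have [sx|sx] := leP x sg; last by have := sqr_ge0 b; nra.
    have : (sg - x) ^+ 2 <= b ^+ 2 by rewrite ler_pXn2r ?nnegrE ?subr_ge0// ltW.
    by have := sqr_ge0 x; nra.
  have p3 : sg ^+ 2 * (sg ^+ 2 - 2 * sg * x) <= sg ^+ 2 * b ^+ 2 by rewrite ler_wpM2l ?sqr_ge0.
  have p4 : sg ^+ 2 * sg * x <= x.
    by rewrite -[leRHS]mul1r ler_wpM2r ?(ltW x0)// -exprSr exprn_ile1// ltW.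
  have -> : (sg ^+ 2) ^+ 2 = sg ^+ 2 * sg ^+ 2 by rewrite expr2.
  by move: p1 p3 p4; nra.
(* The factor 2 bounds [||f n|| + ||A f n||], each term being at most [||h n|| = 1]. *)
have [|fl lfl cl] := @hilbert_cube_cluster R T f (fun x => 2 * w x) (l2Z 2 lw) _.
  move=> n x; apply: le_trans (Aw (Af n) x) _.
  rewrite normc_mul mulrC ler_wpM2r ?normc_ge0//.
  have n2 : normc (2 : C) = 2.
    have -> : (2 : C) = (2 : R)%:C%C by rewrite -[2%:R in RHS]/(1 + 1) rmorphD.
    by rewrite normc_real ger0_norm.
  rewrite n2; have := shifted_norm (Af n) (lh n) iN i1; rewrite h1 expr1n => E.
  have := l2norm_ge0 (f n); have := l2norm_ge0 (h n + i *: f n).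
  move: E; move: (l2norm (f n)) (l2norm (h n + _)) => a b E b0 a0.
  have : a <= 1 by rewrite -(@ler_pXn2r _ 2) ?nnegrE// expr1n E lerDr sqr_ge0.
  have : b <= 1 by rewrite -(@ler_pXn2r _ 2) ?nnegrE// expr1n E lerDl sqr_ge0.
  by lra.
have [u Au] := ex' _ lfl; have [/= lu _] := Al Au.
pose s := sg ^+ 2; have s0 : 0 < s by rewrite exprn_gt0.
have s1 : s <= 1 by rewrite exprn_ile1// ltW.
(* [u = (A + i)^-1 fl] is close to [t n] when [f n] is close to [fl], and [t n] is close to
   [s * h n]. So convergence of the [f n] forces that of the maximising vectors [h n], for which no
   coordinatewise bound is available. *)
have key (e : R) : 0 < e -> exists n, l2norm (f n - fl) < e /\ l2norm (u - s%:C%C *: h n) < e.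
  move=> e0; have e2 : 0 < e / 2 by rewrite divr_gt0.
  have [N HN] := l2_invSn (divr_gt0 (exprn_gt0 2 e2) (ltr0n R 4)).
  have [n Nn fn] := cl _ N e2; exists n; split; first by move: fn e0; lra.
  have lsh : l2 (s%:C%C *: h n) by apply: l2Z.
  have := l2norm_dist lu (lt n) lsh.
  have d1 : l2norm (u - t n) <= l2norm (fl - f n).
    apply: (@shifted_norm_le _ _ (- i)) => //; last exact: l2B.
    have := subspaceB AA Au (At n); congr (A (_, _)).
    by rewrite /= opprD addrACA scalerBr.
  have d2 : l2norm (t n - s%:C%C *: h n) < e / 2.
    rewrite -(@ltr_pXn2r _ 2) ?nnegrE ?l2norm_ge0 ?(ltW e2)//.
    apply: le_lt_trans (tsh n) _; have := HN _ Nn.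
    by move: (n.+1%:R^-1) ((e / 2) ^+ 2) => x y; lra.
  by rewrite (l2normBC fl) in d1; move: fn d1 d2; lra.
(* Together with [(A + i) u = fl] this says [(A^2 + 1) u = s^-1 u]. *)
have Afl : A (fl, (s^-1)%:C%C *: u + i *: fl).
  apply: (selfadjoint_closed saA); split=> //=.
    by apply: l2D; apply: l2Z.
  move=> e e0; have p : 0 < e / 2 * s by rewrite mulr_gt0// divr_gt0.
  have e2 : 0 < e / 2 by rewrite divr_gt0.
  have mp : 0 < Num.min (e / 2) (e / 2 * s) by rewrite lt_min e2.
  have [n [k1 k2]] := key _ mp.
  rewrite !lt_min in k1 k2; have /andP[k3 _] := k1; have /andP[_ k4] := k2.
  exists (f n, h n + i *: f n); first exact: Af.
  rewrite /= l2normBC; split; first by move: k3 e0; lra.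
  have -> : (s^-1)%:C%C *: u + i *: fl - (h n + i *: f n) =
      (s^-1)%:C%C *: (u - s%:C%C *: h n) + i *: (fl - f n).
    rewrite !scalerBr scalerA -rmorphM/= mulVf ?gt_eqF// scale1r.
    by rewrite opprD addrACA.
  have lus : l2 (u - s%:C%C *: h n) by apply: l2B => //; apply: l2Z.
  have lff := l2B lfl (lf n).
  apply: le_lt_trans (l2normD (l2Z _ lus) (l2Z _ lff)) _.
  rewrite !l2normZ// i1 mul1r normc_real gtr0_norm ?invr_gt0// (l2normBC fl).
  have : s^-1 * l2norm (u - s%:C%C *: h n) < e / 2 by rewrite ltr_pdivrMl// mulrC.
  by move: k3; lra.
have Mfl : M fl.
  split=> // e Ee; have le : l2 e by case: Ee => _ [z /Al[]].
  apply: (@l2_closure_inner0 _ _ M) => //; first by move=> g [_ ]; apply.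
  by split=> // x /key[n [k1 _]]; exists (f n) => //; rewrite l2normBC.
have Mu : M u := shifted_orthogonal_eigen Au niN ni1 Mfl.
have uN : u <> 0.
  move=> u00; suff : s <= 0 by rewrite leNgt s0.
  apply: le0_eps => e /key[n [_]]; rewrite u00 sub0r l2normN l2normZ// h1 mulr1.
  by rewrite normc_real gtr0_norm// => /ltW.
(* This is [A u], and [A y = (s^-1 - 1) u]; hence [(A - nu) (A + nu) u = 0] for the square root [nu]
   below. Either [(A + nu) u] is an eigenvector for [nu], or it vanishes and [u] is one for [-nu].
   Both lie in [M]. *)
pose y := fl + - i *: u.
have Ay : A (y, (s^-1 - 1)%:C%C *: u).
  have := subspace_lin (- i) AA Au Afl; congr (A (_, _)); rewrite /y /= 1?addrC//.
  have E (a b c : C) : c * b + i * a + - i * (a + - i * b) = (c + i ^+ 2) * b by ring.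
  by apply/funext => x; apply: etrans (E _ _ _) _; rewrite sqr_i rmorphB rmorph1.
pose nu := Num.sqrt (s^-1 - 1).
have nu2 : nu ^+ 2 = s^-1 - 1 by rewrite sqr_sqrtr// subr_ge0 -[leLHS]invr1 lef_pV2 ?posrE.
pose e1 := nu%:C%C *: u + y.
have Ae1 : A (e1, nu%:C%C *: e1).
  have := subspace_lin nu%:C%C AA Au Ay; congr (A (_, _)).
  by rewrite /= -nu2 rmorphXn/= expr2 /e1 /y !scalerDr !scalerA addrC.
have My : M y by rewrite /y addrC; apply: subspace_lin.
have Me1 : M e1 by apply: subspace_lin.
have e10 : e1 = 0.
  apply: contrapT => e1N; apply: (e1N); apply: inner_self_eq0; first by case: Me1.
  by case: Me1 => _; apply; split => //; exists nu%:C%C.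
apply: (uN); apply: inner_self_eq0 => //; case: Mu => _; apply; split=> //.
exists (- nu%:C%C); have -> : - nu%:C%C *: u = y; last exact: Au.
by move/eqP: e10; rewrite /e1 addrC addr_eq0 => /eqP ->; rewrite scaleNr.
Qed.

(** A trace estimate. At a point [x], the combination [f] of the [b] with coefficients [(b x)^*] has
    [f x = ||f||^2], while [||A f|| <= K * ||f||]. The coordinatewise bound then gives
    [sum_b |b x|^2 <= (1 + K)^2 * |w x|^2], and summing over [x] counts the vectors. *)
Lemma orthonormal_eigen_count (L : seq (T -> C)) (mu : (T -> C) -> R) (K : R) :
  uniq L -> (forall b, b \in L -> A (b, (mu b)%:C%C *: b)) ->
  (forall b, b \in L -> inner b b = 1) ->
  (forall b c, b \in L -> c \in L -> b <> c -> inner b c = 0) ->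
  0 <= K -> (forall b, b \in L -> `|mu b| <= K) ->
  (size L)%:R <= 2 * ((1 + K) * l2norm w) ^+ 2.
Proof.
move=> uL LA L1 L0 K0 LK.
have Ll b : b \in L -> l2 b by move=> /LA /Al[].
pose B := [set b | b \in L].
have Hl : L2 `<=` L2 by [].
have BH : B `<=` L2 by move=> b /Ll.
have LB b : b \in L -> B b by [].
have pt x : \sum_(b <- L) normc (b x) ^+ 2 <= (1 + K) ^+ 2 * normc (w x) ^+ 2.
  set S := \sum_(b <- L) _.
  have S0 : 0 <= S by apply: sumr_ge0 => b _; rewrite sqr_ge0.
  pose f := \sum_(b <- L) (b x)^* *: b.
  pose g := \sum_(b <- L) ((mu b)%:C%C * (b x)^*) *: b.
  have Afg : A (f, g).
    rewrite /f /g; elim: (L) LA => [|b s IH] sA; first by rewrite !big_nil; exact: (subspace0 AA).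
    rewrite !big_cons.
    have h2 : A (\sum_(j <- s) (j x)^* *: j, \sum_(j <- s) ((mu j)%:C%C * (j x)^*) *: j).
      by apply: IH => c cs; apply: sA; rewrite in_cons cs orbT.
    have := subspace_lin ((b x)^*) AA (sA b (mem_head _ _)) h2; congr (A (_, _)).
    by rewrite /= scalerA [(b x)^* * _]mulrC.
  have fx : f x = S%:C%C.
    rewrite -inner_delta /f big_seq inner_suml; last exact: delta_l2.
      rewrite -big_seq rmorph_sum/=; apply: eq_bigr => b _.
      by rewrite inner_delta scale_fctE mulrC mulc_conj.
    by move=> b /Ll; apply: l2Z.
  have fn : l2norm f ^+ 2 = S.
    rewrite (orthonormal_comb_norm (B := B) Hl BH)//.
    by apply: eq_bigr => b _; rewrite normc_conj.
  have gn : l2norm g <= K * l2norm f.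
    rewrite -(@ler_pXn2r _ 2) ?nnegrE ?mulr_ge0 ?l2norm_ge0//.
    rewrite exprMn fn (orthonormal_comb_norm (B := B) Hl BH)// mulr_sumr.
    rewrite big_seq [leRHS]big_seq; apply: ler_sum => b bL.
    rewrite normc_mul normc_conj exprMn ler_wpM2r ?sqr_ge0//.
    by rewrite normc_real ler_pXn2r ?nnegrE ?normr_ge0// LK.
  have := Aw Afg x; rewrite fx normc_real ger0_norm// => h.
  have {}h : S <= normc (w x) * (1 + K) * l2norm f.
    apply: le_trans h _; rewrite -mulrA ler_wpM2l ?normc_ge0// mulrDl mul1r.
    by rewrite lerD2l.
  move: h; rewrite -fn; have := l2norm_ge0 f; rewrite le_eqVlt => /predU1P[<- _|fp].
    by rewrite expr0n/= mulr_ge0 ?sqr_ge0.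
  rewrite expr2 ler_pM2r// => h; rewrite -exprMn mulrC.
  have := h; rewrite -(@ler_pXn2r _ 2) ?nnegrE ?mulr_ge0 ?normc_ge0 ?(ltW fp) ?addr_ge0//.
  by rewrite expr2 [_ * (1 + K)]mulrC.
(* A finite set catching half of the squared norm of every [b] keeps the double sum finite; this is
   the factor 2 of the bound. *)
have /choice[Xs XsP] : forall b, exists X : seq T, b \in L -> 2^-1 <= \sum_(x <- X) normc (b x) ^+ 2 /\ uniq X.
  move=> b; have [bL|] := boolP (b \in L); last by exists [::].
  have b0 x : 0 <= normc (b x) ^+ 2 by rewrite sqr_ge0.
  have p2 : 0 < 2^-1 :> R by rewrite invr_gt0.
  have [X uX h] := summ_approx b0 (Ll _ bL) p2.
  exists X => _; split=> //; move: h; rewrite -l2norm_sqr.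
  have := inner_self (Ll _ bL); rewrite L1// => -[<-]; lra.
pose X := undup (flatten [seq Xs b | b <- L]).
have bX b : b \in L -> 2^-1 <= \sum_(x <- X) normc (b x) ^+ 2.
  move=> bL; have [h uX] := XsP b bL; apply: le_trans h _.
  rewrite (perm_big [seq x <- X | x \in Xs b]) /=.
    rewrite big_filter big_mkcond; apply: ler_sum => x _.
    by case: ifP => // _; rewrite sqr_ge0.
  apply: uniq_perm => //; first by rewrite filter_uniq// undup_uniq.
  move=> x; rewrite mem_filter mem_undup; case: (boolP (x \in Xs b)) => //= xb.
  by apply/esym/flattenP; exists (Xs b) => //; apply: map_f.
have h1 : (size L)%:R * 2^-1 <= \sum_(b <- L) \sum_(x <- X) normc (b x) ^+ 2.
  rewrite mulrC mulr_natr -[X in X <= _](_ : \sum_(b <- L) 2^-1 = _).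
    by rewrite big_seq [leRHS]big_seq; apply: ler_sum => b /bX.
  by rewrite big_const_seq count_predT iter_addr_0.
have h2 : \sum_(b <- L) \sum_(x <- X) normc (b x) ^+ 2 <= (1 + K) ^+ 2 * l2norm w ^+ 2.
  rewrite exchange_big /=; apply: le_trans (ler_sum _ (fun x _ => pt x)) _.
  rewrite -mulr_sumr ler_wpM2l ?sqr_ge0//; apply: l2_sumub => //.
  exact: undup_uniq.
rewrite exprMn; move: (le_trans h1 h2); lra.
Qed.

End DominatedOperators.

(** * Orthonormal eigenbasis and isolated eigenvalues when eigenvalues are simple *)

Section SimpleSpectrum.
Variables (R : realType) (T : choiceType).
Local Notation C := R[i].
Local Notation L2 := (@l2 R T).
Variables (A : graph R T) (w : T -> C).
Hypotheses (saA : selfadjoint L2 A) (lw : l2 w).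
Hypothesis Aw : forall f g, A (f, g) ->
  forall x, normc (f x) <= normc (w x) * (l2norm f + l2norm g).
Hypothesis simple : forall (z : C) f g, A (f, z *: f) -> A (g, z *: g) -> g <> 0 ->
  exists c : C, f = c *: g.

(** Simplicity allows one unit eigenvector [v t] per eigenvalue [t], and [eigenvectors_total] makes
    this set total. Eigenvalues accumulating at [z] would provide arbitrarily many orthonormal
    eigenvectors with eigenvalues bounded by [|z| + 1], against [orthonormal_eigen_count]. *)
Theorem simple_spectrum : exists (B : set (T -> C)) (mu : (T -> C) -> R),
  [/\ forall b, B b -> A (b, (mu b)%:C%C *: b),
      forall b, B b -> inner b b = 1,
      forall b c, B b -> B c -> b <> c -> inner b c = 0,
      L2 `<=` l2_closure (linear_span B)
    & forall z : C, exists2 e : R, 0 < e &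
        forall b, B b -> normc (z - (mu b)%:C%C) < e -> (mu b)%:C%C = z].
Proof.
have Al := selfadjoint_sub saA; have AA := selfadjoint_subspace saA.
pose E := [set t : R | exists f, f <> 0 /\ A (f, t%:C%C *: f)].
have /choice[v vP] : forall t, exists f, E t -> A (f, t%:C%C *: f) /\ inner f f = 1.
  move=> t; have [[f [f0 Af]]|NE] := EM (E t); last by exists 0.
  have [/= lf _] := Al _ Af.
  have fp : 0 < l2norm f.
    by rewrite lt_def l2norm_ge0 andbT; apply/eqP => /(l2norm_eq0 lf).
  exists (((l2norm f)^-1)%:C%C *: f) => _; split.
    have := subspaceZ ((l2norm f)^-1)%:C%C AA Af; congr (A (_, _)).
    by rewrite /= !scalerA mulrC.
  rewrite inner_self; last exact: l2Z.
  by rewrite l2normZ// normc_real gtr0_norm ?invr_gt0// mulVf ?gt_eqF// expr1n.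
pose B := v @` E.
have vE t : E t -> A (v t, t%:C%C *: v t) by move=> /vP[].
have v1 t : E t -> inner (v t) (v t) = 1 by move=> /vP[].
have /choice[mu muP] : forall b, exists t, B b -> E t /\ b = v t.
  move=> b; have [[t Et <-]|] := EM (B b); first by exists t.
  by exists 0.
have BA b : B b -> A (b, (mu b)%:C%C *: b).
  by move=> /muP[Et bE]; rewrite {1 3}bE; apply: vE.
have B1 b : B b -> inner b b = 1 by move=> /muP[Et bE]; rewrite bE; apply: v1.
have Bl b : B b -> l2 b by move=> /BA /Al[].
have B0 b c : B b -> B c -> b <> c -> inner b c = 0.
  move=> Bb Bc bc; have [lb lc] := conj (Bl _ Bb) (Bl _ Bc).
  have := selfadjoint_symmetric saA (BA _ Bb) (BA _ Bc).
  rewrite /= innerZl// innerZr// conjc_realE => /eqP.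
  rewrite -subr_eq0 -mulrBl mulf_eq0 => /orP[|/eqP//].
  rewrite subr_eq0 => /eqP/complexI bcE; exfalso; apply: bc.
  by have [[_ ->] [_ ->]] := conj (muP _ Bb) (muP _ Bc); rewrite bcE.
exists B, mu; split=> //.
- apply: l2_total; first exact: Bl.
  move=> u lu uB; apply: (eigenvectors_total saA lw Aw); split=> // e [e0 [z Ae]].
  have zR := selfadjoint_eigenvalue_real saA Ae e0.
  have zE : z = (complex.Re z)%:C%C.
    by case: z zR {Ae} => x y /= -[] yE; apply/eqP; rewrite eq_complex /= eqxx /=;
      apply/eqP; move: yE; lra.
  have Et : E (complex.Re z) by exists e; rewrite -zE.
  have Av := vE _ Et; rewrite -zE in Av.
  have vN : v (complex.Re z) <> 0.
    by move=> v0; have := v1 _ Et; rewrite v0 inner0l => /esym/eqP; rewrite oner_eq0.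
  have Bv : B (v (complex.Re z)) by exists (complex.Re z).
  have [c ->] := simple Ae Av vN; rewrite innerZr//; last exact: Bl.
  by rewrite innerC ?uB ?rmorph0 ?mulr0//; apply: Bl.
move=> z; apply: contrapT => Nz.
have next (e : R) : 0 < e ->
    exists2 b, B b & normc (z - (mu b)%:C%C) < e /\ (mu b)%:C%C <> z.
  move=> e0; apply: contrapT => h; apply: Nz; exists e => // b Bb zb.
  by apply: contrapT => bz; apply: h; exists b.
(* Each new eigenvalue is taken strictly closer to [z] than the earlier ones, hence belongs to a new
   vector. *)
have lists n : exists L : seq (T -> C), [/\ size L = n, uniq L &
    forall b, b \in L -> [/\ B b, normc (z - (mu b)%:C%C) < 1 & (mu b)%:C%C <> z]].
  elim: n => [|n [L [sL uL LP]]]; first by exists [::].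
  have [e [e0 e1 eL]] : exists e : R, [/\ 0 < e, e <= 1 &
      forall b, b \in L -> e <= normc (z - (mu b)%:C%C)].
    elim: L LP {sL uL} => [|b L IH] LP; first by exists 1.
    have [c cL|e [e0 e1 eL]] := IH; first by apply: LP; rewrite in_cons cL orbT.
    exists (Num.min e (normc (z - (mu b)%:C%C))); split.
    - rewrite lt_min e0 lt_def normc_ge0 andbT; apply/eqP => /normc_eq0/eqP.
      by rewrite subr_eq0 => /eqP zb; have [_ _] := LP b (mem_head _ _); apply.
    - by rewrite ge_min e1.
    move=> c; rewrite in_cons ge_min => /orP[/eqP ->|/eL ->//].
    by rewrite lexx orbT.
  have [b Bb [be bz]] := next e e0; exists (b :: L); split.
  - by rewrite /= sL.
  - by rewrite /= uL andbT; apply/negP => /eL; rewrite leNgt be.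
  move=> c; rewrite in_cons => /orP[/eqP ->|/LP//].
  by split=> //; apply: lt_le_trans be e1.
pose K := normc z + 1.
pose n := Num.bound (2 * ((1 + K) * l2norm w) ^+ 2).
have [L [sL uL LP]] := lists n.
have LB b : b \in L -> B b by move=> /LP[].
have K0 : 0 <= K by rewrite addr_ge0 ?normc_ge0.
have LK b : b \in L -> `|mu b| <= K.
  move=> /LP[_ zb _]; rewrite -normc_real.
  have -> : (mu b)%:C%C = z - (z - (mu b)%:C%C) by rewrite opprB addrC subrK.
  by apply: le_trans (normc_triangle _ _) _; rewrite normc_opp /K; lra.
have := orthonormal_eigen_count saA lw Aw uL (fun b bL => BA b (LB b bL))
  (fun b bL => B1 b (LB b bL)) (fun b c bL cL => B0 b c (LB b bL) (LB c cL)) K0 LK.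
by rewrite sL leNgt archi_boundP// mulr_ge0// sqr_ge0.
Qed.

End SimpleSpectrum.

(** * Jacobi matrices in the limit circle case *)

Section FinitelySupportedOperators.
Variables (R : realType) (T : choiceType).
Local Notation C := R[i].
Local Notation L2 := (@l2 R T).
Implicit Types (G : graph R T) (f g u : T -> C).

Lemma linear_span_L2 G : G `<=` L2 `*` L2 -> linear_span G `<=` L2 `*` L2.
Proof.
move=> Gl; apply: linear_span_min => //; apply: subspaceP.
  by split; apply: l20.
by move=> c u v [lu1 lu2] [lv1 lv2]; split; apply: l2D => //; apply: l2Z.
Qed.

Lemma adjoint_linear_span G : G `<=` L2 `*` L2 ->
  adjoint L2 (linear_span G) = adjoint L2 G.
Proof.
move=> Gl; apply/seteqP; split; first exact/adjointS/sub_linear_span.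
move=> [f g] [/= lf lg fg]; split=> // q Gq.
pose S := [set q : (T -> C) * (T -> C) | [/\ l2 q.1, l2 q.2 & inner q.2 f = inner q.1 g]].
have [] // : S q; apply: linear_span_min Gq.
  by move=> p Gp; have [l1 l2'] := Gl _ Gp; split=> //; apply: fg.
apply: subspaceP; first by split; [exact: l20|exact: l20|rewrite /= !inner0l].
move=> c u v [lu1 lu2 uE] [lv1 lv2 vE]; split=> /=.
- by apply: l2D => //; apply: l2Z.
- by apply: l2D => //; apply: l2Z.
by rewrite !innerDl ?innerZl ?uE ?vE//; apply: l2Z.
Qed.

Lemma symmetric_linear_span G : G `<=` L2 `*` L2 -> symmetric G ->
  symmetric (linear_span G).
Proof.
move=> Gl sG p q Gp Gq.
suff : adjoint L2 (linear_span G) q by case=> _ _; apply.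
apply: (linear_span_min _ _ Gq); rewrite adjoint_linear_span//.
  exact: adjointP_sym.
exact: adjoint_subspace (@l2_span _ _ L2 (fun _ => id)) Gl.
Qed.

Variable c : T -> T -> C.
Hypothesis cl : forall x, l2 (c x).

Let G := range (fun x => (delta R x, c x)).

Let Gl : G `<=` L2 `*` L2.
Proof. by move=> _ [x _ <-]; split; [exact: delta_l2|exact: cl]. Qed.

Lemma finsupp_sub : finsupp_operator c `<=` L2 `*` L2.
Proof. exact: linear_span_L2. Qed.

Lemma finsupp_subspace : linear_span (finsupp_operator c) `<=` finsupp_operator c.
Proof. exact: linear_span_subspace. Qed.

Lemma finsupp_column x : finsupp_operator c (delta R x, c x).
Proof. by apply: sub_linear_span; exists x. Qed.

(** The adjoint is the maximal operator: the formal action of the conjugate transpose on every [f]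
    for which the result is square summable. *)
Lemma finsupp_adjoint f g : adjoint L2 (finsupp_operator c) (f, g) <->
  [/\ l2 f, l2 g & forall x, g x = inner f (c x)].
Proof.
rewrite /finsupp_operator adjoint_linear_span//.
split=> [[/= lf lg fg]|[lf lg fg]]; split=> //= x.
  have := fg (delta R x, c x) (ex_intro2 _ _ x I erefl); rewrite /=.
  rewrite [inner (delta R x) g]innerC//; last exact: delta_l2.
  rewrite inner_delta innerC// => /(congr1 Num.conj).
  by rewrite !conjCK.
move=> [y _ <-] /=; have ld := delta_l2 R y.
by rewrite innerC// [RHS]innerC// inner_delta fg.
Qed.

Lemma finsupp_domain : L2 `<=` l2_closure (domain (finsupp_operator c)).
Proof.
apply: subset_trans (@finsupp_dense R T) (l2_closureS _).
apply: linear_span_min; first by move=> _ [x _ <-]; exists (c x); apply: finsupp_column.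
apply: subspaceP; first by exists 0; apply: (subspace0 finsupp_subspace).
move=> a u v [u' Au] [v' Av]; exists (a *: u' + v').
exact: (subspace_lin a finsupp_subspace Au Av).
Qed.

Hypothesis cH : forall x y, c x y = (c y x)^*.

Lemma finsupp_symmetric : symmetric (finsupp_operator c).
Proof.
apply: symmetric_linear_span => // _ _ [x _ <-] [y _ <-] /=.
have ld := delta_l2 R x.
by rewrite inner_delta innerC// inner_delta.
Qed.

(** Contrapositive of [selfadjoint_criterion]. The sign of [z] stays open; for Jacobi matrices it is
    fixed later by complex conjugation. *)
Lemma finsupp_deficiency : ~ essentially_selfadjoint L2 (finsupp_operator c) ->
  exists (z : C) u, [/\ z = 'i%C \/ z = - 'i%C, l2 u, u <> 0 &
    forall x, z * u x = inner u (c x)].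
Proof.
move=> NE; apply: contrapT => h; apply: NE.
have d z : z = 'i%C \/ z = - 'i%C -> deficiency_trivial (finsupp_operator c) z.
  move=> zi u lu /finsupp_adjoint[_ _ uE]; apply: contrapT => u0; apply: h.
  by exists z, u.
apply: selfadjoint_criterion; [exact: finsupp_sub|exact: finsupp_subspace|
  exact: finsupp_symmetric|exact: finsupp_domain|apply: d; by left|apply: d; by right].
Qed.

Lemma finsupp_extension_adjoint (A : graph R T) f g :
  selfadjoint_extension L2 (finsupp_operator c) A -> A (f, g) ->
  [/\ l2 f, l2 g & forall x, g x = inner f (c x)].
Proof.
move=> [SA sA] Afg; apply/finsupp_adjoint; apply: adjointS SA _ _.
by rewrite selfadjoint_adjoint.
Qed.

End FinitelySupportedOperators.

Section AbsoluteSums.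
Variables (R : realType) (T : choiceType).
Local Notation C := R[i].

Lemma l2_eq_normc (f g : T -> C) : (forall x, normc (f x) = normc (g x)) ->
  l2 f -> l2 g.
Proof.
move=> fg; rewrite /l2 /=.
by have -> : (fun x => (normc (f x) ^+ 2)%:E) = (fun x => (normc (g x) ^+ 2)%:E)
  by apply/funext => x; rewrite fg.
Qed.

Lemma l2norm_eq_normc (f g : T -> C) : (forall x, normc (f x) = normc (g x)) ->
  l2norm f = l2norm g.
Proof.
move=> fg; rewrite /l2norm.
by have -> : (fun x => (normc (f x) ^+ 2)%:E) = (fun x => (normc (g x) ^+ 2)%:E)
  by apply/funext => x; rewrite fg.
Qed.

Lemma normc_abs (z : C) : normc (normc z)%:C%C = normc z.
Proof. by rewrite normc_real ger0_norm ?normc_ge0. Qed.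

(** The inequality for the functions of absolute values, whose inner product is a sum of nonnegative
    terms and so dominates its partial sums. *)
Lemma cauchy_schwarz_sum (f g : T -> C) (X : seq T) : l2 f -> l2 g -> uniq X ->
  \sum_(x <- X) normc (f x) * normc (g x) <= l2norm f * l2norm g.
Proof.
move=> lf lg uX; pose f' x : C := (normc (f x))%:C%C; pose g' x : C := (normc (g x))%:C%C.
have lf' : l2 f' by apply: l2_eq_normc lf => x; rewrite normc_abs.
have lg' : l2 g' by apply: l2_eq_normc lg => x; rewrite normc_abs.
have -> : l2norm f = l2norm f' by apply: l2norm_eq_normc => x; rewrite normc_abs.
have -> : l2norm g = l2norm g' by apply: l2norm_eq_normc => x; rewrite normc_abs.
apply: le_trans (cauchy_schwarz lf' lg').
apply: le_trans (Re_le_normc _); rewrite /inner /csum /=.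
have [r1 _] := summ_inner lf' lg'.
have rE : (fun x => complex.Re (f' x * (g' x)^*)) = fun x => normc (f x) * normc (g x).
  by apply/funext => x; rewrite conjc_realE -rmorphM.
rewrite rE; have {}r1 : summable [set: T] (fun x => (normc (f x) * normc (g x))%:E).
  by apply: summ_le r1 => x; rewrite conjc_realE -rmorphM ger0_norm ?mulr_ge0 ?normc_ge0.
have p x : 0 <= normc (f x) * normc (g x) by rewrite mulr_ge0 ?normc_ge0.
by rewrite rsum_ge0E// ger0_norm ?tsum_ge0//; apply: summ_ub.
Qed.

End AbsoluteSums.

(** * Three-term recurrences and their Wronskians *)

Section JacobiMatrices.
Variable R : realType.
Local Notation C := R[i].
Local Notation L2 := (@l2 R nat).
Implicit Types (a b : nat -> R) (f g u v : nat -> C) (z : C).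

Lemma l2_shift f : l2 (fun k => f k.+1) <-> l2 f.
Proof.
split=> lf.
- apply: (@l2_sumlub _ _ f (normc (f 0%N) ^+ 2 + l2norm (fun k => f k.+1) ^+ 2) _).1.
  move=> X uX; pose Y := [seq k.-1 | k <- X & (k != 0)%N].
  apply: le_trans (_ : normc (f 0%N) ^+ 2 + \sum_(k <- Y) normc (f k.+1) ^+ 2 <= _).
    rewrite (bigID (fun k => k == 0%N)) /=; apply: lerD.
      have [X0|X0] := boolP (0%N \in X); last first.
        by rewrite big1_seq ?sqr_ge0// => k /andP[/eqP -> kX]; rewrite kX in X0.
      rewrite big_mkcond (bigD1_seq 0%N)//= big1 ?addr0//.
      by move=> k /negbTE ->.
    rewrite /Y big_map big_filter; apply: ler_sum => k k0.
    by rewrite prednK// lt0n.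
  rewrite lerD2l; apply: (@l2_sumub _ _ (fun k => f k.+1)) => //.
  rewrite map_inj_in_uniq ?filter_uniq// => i j.
  by rewrite !mem_filter; case: i => // i; case: j => //= j _ _ ->.
- apply: (@l2_sumlub _ _ _ (l2norm f ^+ 2) _).1 => X uX.
  rewrite -(big_map S xpredT (fun k => normc (f k) ^+ 2)); apply: (l2_sumub lf).
  by rewrite map_inj_uniq//; apply: succn_inj.
Qed.

(** The matrix acting on arbitrary sequences, without any domain; solutions of the recurrence need
    not be square summable. *)
Definition jac b a f (k : nat) : C :=
  (if k is k'.+1 then (a k')%:C%C * f k' else 0) + (b k)%:C%C * f k
  + (a k)%:C%C * f k.+1.

Lemma jacobi_columnE b a j : (fun i => jacobi_matrix b a i j) =
  (if j is j'.+1 then (a j')%:C%C *: delta R j' else 0) + (b j)%:C%C *: delta R j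
  + (a j)%:C%C *: delta R j.+1.
Proof.
apply/funext => i; rewrite /jacobi_matrix.
have E k (x : C) : (x *: delta R k) i = if i == k then x else 0.
  by rewrite scale_fctE /delta; case: ifP; rewrite ?mulr1 ?mulr0.
rewrite -[RHS]/((if j is j'.+1 then (a j')%:C%C *: delta R j' else 0 : nat -> C) i +
  ((b j)%:C%C *: delta R j) i + ((a j)%:C%C *: delta R j.+1) i) !E.
have F : (if j is j'.+1 then (a j')%:C%C *: delta R j' else 0 : nat -> C) i =
    if j == i.+1 then (a i)%:C%C else 0.
  case: j {E} => [//|j]; rewrite scale_fctE /delta eqSS eq_sym.
  by case: eqP => [->|]; rewrite ?mulr1 ?mulr0.
rewrite F; have [->|ij] := eqVneq i j.
  by rewrite (ltn_eqF (ltnSn j)) add0r addr0.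
have [ij1|ij1] := eqVneq i j.+1.
  by rewrite ifF ?addr0 ?add0r// ij1; apply/negbTE; rewrite neq_ltn ltnW ?orbT.
by rewrite !addr0; case: ifP.
Qed.

Lemma jacobi_column_l2 b a j : l2 (fun i => jacobi_matrix b a i j : C).
Proof.
rewrite jacobi_columnE; apply: l2D; last exact/l2Z/delta_l2.
apply: l2D; last exact/l2Z/delta_l2.
by case: j => [|j]; [exact: l20|exact/l2Z/delta_l2].
Qed.

Lemma inner_jacobi_column b a f j : l2 f ->
  inner f (fun i => jacobi_matrix b a i j) = jac b a f j.
Proof.
move=> lf; have ld (k : nat) := delta_l2 R k; have lZ (x : C) k := l2Z x (ld k).
rewrite jacobi_columnE !innerDr//; last 2 first.
- by case: j => [|j]; [exact: l20|exact: lZ].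
- by apply: l2D => //; case: j => [|j]; [exact: l20|exact: lZ].
rewrite !innerZr// !inner_delta !conjc_realE /jac; congr (_ + _ + _).
by case: j => [|j]; rewrite ?inner0r// innerZr// inner_delta conjc_realE.
Qed.

Lemma jacobi_matrix_sym b a i j : jacobi_matrix b a i j = (jacobi_matrix b a j i)^*.
Proof.
rewrite /jacobi_matrix conjc_realE; congr (_%:C%C).
have [->//|ij] := eqVneq i j.
by have [e|] := eqVneq i j.+1; case: eqVneq => // e'; move: e e'; lia.
Qed.

Lemma jacD b a f g x y k :
  jac b a (fun k => x * f k + y * g k) k = x * jac b a f k + y * jac b a g k.
Proof. by rewrite /jac; case: k => [|k]; ring. Qed.

Lemma jac_conj b a f k : jac b a (fun k => (f k)^*) k = (jac b a f k)^*.
Proof.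
rewrite /jac !rmorphD !rmorphM /= !(conjc_realE (b k)) !(conjc_realE (a k)).
by case: k => [|k]; rewrite ?rmorph0// rmorphM /= (conjc_realE (a k)).
Qed.

Section Solutions.
Variables (b a : nat -> R).
Hypothesis a0 : forall k, 0 < a k.

Let aC k : (a k)%:C%C != 0 :> C.
Proof. by rewrite (inj_eq (@complexI R) _ 0) gt_eqF. Qed.

(** Row 0 is left out: the solutions then form a two-dimensional space, and the condition behaves
    well under shifts of the recurrence. *)
Definition solves z f := forall k, jac b a f k.+1 = z * f k.+1.

Lemma solves_unique z f g : solves z f -> solves z g ->
  f 0%N = g 0%N -> f 1%N = g 1%N -> f = g.
Proof.
move=> sf sg e0 e1; suff K k : f k = g k /\ f k.+1 = g k.+1.
  by apply/funext => k; case: (K k).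
elim: k => [//|k [h1 h2]]; split=> //.
have := sf k; have := sg k; rewrite /jac h1 h2 => <- /addrI.
exact: (mulfI (aC k.+1)).
Qed.

Lemma eigen_unique z f g : (forall k, jac b a f k = z * f k) ->
  (forall k, jac b a g k = z * g k) -> g 0%N <> 0 ->
  f = (f 0%N / g 0%N) *: g.
Proof.
move=> sf sg g0; set x := _ / _.
have E k : jac b a (x *: g) k = z * (x *: g) k.
  have -> : x *: g = fun k => x * g k + 0 * g k by apply/funext => i; rewrite mul0r addr0.
  by rewrite jacD sg; ring.
have e0 : f 0%N = (x *: g) 0%N by rewrite scale_fctE divfK//; apply/eqP.
apply: (@solves_unique z _ _ (fun k => sf k.+1) (fun k => E k.+1) e0).
have := sf 0%N; have := E 0%N; rewrite /jac e0 => <- /addrI.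
exact: (mulfI (aC 0)).
Qed.

Lemma eigen_neq0 z f : (forall k, jac b a f k = z * f k) -> f 0%N = 0 -> f = 0.
Proof.
move=> sf f0; have s0 : solves z (0 : nat -> C).
  by move=> k; rewrite /jac -[(0 : nat -> C)]/(fun=> 0 : C) !mulr0 !addr0.
apply: (@solves_unique z _ _ (fun k => sf k.+1) s0 f0).
have := sf 0%N; rewrite /jac f0 !mulr0 !add0r => /eqP.
by rewrite mulf_eq0 (negbTE (aC 0)) => /eqP.
Qed.

Lemma solvesD z f g x y : solves z f -> solves z g ->
  solves z (fun k => x * f k + y * g k).
Proof. by move=> sf sg k; rewrite jacD sf sg; ring. Qed.

(** Carrying two consecutive values [(f n, f n.+1)] makes the second-order recurrence structurally
    recursive. *)
Fixpoint solution_pair z (x y : C) (n : nat) : C * C :=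
  if n is n'.+1 then
    let p := solution_pair z x y n' in
    (p.2, ((z - (b n)%:C%C) * p.2 - (a n')%:C%C * p.1) / (a n)%:C%C)
  else (x, y).

Lemma solution_exists z x y : exists f, [/\ solves z f, f 0%N = x & f 1%N = y].
Proof.
exists (fun n => (solution_pair z x y n).1); split=> // k.
rewrite /jac /=; move: (solution_pair z x y k) => p.
have := aC k.+1; move: ((a k.+1)%:C%C) => w wN; field.
exact: wN.
Qed.

(** Substituting the recurrences at [k+1], the terms with [z] and [b] are symmetric in [u] and [v]
    and cancel. *)
Lemma wronskian_const z u v k : solves z u -> solves z v ->
  (a k)%:C%C * (u k * v k.+1 - u k.+1 * v k) =
  (a 0)%:C%C * (u 0%N * v 1%N - u 1%N * v 0%N).
Proof.
move=> su sv; elim: k => [//|k <-].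
have := su k; have := sv k; rewrite /jac => ev eu.
have {}ev : (a k.+1)%:C%C * v k.+2 = z * v k.+1 - (b k.+1)%:C%C * v k.+1 - (a k)%:C%C * v k.
  by rewrite -ev; ring.
have {}eu : (a k.+1)%:C%C * u k.+2 = z * u k.+1 - (b k.+1)%:C%C * u k.+1 - (a k)%:C%C * u k.
  by rewrite -eu; ring.
rewrite mulrBr mulrCA ev [_ * (u _ * _)]mulrA eu; ring.
Qed.

(* Variation of constants: the Wronskians of f with two solutions u, v at i
   are partial sums of products of g - i f with square summable sequences. *)
Lemma wronskian_bound u v : l2 u -> l2 v -> solves 'i%C v ->
  exists2 K : R, 0 <= K & forall f g, l2 f -> l2 g -> (forall k, g k = jac b a f k) ->
    forall k, normc ((a k)%:C%C * (f k * v k.+1 - f k.+1 * v k)) <= K * (l2norm f + l2norm g).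
Proof.
(* The first summand bounds the Wronskian at index 0 through two values of [f]; the second is the
   Cauchy-Schwarz bound of the remainder [sum h * v] with [h = g - i f]. *)
move=> lu lv sv; pose K := a 0%N * (normc (v 1%N) + normc (v 0%N)) + l2norm v.
have a00 := ltW (a0 0%N).
have K0 : 0 <= a 0%N * (normc (v 1%N) + normc (v 0%N)).
  by rewrite mulr_ge0// addr_ge0 ?normc_ge0.
exists K; first by rewrite addr_ge0 ?l2norm_ge0.
move=> f g lf lg fg k; pose h := g - 'i%C *: f.
have lh : l2 h by apply: sub_scale_l2.
pose s k := (a k)%:C%C * (f k * v k.+1 - f k.+1 * v k).
have sS j : s j.+1 = s j - h j.+1 * v j.+1.
  have := sv j; rewrite /jac => ev; have := fg j.+1; rewrite /jac => ef.
  have {}ev : (a j.+1)%:C%C * v j.+2 = 'i%C * v j.+1 - (b j.+1)%:C%C * v j.+1 - (a j)%:C%C * v j.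
    by rewrite -ev; ring.
  have {}ef : (a j.+1)%:C%C * f j.+2 = g j.+1 - (b j.+1)%:C%C * f j.+1 - (a j)%:C%C * f j.
    by rewrite ef; ring.
  rewrite /s -[h j.+1]/(g j.+1 - 'i%C * f j.+1) mulrBr mulrCA ev [_ * (f _ * _)]mulrA ef.
  by ring.
have sE j : s j = s 0%N - \sum_(i <- iota 1 j) h i * v i.
  elim: j => [|j IH]; first by rewrite big_nil subr0.
  have -> : iota 1 j.+1 = iota 1 j ++ [:: j.+1] by rewrite -(addn1 j) iotaD add1n addn1.
  by rewrite sS IH big_cat /= big_seq1 opprD addrA.
rewrite -/(s k) sE; apply: le_trans (normc_triangle _ _) _; rewrite normc_opp.
have h1 : normc (s 0%N) <= a 0%N * (normc (v 1%N) + normc (v 0%N)) * l2norm f.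
  rewrite /s normc_mul normc_real (ger0_norm a00) -mulrA ler_wpM2l//.
  apply: le_trans (normc_triangle _ _) _; rewrite normc_opp !normc_mul mulrDl.
  by apply: lerD; [rewrite mulrC|rewrite mulrC]; rewrite ler_wpM2l ?normc_ge0 ?normc_le_l2norm.
have h2 : normc (\sum_(i <- iota 1 k) h i * v i) <= l2norm h * l2norm v.
  apply: le_trans (normc_sum _ _) _; under eq_bigr do rewrite normc_mul.
  by apply: cauchy_schwarz_sum => //; apply: iota_uniq.
have h3 : l2norm h <= l2norm f + l2norm g.
  apply: le_trans (l2normB lg (l2Z _ lf)) _; rewrite l2normZ// normc_i mul1r addrC//.
have := ler_wpM2r (l2norm_ge0 v) h3.
have h4 : a 0%N * (normc (v 1%N) + normc (v 0%N)) * l2norm f <=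
  a 0%N * (normc (v 1%N) + normc (v 0%N)) * (l2norm f + l2norm g).
  by rewrite ler_wpM2l// lerDl l2norm_ge0.
have -> : K * (l2norm f + l2norm g) =
    a 0%N * (normc (v 1%N) + normc (v 0%N)) * (l2norm f + l2norm g) +
    (l2norm f + l2norm g) * l2norm v by rewrite /K; ring.
by move: h1 h2 h4; lra.
Qed.

(** With the Wronskian of [u] and [v] equal to 1, Cramer's rule writes [f k] as
    [W(f,v) * u k - W(f,u) * v k], and both Wronskians are bounded uniformly in [k]. *)
Lemma jacobi_domination u v : l2 u -> l2 v -> solves 'i%C u -> solves 'i%C v ->
  (a 0)%:C%C * (u 0%N * v 1%N - u 1%N * v 0%N) = 1 ->
  exists2 w, l2 w & forall f g, l2 f -> l2 g -> (forall k, g k = jac b a f k) ->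
    forall k, normc (f k) <= normc (w k : C) * (l2norm f + l2norm g).
Proof.
move=> lu lv su sv W.
have [K1 K10 HK1] := wronskian_bound lu lv sv.
have [K2 K20 HK2] := wronskian_bound lv lu su.
pose w k : C := ((K1 * normc (u k) + K2 * normc (v k)))%:C%C.
have wE k : normc (w k) = K1 * normc (u k) + K2 * normc (v k).
  by rewrite normc_real ger0_norm// addr_ge0// mulr_ge0 ?normc_ge0.
have abs_l2 (h : nat -> C) : l2 h -> l2 (fun k => (normc (h k))%:C%C : C).
  by apply: l2_eq_normc => k; rewrite normc_abs.
exists w.
  have -> : w = K1%:C%C *: (fun k => (normc (u k))%:C%C : C) +
      K2%:C%C *: (fun k => (normc (v k))%:C%C : C).
    by apply/funext => k; rewrite /w rmorphD !rmorphM.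
  by apply: l2D; apply/l2Z/abs_l2.
move=> f g lf lg fg k; rewrite wE.
have -> : f k = (a k)%:C%C * (f k * v k.+1 - f k.+1 * v k) * u k -
    (a k)%:C%C * (f k * u k.+1 - f k.+1 * u k) * v k.
  rewrite -[LHS]mulr1 -W -(wronskian_const k su sv); ring.
apply: le_trans (normc_triangle _ _) _; rewrite normc_opp [leLHS]addrC addrC.
rewrite !normc_mul -!normc_mul mulrDl; apply: lerD; rewrite normc_mul mulrAC.
- by rewrite ler_wpM2r ?normc_ge0// HK1.
- by rewrite ler_wpM2r ?normc_ge0// HK2.
Qed.

End Solutions.

End JacobiMatrices.

(** * The limit circle case and the selfadjoint extensions of a Jacobi matrix *)

Section LimitCircle.
Variable R : realType.
Local Notation C := R[i].
Local Notation L2 := (@l2 R nat).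
Implicit Types (f g h u v : nat -> C) (z : C).

(** Weyl's limit circle case, taken at the point [i], to which deficiency vectors at [-i] are
    carried by complex conjugation. *)
Definition limit_circle (b a : nat -> R) := forall f, solves b a 'i%C f -> l2 f.

Section OneMatrix.
Variables (b a : nat -> R).
Hypothesis a0 : forall k, 0 < a k.

Let aC k : (a k)%:C%C != 0 :> C.
Proof. by rewrite (inj_eq (@complexI R) _ 0) gt_eqF. Qed.

Definition jacobi_operator : graph R nat :=
  finsupp_operator (fun j i => jacobi_matrix b a i j).

Let cl := jacobi_column_l2 b a.
Let Jl := finsupp_sub cl.

Lemma jacobi_adjoint f g : adjoint L2 jacobi_operator (f, g) <->
  [/\ l2 f, l2 g & forall k, g k = jac b a f k].
Proof.
split=> [/(finsupp_adjoint cl)[lf lg fg]|[lf lg fg]].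
  by split=> // k; rewrite -inner_jacobi_column.
by apply/(finsupp_adjoint cl); split=> // k; rewrite inner_jacobi_column.
Qed.

Lemma jacobi_symmetric : symmetric jacobi_operator.
Proof. by apply: finsupp_symmetric => // x y; apply: jacobi_matrix_sym. Qed.

Lemma jacobi_extension_formal (A : graph R nat) f g :
  selfadjoint_extension L2 jacobi_operator A -> A (f, g) ->
  [/\ l2 f, l2 g & forall k, g k = jac b a f k].
Proof.
move=> /finsupp_extension_adjoint h /(h cl)[lf lg fg]; split=> // k.
by rewrite -inner_jacobi_column.
Qed.

(** Real coefficients let conjugation exchange [i] and [-i], and a nonzero solution of all rows
    cannot vanish at 0, so it can be normalised there. *)
Lemma jacobi_deficiency_vector z u : z = 'i%C \/ z = - 'i%C -> l2 u -> u <> 0 ->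
  (forall k, jac b a u k = z * u k) ->
  exists v, [/\ l2 v, v 0%N = 1 & forall k, jac b a v k = 'i%C * v k].
Proof.
move=> zi lu uN su.
have u0 : u 0%N != 0 by apply/eqP => /(eigen_neq0 a0 su).
case: zi su => -> su.
  (* The zero term gives the sequence the two-term shape of [jacD]. *)
  exists (fun k => (u 0%N)^-1 * u k + 0 * u k); split.
  - have -> : (fun k => (u 0%N)^-1 * u k + 0 * u k) = (u 0%N)^-1 *: u.
      by apply/funext => k; rewrite mul0r addr0.
    exact: l2Z.
  - by rewrite mul0r addr0 mulVf.
  - by move=> k; rewrite jacD su; ring.
have cu0 : (u 0%N)^* != 0 by rewrite conjC_eq0.
pose u' k := (u k)^*; have lu' : l2 u' by apply: l2_conj.
have su' k : jac b a u' k = 'i%C * u' k.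
  rewrite jac_conj su rmorphM; congr (_ * _).
  by rewrite -[LHS]/(Num.conj _) rmorphN /= conjc_i opprK.
exists (fun k => (u' 0%N)^-1 * u' k + 0 * u' k); split.
- have -> : (fun k => (u' 0%N)^-1 * u' k + 0 * u' k) = (u' 0%N)^-1 *: u'.
    by apply/funext => k; rewrite mul0r addr0.
  exact: l2Z.
- by rewrite mul0r addr0 mulVf.
- by move=> k; rewrite jacD su'; ring.
Qed.

Section DeficiencyVector.
Variable u : nat -> C.
Hypotheses (lu : l2 u) (u0 : u 0%N = 1) (su : forall k, jac b a u k = 'i%C * u k).

Let cu k := (u k)^*.
Let lcu : l2 cu. Proof. exact: l2_conj. Qed.
Let uN : u <> 0.
Proof. by move=> h; move: u0; rewrite h => /esym/eqP; rewrite oner_eq0. Qed.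

Let scu k : jac b a cu k = - 'i%C * cu k.
Proof.
by rewrite jac_conj su rmorphM; congr (_ * _); exact: conjc_i.
Qed.

Lemma jacobi_not_esa : ~ essentially_selfadjoint L2 jacobi_operator.
Proof.
move=> sa; have : op_closure jacobi_operator (u, 'i%C *: u).
  rewrite -(selfadjoint_adjoint sa) adjoint_op_closure; last exact: Jl.
  by apply/jacobi_adjoint; split=> //; apply: l2Z.
move=> /(selfadjoint_eigenvalue_real sa)/(_ uN).
by rewrite conjc_i => /(congr1 (@complex.Im R)) /=; lra.
Qed.

(* Von Neumann's extension: the closure of the operator extended to u + conj u. *)
Lemma jacobi_extension : exists A, selfadjoint_extension L2 jacobi_operator A.
Proof.
(* [chi] is the image of [phi] under the adjoint, since [u] and its conjugate are eigenvectors at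
   [i] and [-i]. *)
pose phi := u + cu; pose chi := 'i%C *: u - 'i%C *: cu.
have lphi : l2 phi by apply: l2D.
have lchi : l2 chi by apply: l2B; apply: l2Z.
have phichi : adjoint L2 jacobi_operator (phi, chi).
  apply/jacobi_adjoint; split=> // k.
  have -> : phi = fun k => 1 * u k + 1 * cu k by apply/funext => j; rewrite !mul1r.
  by rewrite jacD su scu -[LHS]/('i%C * u k - 'i%C * cu k); ring.
pose G := jacobi_operator `|` [set (phi, chi)].
have Gl : G `<=` L2 `*` L2 by move=> q [/Jl//|->].
have cross q : jacobi_operator q -> inner q.2 phi = inner q.1 chi.
  by case: phichi => _ _; apply.
have self : inner chi phi = inner phi chi.
  have nu : inner cu cu = inner u u.
    rewrite !inner_self//; congr ((_ ^+ 2)%:C%C); apply: l2norm_eq_normc => k.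
    by rewrite normc_conj.
  have lZ (x : C) f : l2 f -> l2 (x *: f) by apply: l2Z.
  rewrite /chi /phi innerBl ?innerBr ?innerZl ?innerZr ?innerDl ?innerDr//; try by apply: lZ.
  by rewrite nu conjc_i; ring.
have sG : symmetric G.
  move=> p q [Jp|->] [Jq|->] //=; [exact: jacobi_symmetric|exact: cross|].
  have [lq1 lq2] := Jl Jq; rewrite innerC// [RHS]innerC//.
  by rewrite -cross// -innerC//; congr (_^*); rewrite innerC.
pose S := linear_span G.
have JS : jacobi_operator `<=` S.
  by move=> q Jq; apply: sub_linear_span; left.
have Sl : S `<=` L2 `*` L2 := linear_span_L2 Gl.
have SS : linear_span S `<=` S by apply: linear_span_subspace.
(* Enlarging the operator shrinks the deficiency spaces: [h] is a deficiency vector of the original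
   matrix, hence a multiple of [u] or [cu], subject to one more equation from the pair
   [(phi, chi)]. *)
have defic z h : adjoint L2 S (h, z *: h) ->
    [/\ l2 h, forall k, jac b a h k = z * h k & inner chi h = z^* * inner phi h].
  move=> aS; have [lh _ hE] := aS; split=> //.
    have /jacobi_adjoint[_ _ jh] := adjointS JS aS.
    by move=> k; rewrite -jh.
  have := hE (phi, chi) (sub_linear_span (or_intror erefl)); rewrite /= innerZr//.
exists (op_closure S); split.
  by move=> q /JS; apply: sub_op_closure.
apply: selfadjoint_criterion => //.
- exact: symmetric_linear_span.
- apply: subset_trans (@finsupp_domain _ _ (fun j i => jacobi_matrix b a i j)) (l2_closureS _).
  by move=> f [g Jfg]; exists g; apply: JS.
- move=> h lh /defic[_ sh]; rewrite conjc_i.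
  have hE : h = h 0%N *: u.
    rewrite {1}(eigen_unique a0 sh su); first by rewrite u0 divr1.
    by rewrite u0; apply/eqP/oner_neq0.
  (* At [z = i] the extra equation reads [inner chi h = - i * inner phi h]; in this decomposition it
     becomes [2 i * inner u h = 0], which kills a multiple of [u]. *)
  have chiE : chi = - 'i%C *: phi + (2 * 'i%C) *: u.
    apply/funext => k; rewrite -[LHS]/('i%C * u k - 'i%C * cu k).
    by rewrite -[RHS]/(- 'i%C * (u k + cu k) + 2 * 'i%C * u k); ring.
  rewrite chiE innerDl ?innerZl//; try by apply: l2Z.
  move=> /eqP; rewrite -subr_eq0 addrAC subrr add0r {1}hE innerZr//.
  rewrite !mulf_eq0 => /orP[/orP[|]|/orP[|]].
  + by rewrite (pnatr_eq0 _ 2).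
  + by move=> /eqP i0; have := normc_i R; rewrite i0 normc_zero => /esym/eqP; rewrite oner_eq0.
  + by rewrite conjC_eq0 => /eqP h0; rewrite hE h0 scale0r.
  + by move=> /eqP/(inner_self_eq0 lu).
move=> h lh /defic[_ sh]; rewrite rmorphN /= conjc_i opprK.
have hE : h = h 0%N *: cu.
  have c0 : cu 0%N = 1 by rewrite /cu u0 rmorph1.
  rewrite {1}(eigen_unique a0 sh scu); first by rewrite c0 divr1.
  by rewrite c0; apply/eqP/oner_neq0.
have chiE : chi = 'i%C *: phi + (- 2 * 'i%C) *: cu.
  apply/funext => k; rewrite -[LHS]/('i%C * u k - 'i%C * cu k).
  by rewrite -[RHS]/('i%C * (u k + cu k) + - 2 * 'i%C * cu k); ring.
rewrite chiE innerDl ?innerZl//; try by apply: l2Z.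
move=> /eqP; rewrite -subr_eq0 addrAC subrr add0r {1}hE innerZr//.
rewrite !mulf_eq0 => /orP[/orP[|]|/orP[|]].
+ by rewrite oppr_eq0 (pnatr_eq0 _ 2).
+ by move=> /eqP i0; have := normc_i R; rewrite i0 normc_zero => /esym/eqP; rewrite oner_eq0.
+ by rewrite conjC_eq0 => /eqP h0; rewrite hE h0 scale0r.
move=> /eqP/(inner_self_eq0 lcu) cu0; exfalso; apply: uN.
apply/funext => k; apply/eqP; rewrite -conjC_eq0; apply/eqP.
by rewrite -/(cu k) cu0.
Qed.

(* The second solution is the resolvent of an extension applied to delta 0. *)
Lemma jacobi_limit_circle : limit_circle b a.
Proof.
have [A ext] := jacobi_extension; have sA := ext.2.
have [v Av] := selfadjoint_resolvent sA (conjc_i R) (normc_i R) (delta_l2 R 0%N).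
have [lv _ vE] := jacobi_extension_formal ext Av.
have sv : solves b a 'i%C v.
  move=> k; rewrite -vE -[LHS]/(delta R 0%N k.+1 + 'i%C * v k.+1).
  by rewrite delta_neq ?add0r.
have su' : solves b a 'i%C u by move=> k; apply: su.
(* The source [delta 0] enters only row 0, where it makes the Wronskian equal to 1; this is the
   independence of [u] and [v]. *)
have W : (a 0%N)%:C%C * (u 0%N * v 1%N - u 1%N * v 0%N) = 1.
  have := vE 0%N; rewrite -[LHS]/(delta R 0%N 0%N + 'i%C * v 0%N) deltaxx /jac add0r.
  have := su 0%N; rewrite /jac add0r u0 !mulr1 => e1 e2.
  have {}e1 : (a 0%N)%:C%C * u 1%N = 'i%C - (b 0%N)%:C%C by rewrite -e1; ring.
  have {}e2 : (a 0%N)%:C%C * v 1%N = 1 + 'i%C * v 0%N - (b 0%N)%:C%C * v 0%N.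
    by rewrite e2; ring.
  by rewrite mulrBr mul1r e2 mulrA e1; ring.
move=> f sf.
pose x := (a 0%N)%:C%C * (f 0%N * v 1%N - f 1%N * v 0%N).
pose y := (a 0%N)%:C%C * (f 1%N * u 0%N - f 0%N * u 1%N).
have -> : f = fun k => x * u k + y * v k.
  apply: (solves_unique a0 sf (solvesD x y su' sv)).
  - by rewrite -[LHS]mulr1 -W /x /y; ring.
  - by rewrite -[LHS]mulr1 -W /x /y; ring.
have -> : (fun k => x * u k + y * v k) = x *: u + y *: v by [].
by apply: l2D; apply: l2Z.
Qed.

End DeficiencyVector.

Section UnderLimitCircle.
Hypothesis lc : limit_circle b a.

Lemma limit_circle_vector :
  exists u, [/\ l2 u, u 0%N = 1 & forall k, jac b a u k = 'i%C * u k].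
Proof.
(* The value at 1 is the one that row 0 prescribes once the value at 0 is 1. *)
have [u [su u0 u1]] := solution_exists b a0 'i%C 1 (('i%C - (b 0%N)%:C%C) / (a 0%N)%:C%C).
exists u; split=> //; first exact: lc.
case=> [|k]; last exact: su.
by rewrite /jac u0 u1 [_ * (_ / _)]mulrC divfK//; ring.
Qed.

Lemma limit_circle_not_esa : ~ essentially_selfadjoint L2 jacobi_operator.
Proof. by have [u [lu u0 su]] := limit_circle_vector; apply: jacobi_not_esa su. Qed.

Lemma limit_circle_extension : exists A, selfadjoint_extension L2 jacobi_operator A.
Proof. by have [u [lu u0 su]] := limit_circle_vector; apply: jacobi_extension su. Qed.

Lemma limit_circle_domination : exists2 w, l2 w &
  forall f g, l2 f -> l2 g -> (forall k, g k = jac b a f k) ->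
    forall k, normc (f k) <= normc (w k : C) * (l2norm f + l2norm g).
Proof.
(* These two pairs of initial values have Wronskian 1. *)
have [u [su u0 u1]] := solution_exists b a0 'i%C 1 0.
have [v [sv v0 v1]] := solution_exists b a0 'i%C 0 ((a 0%N)%:C%C)^-1.
apply: (jacobi_domination a0 (lc su) (lc sv) su sv).
by rewrite u0 u1 v0 v1 mul1r mul0r subr0 mulfV.
Qed.

Lemma limit_circle_spectrum (A : graph R nat) :
  selfadjoint_extension L2 jacobi_operator A ->
  exists (B : set (nat -> C)) (mu : (nat -> C) -> R),
  [/\ forall b, B b -> A (b, (mu b)%:C%C *: b),
      forall b, B b -> inner b b = 1,
      forall b c, B b -> B c -> b <> c -> inner b c = 0,
      L2 `<=` l2_closure (linear_span B)
    & forall z : C, exists2 e : R, 0 < e &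
        forall b, B b -> normc (z - (mu b)%:C%C) < e -> (mu b)%:C%C = z].
Proof.
move=> ext; have [w lw dom] := limit_circle_domination.
apply: (simple_spectrum ext.2 lw).
  by move=> f g /(jacobi_extension_formal ext)[lf lg fg]; apply: dom.
move=> z f g /(jacobi_extension_formal ext)[_ _ sf] /(jacobi_extension_formal ext)[_ _ sg] gN.
have g0 : g 0%N <> 0 by move=> /(eigen_neq0 a0 (fun k => esym (sg k))).
exists (f 0%N / g 0%N).
exact: (eigen_unique a0 (fun k => esym (sf k)) (fun k => esym (sg k)) g0).
Qed.

End UnderLimitCircle.

(** Dropping the first value of a solution solves the shifted recurrence. Conversely a solution of
    the shifted one is prolonged backwards by the value [x] that row 1 forces, which is possible
    because [a 0] is nonzero and row 0 is free. Neither operation affects square summability. *)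
Lemma limit_circle_shift :
  limit_circle (fun k => b k.+1) (fun k => a k.+1) <-> limit_circle b a.
Proof.
split=> lc f sf.
  by apply/l2_shift/lc => k; apply: sf.
pose x := ('i%C * f 0%N - (b 1%N)%:C%C * f 0%N - (a 1%N)%:C%C * f 1%N) / (a 0%N)%:C%C.
apply/(l2_shift (fun k => if k is k'.+1 then f k' else x)); apply: lc => -[|k].
  by rewrite /jac /x [_ * (_ / _)]mulrC divfK//; ring.
exact: sf.
Qed.

End OneMatrix.

Lemma limit_circle_tails (b a : nat -> R) n : (forall k, 0 < a k) ->
  limit_circle (fun k => b (n + k)%N) (fun k => a (n + k)%N) <-> limit_circle b a.
Proof.
move=> a0; elim: n => [//|n IH].
rewrite -IH -(limit_circle_shift _ (fun k => a0 (n + k)%N)).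
by under eq_fun do rewrite addSnnS; under [X in limit_circle _ X]eq_fun do rewrite addSnnS.
Qed.

End LimitCircle.

(** * The Jacobi operator on the tree *)

Section TreeOperator.
Variables (R : realType) (d : nat).
Local Notation C := R[i].
Local Notation vertex := (seq 'I_d).
Local Notation L2 := (@l2 R vertex).
Implicit Types (x y z : vertex).

Fixpoint level (k : nat) : seq vertex :=
  if k is k'.+1 then [seq rcons y i | y <- level k', i <- enum 'I_d] else [:: [::]].

Lemma mem_level k y : (y \in level k) = (size y == k).
Proof.
elim: k y => [|k IH] y; first by rewrite inE; case: y.
apply/allpairsP/eqP => [[[z i] /= [zk _ ->]]|].
  by rewrite size_rcons; move: zk; rewrite IH => /eqP ->.
case/lastP: y => [//|y i]; rewrite size_rcons => -[yk].
by exists (y, i); split => //=; rewrite ?IH ?yk// mem_enum.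
Qed.

Lemma level_uniq k : uniq (level k).
Proof.
elim: k => [//|k IH]; apply: allpairs_uniq => //; first exact: enum_uniq.
by move=> [y i] [z j] _ _ /= /rcons_inj.
Qed.

Lemma big_level k (F : vertex -> C) :
  \sum_(y <- level k.+1) F y = \sum_(y <- level k) \sum_(i < d) F (rcons y i).
Proof. by rewrite big_allpairs_dep /=; apply: eq_bigr => y _; rewrite big_enum. Qed.

Implicit Types f : vertex -> C.

Lemma level_expand k f : (forall y, size y != k -> f y = 0) ->
  f = \sum_(y <- level k) f y *: delta R y.
Proof.
move=> f0; apply/funext => y.
have E (s : seq vertex) : (\sum_(z <- s) f z *: delta R z) y = \sum_(z <- s) f z * delta R z y.
  by elim: s => [|z s IH]; rewrite ?big_nil// !big_cons -IH.
rewrite E; have [yk|yk] := eqVneq (size y) k; last first.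
  rewrite f0// big1_seq// => z /=; rewrite mem_level => /eqP zk.
  by rewrite delta_neq ?mulr0//; apply: contraNneq yk => ->; rewrite zk.
rewrite (bigD1_seq y) ?level_uniq ?mem_level ?yk//= deltaxx mulr1 big1 ?addr0//.
by move=> z zy; rewrite delta_neq ?mulr0// eq_sym.
Qed.

Lemma level_supp_l2 k f : (forall y, size y != k -> f y = 0) -> l2 f.
Proof.
move=> /level_expand ->; apply: l2_sum => y _; exact/l2Z/delta_l2.
Qed.

Lemma level_supp_inner k f (g : vertex -> C) : (forall y, size y != k -> g y = 0) -> l2 f ->
  inner f g = \sum_(y <- level k) f y * (g y)^*.
Proof.
move=> g0 lf; rewrite {1}(level_expand g0) inner_sumr//; last by move=> y _; apply/l2Z/delta_l2.
apply: eq_bigr => y _; rewrite innerZr//; last exact: delta_l2.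
by rewrite inner_delta mulrC.
Qed.

Section Action.
Variables (lam bet : nat -> R).

Definition tree_action f x : C :=
  (if x is i :: s then (lam (size s))%:C%C * f (belast i s) else 0)
  + (bet (size x))%:C%C * f x
  + (lam (size x))%:C%C * \sum_(i < d) f (rcons x i).

Lemma tree_action_nil f : tree_action f [::] =
  (bet 0)%:C%C * f [::] + (lam 0)%:C%C * \sum_(i < d) f [:: i].
Proof. by rewrite /tree_action add0r. Qed.

(** [J_column] reads the predecessor off a decomposition at the head of the word, whereas inductions
    on the tree remove the last letter; this reconciles the two. *)
Lemma belast_rcons (T : Type) (j : T) t s (i : T) : rcons s i = j :: t ->
  belast j t = s /\ size t = size s.
Proof.
move=> e; split; last by have := congr1 size e; rewrite size_rcons => -[].
by case: s e => [|k s] [<- <-] //; rewrite belast_rcons.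
Qed.

Lemma tree_action_rcons f s i : tree_action f (rcons s i) =
  (lam (size s))%:C%C * f s + (bet (size s).+1)%:C%C * f (rcons s i)
  + (lam (size s).+1)%:C%C * \sum_(j < d) f (rcons (rcons s i) j).
Proof.
rewrite /tree_action size_rcons; case e: (rcons s i) => [|j t].
  by case: s e.
by have [-> ->] := belast_rcons e.
Qed.

Lemma J_column_l2 x : l2 (J_column lam bet x).
Proof.
have ld y : l2 (delta R y : vertex -> C) by apply: delta_l2.
apply: l2D; last by apply/l2Z/l2_sum.
apply: l2D; last exact: l2Z.
by case: x => [|i s]; [exact: l20|exact: l2Z].
Qed.

Lemma inner_J_column f x : l2 f -> inner f (J_column lam bet x) = tree_action f x.
Proof.
move=> lf; have ld y : l2 (delta R y : vertex -> C) by apply: delta_l2.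
have lZ (c : C) y : l2 (c *: delta R y : vertex -> C) by apply: l2Z.
have lS : l2 (\sum_(i < d) delta R (rcons x i) : vertex -> C) by apply: l2_sum.
have l1 : l2 (if x is i :: s then (lam (size s))%:C%C *: delta R (belast i s) else 0 : vertex -> C).
  by case: x {lS} => [|i s]; [exact: l20|exact: l2Z].
rewrite /J_column !innerDr//; [|exact: l2D|exact: l2Z].
rewrite !innerZr// inner_delta !conjc_realE inner_sumr//.
rewrite /tree_action; congr (_ + _ + _ * _).
- case: x {lS l1} => [|i s]; first by rewrite inner0r.
  by rewrite innerZr// inner_delta conjc_realE.
- by apply: eq_bigr => i _; rewrite inner_delta.
Qed.

Lemma J_column_sym x y : J_column lam bet x y = (J_column lam bet y x)^*.
Proof.
(* [P x y] says that [y] is the predecessor of [x]. Written with it, the matrix entry in [E] below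
   is visibly symmetric. *)
pose P x y := if x is i :: s then y == belast i s else false.
have PE z t : \sum_(i < d) (z == rcons t i)%:R = (P z t)%:R :> C.
  case/lastP: z => [|z j].
    by rewrite big1// => i _; case: t.
  have -> : P (rcons z j) t = (t == z).
    rewrite /P; case e: (rcons z j) => [|k r]; first by case: (z) e.
    by have [-> _] := belast_rcons e.
  rewrite (bigD1 j)//= big1 ?addr0; last first.
    by move=> i ij; rewrite eqseq_rcons [j == i]eq_sym (negbTE ij) andbF.
  by rewrite eqseq_rcons eqxx andbT eq_sym.
have E x' y' : J_column lam bet x' y' = ((lam (size y') * (P x' y')%:R) +
    bet (size x') * (x' == y')%:R + lam (size x') * (P y' x')%:R)%:C%C.
  have -> : J_column lam bet x' y' =
    (if x' is i :: s then (lam (size s))%:C%C * (y' == belast i s)%:R else 0)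
    + (bet (size x'))%:C%C * (y' == x')%:R
    + (lam (size x'))%:C%C * \sum_(i < d) (y' == rcons x' i)%:R.
    rewrite /J_column -[LHS]/((if x' is i :: s then (lam (size s))%:C%C *: delta R (belast i s) else 0 : vertex -> C) y' +
       (bet (size x'))%:C%C * delta R x' y' +
       (lam (size x'))%:C%C * (\sum_(i < d) delta R (rcons x' i) : vertex -> C) y').
    congr (_ + _ + _ * _); first by case: x'.
    elim/big_ind2: _ => // u1 v1 u2 v2 <- <-; by [].
  rewrite PE !rmorphD !rmorphM /= !rmorph_nat [y' == x']eq_sym; congr (_ + _ + _).
  case: x' => [|i s]; first by rewrite /= mulr0.
  rewrite /P; case: eqP => [->|]; last by rewrite !mulr0.
  by rewrite size_belast.
rewrite !E conjc_realE; congr (_%:C%C); rewrite [y == x]eq_sym.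
by have [->|_] := eqVneq x y; rewrite ?mulr0; ring.
Qed.

Lemma tree_action_lin c f (g : vertex -> C) x :
  tree_action (c *: f + g) x = c * tree_action f x + tree_action g x.
Proof.
rewrite /tree_action.
have -> : \sum_(i < d) (c *: f + g) (rcons x i) =
    c * (\sum_(i < d) f (rcons x i)) + \sum_(i < d) g (rcons x i).
  by rewrite mulr_sumr -big_split.
rewrite -[(c *: f + g) x]/(c * f x + g x); case: x => [|i s].
  by ring.
by rewrite -[(c *: f + g) (belast i s)]/(c * f (belast i s) + g (belast i s)); ring.
Qed.

End Action.

(** * Families of level vectors on which J acts as a Jacobi matrix *)

Section LevelSystems.
Implicit Types (g h : nat -> C) (u v : nat -> vertex -> C).
Variables (lam bet : nat -> R).
Hypothesis d0 : (0 < d)%N.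
Local Notation sd := (Num.sqrt d%:R : R).

Let sd0 : 0 < sd. Proof. by rewrite sqrtr_gt0 ltr0n. Qed.
Let sdC : sd%:C%C != 0 :> C.
Proof. by rewrite (inj_eq (@complexI R) _ 0) gt_eqF. Qed.
Let sd2 : sd%:C%C * sd%:C%C = d%:R :> C.
Proof. by rewrite -rmorphM -expr2 sqr_sqrtr ?ler0n// rmorph_nat. Qed.

(* The common shape of u_radial (n = 0) and u_vec x a (n = |x|+1); the last clause
   cancels the term lambda_(n-1) that J produces on the level above. *)
Definition level_system (n : nat) (u : nat -> vertex -> C) :=
  [/\ forall m y, size y != (n + m)%N -> u m y = 0,
      forall m y i, size y = (n + m)%N -> u m.+1 (rcons y i) = (sd%:C%C)^-1 * u m y
    & forall y, (size y).+1 = n -> \sum_(i < d) u 0%N (rcons y i) = 0].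

Section OneSystem.
Variables (n : nat) (u : nat -> vertex -> C).
Hypothesis uP : level_system n u.

Lemma embed_level g m y : size y = (n + m)%N -> embed u g y = g m * u m y.
Proof.
have [u0 _ _] := uP; move=> ym; rewrite /embed.
have mk : (m < (size y).+1)%N by rewrite ym ltnS leq_addl.
rewrite (bigD1 (Ordinal mk))//= big1 ?addr0// => k /eqP km.
rewrite u0 ?mulr0//; apply/eqP => yk; apply/km/val_inj/(@addnI n).
exact: etrans (esym yk) ym.
Qed.

Lemma embed_below g y : (size y < n)%N -> embed u g y = 0.
Proof.
have [u0 _ _] := uP; move=> yn; rewrite /embed big1// => k _.
by rewrite u0 ?mulr0// neq_ltn (leq_trans yn)// leq_addr.
Qed.

Lemma embed_lin c g h : embed u (c *: g + h) = c *: embed u g + embed u h.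
Proof.
apply/funext => y.
rewrite -[RHS]/(c * embed u g y + embed u h y) /embed mulr_sumr -big_split /=.
apply: eq_bigr => m _.
by rewrite -[(c *: g + h) m]/(c * g m + h m) mulrDl mulrA.
Qed.

Lemma embedD g h : embed u (g + h) = embed u g + embed u h.
Proof. by have := embed_lin 1 g h; rewrite !scale1r. Qed.

Lemma embed0 : embed u 0 = 0.
Proof. by have := embed_lin (-1) 0 0; rewrite scaler0 addr0 scaleN1r addNr. Qed.

Lemma embedZ c g : embed u (c *: g) = c *: embed u g.
Proof. by have := embed_lin c g 0; rewrite embed0 !addr0. Qed.

Lemma embedB g h : embed u (g - h) = embed u g - embed u h.
Proof. by rewrite embedD -scaleN1r embedZ scaleN1r. Qed.

Lemma embed_sum (I : Type) (s : seq I) (F : I -> nat -> C) :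
  embed u (\sum_(i <- s) F i) = \sum_(i <- s) embed u (F i).
Proof.
by elim: s => [|i s IH]; rewrite ?big_nil ?embed0// !big_cons embedD IH.
Qed.

Lemma embed_delta m : embed u (delta R m) = u m.
Proof.
have [u0 _ _] := uP; apply/funext => y.
have [yn|ny] := ltnP (size y) n.
  by rewrite embed_below// u0// neq_ltn (leq_trans yn)// leq_addr.
rewrite (@embed_level _ (size y - n)) ?subnKC//.
have [->|mN] := eqVneq m (size y - n)%N; first by rewrite deltaxx mul1r.
rewrite delta_neq 1?eq_sym// mul0r u0//; apply: contraNneq mN => ->.
by rewrite addKn.
Qed.

Lemma system_l2 m : l2 (u m).
Proof. by have [u0 _ _] := uP; apply: level_supp_l2 (u0 m). Qed.

(** The origin of the weights [sqrt d * lam]: summing over [d] children, each carrying a factor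
    [1 / sqrt d], gives [sqrt d], and expressing the value at the parent through the child gives
    [sqrt d] again. On the level just above the support the children cancel by the third clause. *)
Lemma tree_action_embed g :
  tree_action lam bet (embed u g) =
  embed u (jac (fun k => bet (n + k)) (fun k => sd * lam (n + k)) g).
Proof.
have [u0 u1 u2] := uP; apply/funext => y.
have child m z : size z = (n + m)%N ->
    \sum_(i < d) embed u g (rcons z i) = sd%:C%C * g m.+1 * u m z.
  move=> zm; under eq_bigr => i _.
    rewrite (@embed_level _ m.+1) ?size_rcons ?zm ?addnS// (u1 _ _ _ zm).
    over.
  rewrite sumr_const card_ord -[LHS]mulr_natl -sd2; field; exact: sdC.
have [yn|ny] := ltnP (size y) n.
  rewrite embed_below//.
  have par i s : y = rcons s i -> embed u g s = 0.
    by move=> yE; apply: embed_below; apply: ltn_trans yn; rewrite yE size_rcons.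
  have ch : \sum_(i < d) embed u g (rcons y i) = 0.
    have [yn1|yn1] := eqVneq (size y).+1 n.
      under eq_bigr do rewrite (@embed_level _ 0) ?size_rcons ?addn0//.
      by rewrite -mulr_sumr u2// mulr0.
    rewrite big1// => i _; apply: embed_below; rewrite size_rcons.
    by rewrite ltn_neqAle yn1.
  case/lastP: y yn par ch => [|s i] yn par ch.
    by rewrite tree_action_nil ch embed_below// !mulr0 addr0.
  by rewrite tree_action_rcons ch (par i s erefl) embed_below// !mulr0 !addr0.
pose k := (size y - n)%N; have yk : size y = (n + k)%N by rewrite subnKC.
rewrite (embed_level _ yk) /jac.
case/lastP: y ny k yk => [|s i] ny k yk.
  have [n0 k0] : n = 0%N /\ k = 0%N by move: yk; case: (n) (k) => [|?] [|?].
  rewrite tree_action_nil (embed_level _ yk) (child k [::] yk) k0 n0 addn0 add0r.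
  by rewrite rmorphM; ring.
rewrite tree_action_rcons (embed_level _ yk) (child k _ yk).
move: yk; rewrite size_rcons => yk.
case: k yk => [|k] yk.
  rewrite embed_below ?addn0; last by rewrite -ltnS yk addn0.
  by rewrite yk addn0 rmorphM; ring.
have sk : size s = (n + k)%N by move: yk; rewrite addnS => -[].
rewrite (embed_level _ sk) (u1 _ _ i sk) sk -addnS !rmorphM /=.
by have := sdC; move: (sd%:C%C) => q qN; field.
Qed.

End OneSystem.

(** From one level to the next, each product is replaced by [d] products with factor [1 / d]. *)
Lemma system_inner n u v m : level_system n u -> level_system n v ->
  inner (u m) (v m) = inner (u 0%N) (v 0%N).
Proof.
move=> uP vP; have [u0 u1 _] := uP; have [v0 v1 _] := vP.
rewrite !(level_supp_inner (v0 _)); try exact: system_l2 uP _.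
elim: m => [//|m <-]; rewrite addnS big_level big_seq [RHS]big_seq.
apply: eq_bigr => y; rewrite mem_level => /eqP ym.
under eq_bigr do rewrite (u1 _ _ _ ym) (v1 _ _ _ ym).
have sc : ((sd%:C%C)^-1)^* = (sd%:C%C)^-1 :> C.
  by rewrite fmorphV; congr (_^-1); exact: conjc_realE.
have cM (p q : C) : (p * q)^* = p^* * q^* by rewrite rmorphM.
rewrite sumr_const card_ord -[LHS]mulr_natl -sd2 cM sc.
by have := sdC; move: (sd%:C%C) => q qN; field.
Qed.

Lemma system_inner_embed n u v m h : level_system n u -> level_system n v ->
  l2 (embed v h) -> inner (u m) (embed v h) = (h m)^* * inner (u 0%N) (v 0%N).
Proof.
move=> uP vP lv; have [u0 _ _] := uP; have [v0 _ _] := vP.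
rewrite innerC//; last exact: system_l2 uP _.
rewrite (level_supp_inner (u0 m) lv) -(system_inner m uP vP).
rewrite (level_supp_inner (v0 m) (system_l2 uP m)) mulr_sumr rmorph_sum /=.
rewrite big_seq [RHS]big_seq; apply: eq_bigr => y; rewrite mem_level => /eqP ym.
rewrite (embed_level vP h ym) !rmorphM -[X in _ * X]/(Num.conj _) conjCK; ring.
Qed.

(** The isometry on partial sums. In this finite form it transfers square summability in both
    directions, before either side is known to converge. *)
Lemma embed_level_sums n u g N : level_system n u ->
  \sum_(k < n + N) \sum_(y <- level k) normc (embed u g y) ^+ 2 =
  (\sum_(k < N) normc (g k) ^+ 2) * l2norm (u 0%N) ^+ 2.
Proof.
move=> uP; have [u0 _ _] := uP; rewrite big_split_ord /= big1 ?add0r; last first.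
  move=> k _; rewrite big1_seq// => y /=; rewrite mem_level => /eqP yk.
  by rewrite (embed_below uP) ?yk ?ltn_ord// normc_zero expr0n.
rewrite mulr_suml; apply: eq_bigr => k _.
apply: (@complexI R); rewrite [RHS]rmorphM /= -inner_self; last exact: system_l2 uP _.
rewrite -(system_inner k uP uP) (level_supp_inner (u0 k) (system_l2 uP k)).
rewrite rmorph_sum mulr_sumr /= big_seq [RHS]big_seq; apply: eq_bigr => y.
rewrite mem_level => /eqP yk; rewrite (embed_level uP g yk) normc_mul exprMn.
by rewrite rmorphM mulc_conj.
Qed.

Lemma levels_uniq N : uniq (flatten [seq level k | k <- iota 0 N]).
Proof.
elim: N => [//|k IH]; rewrite -addn1 iotaD map_cat flatten_cat cat_uniq IH /= cats0 level_uniq andbT.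
apply/hasPn => y; rewrite mem_level => /eqP yk; apply/flattenP => -[s /mapP[j]].
by rewrite mem_iota => /andP[_ jk] ->; rewrite mem_level yk gtn_eqF.
Qed.

Lemma embed_l2_lower n u g (X : seq nat) : level_system n u -> l2 (embed u g) -> uniq X ->
  (\sum_(k <- X) normc (g k) ^+ 2) * l2norm (u 0%N) ^+ 2 <= l2norm (embed u g) ^+ 2.
Proof.
move=> uP le uX; pose N := (\max_(k <- X) k).+1.
apply: le_trans (_ : (\sum_(k < N) normc (g k) ^+ 2) * l2norm (u 0%N) ^+ 2 <= _).
  rewrite ler_wpM2r ?sqr_ge0//.
  rewrite -(big_mkord xpredT (fun k => normc (g k) ^+ 2)).
  rewrite (perm_big [seq k <- index_iota 0 N | k \in X]).
    by rewrite big_filter big_mkcond; apply: ler_sum => y _; case: ifP => _ //; rewrite sqr_ge0.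
  apply: uniq_perm; rewrite ?filter_uniq ?iota_uniq//.
  move=> k; rewrite mem_filter mem_index_iota leq0n; case: (boolP (k \in X)) => //= kX.
  by rewrite ltnS (big_rem k)//= leq_maxl.
rewrite -(embed_level_sums _ _ uP).
have -> : \sum_(k < n + N) \sum_(y <- level k) normc (embed u g y) ^+ 2 =
    \sum_(y <- flatten [seq level k | k <- iota 0 (n + N)]) normc (embed u g y) ^+ 2.
  by rewrite big_flatten big_map -(big_mkord xpredT (fun k => \sum_(y <- level k) _)) /index_iota subn0.
by apply: l2_sumub => //; apply: levels_uniq.
Qed.

Lemma embed_l2_bound n u g : level_system n u -> l2 g ->
  l2 (embed u g) /\ l2norm (embed u g) = l2norm (u 0%N) * l2norm g.
Proof.
move=> uP lg; have [u0 _ _] := uP.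
have ubg (N : nat) : \sum_(k < N) normc (g k) ^+ 2 <= l2norm g ^+ 2.
  rewrite -(big_mkord xpredT (fun k => normc (g k) ^+ 2)); apply: l2_sumub => //.
  exact: iota_uniq.
have [le lle] : l2 (embed u g) /\ l2norm (embed u g) ^+ 2 <= l2norm g ^+ 2 * l2norm (u 0%N) ^+ 2.
  apply: l2_sumlub => X uX.
  pose N := (\max_(y <- X) size y).+1.
  apply: le_trans (_ : \sum_(k < n + N) \sum_(y <- level k) normc (embed u g y) ^+ 2 <= _); last first.
    by rewrite (embed_level_sums _ _ uP) ler_wpM2r ?sqr_ge0.
  have -> : \sum_(y <- X) normc (embed u g y) ^+ 2 =
      \sum_(k < n + N) \sum_(y <- X | size y == k) normc (embed u g y) ^+ 2.
    rewrite (exchange_big_dep xpredT) //= big_seq [RHS]big_seq; apply: eq_bigr => y yX.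
    have yN : (size y < n + N)%N.
      rewrite (leq_trans _ (leq_addl _ _))// ltnS.
      by rewrite (big_rem y)//= leq_maxl.
    rewrite (bigD1 (Ordinal yN)) ?eqxx//= big1 ?addr0// => k /andP[/eqP e /eqP]; case.
    exact/val_inj.
  apply: ler_sum => k _; rewrite -big_filter.
  rewrite (perm_big [seq y <- level k | y \in X]) /=.
    rewrite big_filter big_mkcond; apply: ler_sum => y _.
    by case: ifP => _ //; rewrite sqr_ge0.
  apply: uniq_perm; rewrite ?filter_uniq ?level_uniq//.
  by move=> y; rewrite !mem_filter mem_level andbC.
split=> //; apply/eqP; rewrite -(@eqrXn2 _ 2) ?mulr_ge0 ?l2norm_ge0//.
rewrite exprMn mulrC eq_le lle/=.
have [q0|qN] := eqVneq (l2norm (u 0%N)) 0.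
  by rewrite q0 expr0n mulr0 exprn_ge0 ?l2norm_ge0.
have qp : 0 < l2norm (u 0%N) ^+ 2 by rewrite exprn_gt0// lt_def qN l2norm_ge0.
rewrite -ler_pdivlMr//; apply: (@l2_sumlub _ _ g _ _).2 => X uX.
by rewrite ler_pdivlMr//; apply: embed_l2_lower uP _ _.
Qed.

Lemma embed_l2_inv n u g : level_system n u -> u 0%N <> 0 -> l2 (embed u g) -> l2 g.
Proof.
move=> uP uN le; have qp : 0 < l2norm (u 0%N) ^+ 2.
  rewrite exprn_gt0// lt_def l2norm_ge0 andbT; apply/eqP => /(l2norm_eq0 (system_l2 uP 0)).
  exact: uN.
apply: (@l2_sumlub _ _ g (l2norm (embed u g) ^+ 2 / l2norm (u 0%N) ^+ 2) _).1 => X uX.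
by rewrite ler_pdivlMr//; apply: embed_l2_lower uP _ _.
Qed.

(** Bessel's inequality for an unnormalised family: pairing [f] with the finite combination [g] of
    its own coefficients gives [S = ||g||^2 <= ||f|| * ||u 0|| * ||g||]. *)
Lemma system_coef_l2 n u f : level_system n u -> l2 f ->
  l2 (fun m => inner f (u m)).
Proof.
move=> uP lf; set c := fun m => _; have lu m := system_l2 uP m.
apply: (@l2_sumlub _ _ c ((l2norm f * l2norm (u 0%N)) ^+ 2) _).1 => X uX.
pose g := \sum_(m <- X) c m *: delta R m.
have lg : l2 g by apply: l2_sum => m _; apply/l2Z/delta_l2.
pose S := \sum_(m <- X) normc (c m) ^+ 2.
have S0 : 0 <= S by apply: sumr_ge0 => m _; rewrite sqr_ge0.
have gn : l2norm g ^+ 2 = S.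
  have B1 (b : nat -> C) : range (@delta R nat) b -> inner b b = 1.
    by move=> [m _ <-]; rewrite inner_delta deltaxx.
  have B0 (b b' : nat -> C) : range (@delta R nat) b -> range (@delta R nat) b' -> b <> b' -> inner b b' = 0.
    move=> [m _ <-] [k _ <-] mk; rewrite inner_delta delta_neq//.
    by apply/eqP => km; apply: mk; rewrite km.
  apply: (@complexI R); rewrite -inner_self// {2}/g inner_sumr//; last first.
    by move=> m _; apply/l2Z/delta_l2.
  rewrite rmorph_sum /= big_seq [RHS]big_seq; apply: eq_bigr => m mX.
  rewrite innerZr//; last exact: delta_l2.
  rewrite inner_delta mulrC -mulc_conj; congr (_ * _).
  rewrite -[LHS]inner_delta /g inner_suml; last exact: delta_l2.
    rewrite (bigD1_seq m)//= inner_delta scale_fctE deltaxx mulr1 big1 ?addr0// => k km.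
    by rewrite inner_delta scale_fctE delta_neq ?mulr0// eq_sym.
  by move=> k _; apply/l2Z/delta_l2.
have [lug nug] := embed_l2_bound uP lg.
have E : inner f (embed u g) = S%:C%C.
  rewrite /g embed_sum inner_sumr//; last first.
    by move=> m _; rewrite embedZ (embed_delta uP); apply: l2Z.
  rewrite rmorph_sum /=; apply: eq_bigr => m _.
  by rewrite embedZ (embed_delta uP) innerZr// mulrC mulc_conj.
have := cauchy_schwarz lf lug; rewrite E normc_real ger0_norm// nug mulrA => h.
have [s0|sN] := eqVneq (l2norm g) 0.
  by rewrite -/S -gn s0 expr0n/= sqr_ge0.
have gp : 0 < l2norm g by rewrite lt_def sN l2norm_ge0.
rewrite -/S -gn ler_pXn2r ?nnegrE ?mulr_ge0 ?l2norm_ge0//.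
by rewrite -(ler_pM2r gp) -expr2 gn.
Qed.

Lemma embed_closure n u (S : set (nat -> C)) : level_system n u -> S `<=` @l2 R nat ->
  forall g, l2_closure (linear_span S) g ->
  l2_closure (linear_span (embed u @` S)) (embed u g).
Proof.
move=> uP Sl g [lg cg]; split; first by case: (embed_l2_bound uP lg).
move=> e e0; have p : 0 < l2norm (u 0%N) + 1 by rewrite ltr_wpDl// l2norm_ge0.
have [h Sh gh] := cg _ (divr_gt0 e0 p).
have lh := l2_span Sl Sh; exists (embed u h).
  case: Sh => N [c [s [Ss ->]]]; exists N, c, (fun i => embed u (s i)).
  split; first by move=> i; exists (s i).
  by rewrite embed_sum; apply: eq_bigr => i _; rewrite embedZ.
rewrite -embedB; have [_ ->] := embed_l2_bound uP (l2B lg lh).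
move: gh; rewrite ltr_pdivlMr// mulrDr mulr1 mulrC.
by have := l2norm_ge0 (g - h); lra.
Qed.

Lemma system_span n u g : level_system n u -> l2 g ->
  l2_closure (linear_span (range u)) (embed u g).
Proof.
move=> uP lg; have Dl : range (@delta R nat) `<=` @l2 R nat.
  by move=> _ [m _ <-]; apply: delta_l2.
have := embed_closure uP Dl (finsupp_dense lg).
apply: l2_closureS; apply: linear_spanS => _ [_ [m _ <-] <-].
by exists m => //; rewrite (embed_delta uP).
Qed.

(** For finitely supported [g] this is [system_inner_embed]; the norm identity of [embed_l2_bound]
    controls the remainder. *)
Lemma embed_inner n u v g h : level_system n u -> level_system n v ->
  l2 g -> l2 h -> inner (embed u g) (embed v h) = inner (u 0%N) (v 0%N) * inner g h.
Proof.
move=> uP vP lg lh; have [lu nu] := embed_l2_bound uP lg; have [lv nv] := embed_l2_bound vP lh.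
set q := inner (u 0%N) (v 0%N); apply: normc_eps_eq => e e0.
pose M := l2norm (u 0%N) * l2norm (embed v h) + normc q * l2norm h + 1.
have M0 : 0 <= l2norm (u 0%N) * l2norm (embed v h) + normc q * l2norm h.
  by rewrite addr_ge0// mulr_ge0 ?l2norm_ge0 ?normc_ge0.
have Mp : 0 < M by rewrite ltr_wpDl.
have [X uX gX] := finsupp_approx lg (divr_gt0 e0 Mp).
set gx := \sum_(m <- X) _ in gX.
have lgx : l2 gx by apply: l2_sum => m _; apply/l2Z/delta_l2.
have [lux nux] := embed_l2_bound uP (l2B lg lgx).
have E : inner (embed u gx) (embed v h) = q * inner gx h.
  rewrite /gx embed_sum inner_suml//; last first.
    by move=> m _; rewrite embedZ (embed_delta uP); apply/l2Z/system_l2/uP.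
  rewrite inner_suml//; last by move=> m _; apply/l2Z/delta_l2.
  rewrite mulr_sumr; apply: eq_bigr => m _.
  have lum := system_l2 uP m; rewrite embedZ (embed_delta uP) (innerZl _ lum lv).
  rewrite (system_inner_embed m uP vP lv) innerZl//; last exact: delta_l2.
  rewrite [inner (delta R m) h]innerC//; last exact: delta_l2.
  by rewrite inner_delta -/q; ring.
have -> : inner (embed u g) (embed v h) - q * inner g h =
    inner (embed u (g - gx)) (embed v h) - q * inner (g - gx) h.
  have [lux' _] := embed_l2_bound uP lgx.
  by rewrite embedB// innerBl// E innerBl//; ring.
apply: le_trans (normc_triangle _ _) _; rewrite normc_opp normc_mul.
have := cauchy_schwarz lux lv; rewrite nux.
have := cauchy_schwarz (l2B lg lgx) lh => /(ler_wpM2l (normc_ge0 q)) h1 h2.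
apply: le_trans (lerD h2 h1) _.
have -> : l2norm (u 0%N) * l2norm (g - gx) * l2norm (embed v h) +
    normc q * (l2norm (g - gx) * l2norm h) = l2norm (g - gx) * (M - 1).
  by rewrite /M; ring.
apply: le_trans (_ : l2norm (g - gx) * M <= _).
  by rewrite ler_wpM2l ?l2norm_ge0// gerBl.
by rewrite -ler_pdivlMr// ltW.
Qed.

End LevelSystems.

End TreeOperator.

(** * Finite orthogonal sums of copies of the sequence space *)

Section SystemFamilies.
Variables (R : realType) (d : nat).
Local Notation C := R[i].
Local Notation vertex := (seq 'I_d).
Local Notation L2 := (@l2 R vertex).
Hypothesis d0 : (0 < d)%N.
Variables (n : nat) (I : finType) (u : I -> nat -> vertex -> C).
Hypothesis uP : forall j, level_system n (u j).
Hypothesis u1 : forall j k, inner (u j 0%N) (u k 0%N) = (j == k)%:R.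
Implicit Types (f g h : vertex -> C) (phi : I -> nat -> C).

Definition family_sum phi := \sum_j embed (u j) (phi j).

Definition family_space : set (vertex -> C) :=
  [set f | exists phi, (forall j, l2 (phi j)) /\ f = family_sum phi].

Lemma family_term_l2 j (g : nat -> C) : l2 g -> l2 (embed (u j) g).
Proof. by move=> lg; case: (embed_l2_bound d0 (uP j) lg). Qed.

Lemma family_sum_l2 phi : (forall j, l2 (phi j)) -> l2 (family_sum phi).
Proof. by move=> lphi; apply: l2_sum => j _; apply: family_term_l2. Qed.

Lemma family_space_sub : family_space `<=` L2.
Proof. by move=> _ [phi [lphi ->]]; apply: family_sum_l2. Qed.

Lemma family_sum_lin (c : C) phi psi :
  family_sum (fun j => c *: phi j + psi j) = c *: family_sum phi + family_sum psi.
Proof.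
rewrite /family_sum scaler_sumr -big_split; apply: eq_bigr => j _ /=.
exact: embed_lin.
Qed.

Lemma family_space_subspace : linear_span family_space `<=` family_space.
Proof.
apply: subspaceP.
  exists (fun=> 0); split; first by move=> _; apply: l20.
  by rewrite /family_sum big1// => j _; rewrite embed0.
move=> c _ _ [phi [lphi ->]] [psi [lpsi ->]].
exists (fun j => c *: phi j + psi j); split; last by rewrite family_sum_lin.
by move=> j; apply: l2D => //; apply: l2Z.
Qed.

Lemma family_space_term j (g : nat -> C) : l2 g -> family_space (embed (u j) g).
Proof.
move=> lg; exists (fun k => if k == j then g else 0); split.
  by move=> k; case: ifP => // _; apply: l20.
rewrite /family_sum (bigD1 j)//= eqxx big1 ?addr0// => k /negbTE ->.
by rewrite embed0.
Qed.

Lemma family_inner_term phi k (g : nat -> C) : (forall j, l2 (phi j)) -> l2 g ->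
  inner (family_sum phi) (embed (u k) g) = inner (phi k) g.
Proof.
move=> lphi lg; rewrite inner_suml; last exact: family_term_l2.
  rewrite (bigD1 k)//= (embed_inner d0 (uP k) (uP k))// u1 eqxx mul1r.
  rewrite big1 ?addr0// => j jk.
  by rewrite (embed_inner d0 (uP j) (uP k))// u1 (negbTE jk) mul0r.
by move=> j _; apply: family_term_l2.
Qed.

(** Coefficients along the [u j m] define the candidate for the projection. The difference from [f]
    lies in the closure and is orthogonal to the space, hence to itself. *)
Lemma family_space_closed : l2_closure family_space `<=` family_space.
Proof.
move=> f cf; have [lf _] := cf.
pose phi j m := inner f (u j m).
have lphi j : l2 (phi j) by apply: (system_coef_l2 d0 (uP j)).
exists phi; split=> //.
have Sphi : family_space (family_sum phi) by exists phi.
have lS := family_space_sub Sphi; have lr := l2B lf lS.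
have cr : l2_closure family_space (f - family_sum phi).
  apply: subspaceB => //; first exact: l2_closure_subspace family_space_sub family_space_subspace.
  exact: sub_l2_closure family_space_sub _ _.
apply/eqP; rewrite -subr_eq0; apply/eqP; apply: inner_self_eq0 => //.
apply: (l2_closure_inner0 family_space_sub lr _ cr) => _ [psi [lpsi ->]].
rewrite inner_suml//; last by move=> j _; apply: family_term_l2.
rewrite big1// => j _.
have rl : range (u j) `<=` L2 by move=> _ [m _ <-]; apply: system_l2 (uP j) _.
apply: (l2_closure_inner0 (l2_span rl) lr _ (system_span d0 (uP j) (lpsi j))).
apply: span_inner0 => // _ [m _ <-].
rewrite innerC//; last exact: system_l2 (uP j) _.
rewrite innerBl//; last exact: system_l2 (uP j) _.
rewrite -{2}(embed_delta (uP j) m) family_inner_term//; last exact: delta_l2.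
by rewrite inner_delta subrr rmorph0.
Qed.

Variables (A : graph R nat) (B0 : set (nat -> C)) (mu0 : (nat -> C) -> R).
Hypotheses (saA : selfadjoint (@l2 R nat) A).
Hypothesis BA : forall b, B0 b -> A (b, (mu0 b)%:C%C *: b).
Hypothesis B1 : forall b, B0 b -> inner b b = 1.
Hypothesis BO : forall b c, B0 b -> B0 c -> b <> c -> inner b c = 0.
Hypothesis BT : @l2 R nat `<=` l2_closure (linear_span B0).

Definition family_operator : graph R vertex :=
  [set p | exists P : I -> (nat -> C) * (nat -> C), (forall j, A (P j)) /\
     p = (family_sum (fun j => (P j).1), family_sum (fun j => (P j).2))].

Definition family_basis : set (vertex -> C) :=
  [set f | exists j b, B0 b /\ f = embed (u j) b].

Variable mu : (vertex -> C) -> R.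
Hypothesis muE : forall j b, B0 b -> mu (embed (u j) b) = mu0 b.

Let Bl b : B0 b -> l2 b. Proof. by move=> /BA /(selfadjoint_sub saA)[]. Qed.

Lemma family_basis_sub : family_basis `<=` family_space.
Proof. by move=> _ [j [b [Bb ->]]]; apply/family_space_term/Bl. Qed.

Lemma family_basis_normal f : family_basis f -> inner f f = 1.
Proof.
move=> [j [b [Bb ->]]]; rewrite (embed_inner d0 (uP j) (uP j)); try exact: Bl.
by rewrite u1 eqxx B1// mul1r.
Qed.

Lemma family_basis_orthogonal f g : family_basis f -> family_basis g -> f <> g ->
  inner f g = 0.
Proof.
move=> [j [b [Bb ->]]] [k [c [Bc ->]]] fg.
rewrite (embed_inner d0 (uP j) (uP k)); try exact: Bl.
rewrite u1; have [jk|] := eqVneq j k; last by rewrite mul0r.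
by rewrite mul1r BO// => bc; apply: fg; rewrite jk bc.
Qed.

Lemma family_basis_total : family_space `<=` l2_closure (linear_span family_basis).
Proof.
have Fl : family_basis `<=` L2 := subset_trans family_basis_sub family_space_sub.
have cS := l2_closure_subspace (l2_span Fl) (@linear_span_subspace _ _ family_basis).
move=> _ [phi [lphi ->]]; apply: subspace_sum => // j _.
have := embed_closure d0 (uP j) Bl (BT (lphi j)).
apply: l2_closureS; apply: linear_spanS => _ [b Bb <-].
by exists j, b.
Qed.

(** [A] is itself the diagonal operator of [B0], so membership of every component in [A] amounts to
    coefficient identities, the same ones that describe the diagonal operator of [family_basis]. *)
Lemma family_operatorE : family_operator = diagonal_operator family_space family_basis mu.
Proof.
have AE := selfadjoint_diagonal (fun _ => id) Bl B1 BO BT saA erefl BA.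
have Al := selfadjoint_sub saA.
apply/seteqP; split=> [_ [P [AP ->]]|[f g] [/= [phi [lphi ->]] [psi [lpsi ->]] fg]].
  have l1 j : l2 (P j).1 by case: (Al _ (AP j)).
  have l2' j : l2 (P j).2 by case: (Al _ (AP j)).
  split=> /=; [by exists (fun j => (P j).1)|by exists (fun j => (P j).2)|].
  move=> _ [k [b [Bb ->]]]; have lb := Bl Bb.
  rewrite !family_inner_term// muE//.
  by have := AP k; rewrite AE => -[_ _]; apply.
exists (fun j => (phi j, psi j)); split=> //= j.
rewrite AE; split=> //= b Bb; have lb := Bl Bb.
by have := fg (embed (u j) b) (ex_intro _ j (ex_intro _ b (conj Bb erefl)));
  rewrite !family_inner_term// muE.
Qed.

Lemma family_operator_selfadjoint : selfadjoint family_space family_operator.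
Proof.
rewrite family_operatorE; apply: diagonal_selfadjoint.
- exact: family_space_sub.
- exact: family_space_subspace.
- exact: family_basis_sub.
- exact: family_basis_normal.
- exact: family_basis_orthogonal.
- exact: family_basis_total.
Qed.

Lemma family_basis_eigenvector f : family_basis f -> family_operator (f, (mu f)%:C%C *: f).
Proof.
rewrite family_operatorE; apply: diagonal_eigenvector.
- exact: family_space_sub.
- exact: family_space_subspace.
- exact: family_basis_sub.
- exact: family_basis_orthogonal.
Qed.

Lemma orthonormal_eigenvector (S : graph R vertex) f : inner f f = 1 ->
  S (f, (mu f)%:C%C *: f) -> eigenvector S f.
Proof.
move=> f1 Sf; split; last by exists (mu f)%:C%C.
by move=> f0; move: f1; rewrite f0 inner0l => /esym/eqP; rewrite oner_eq0.
Qed.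

Lemma family_pure_point : pure_point_spectrum family_space family_operator.
Proof.
exists family_basis; split.
- move=> f Bf; split; first exact: family_basis_sub.
  apply: orthonormal_eigenvector; first exact: family_basis_normal.
  exact: family_basis_eigenvector.
- exact: family_basis_normal.
- exact: family_basis_orthogonal.
- exact: family_basis_total.
Qed.

Lemma family_spectrum : spectrum family_space family_operator =
  closure [set ((mu f)%:C%C : R[i]^o) | f in family_basis].
Proof.
rewrite family_operatorE; apply: diagonal_spectrum.
- exact: family_space_sub.
- exact: family_space_subspace.
- exact: family_space_closed.
- exact: family_basis_sub.
- exact: family_basis_normal.
- exact: family_basis_orthogonal.
- exact: family_basis_total.
Qed.

End SystemFamilies.

(** * The decomposition of the tree *)

Section SumZeroVectors.
Variable R : realType.
Local Notation C := R[i].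

(* Rows of the Householder reflection exchanging the first basis vector with
   the constant unit vector. *)
Lemma sum_zero_basis p : (0 < p)%N -> exists alpha : 'I_p -> 'I_p.+1 -> C,
  [/\ forall j, \sum_i alpha j i = 0,
      forall j k, \sum_i alpha j i * (alpha k i)^* = (j == k)%:R
    & forall a : 'I_p.+1 -> C, \sum_i a i = 0 ->
        exists c : 'I_p -> C, forall i, a i = \sum_j c j * alpha j i].
Proof.
(* The common entry of the constant unit vector of length [p + 1]; [p > 0] makes it smaller than
   1. *)
move=> p0; pose s : R := (Num.sqrt p.+1%:R)^-1.
have s0 : 0 < s by rewrite invr_gt0 sqrtr_gt0 ltr0n.
have s2 : p.+1%:R * s ^+ 2 = 1.
  by rewrite exprVn sqr_sqrtr ?ler0n// mulfV// pnatr_eq0.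
have s1 : s < 1.
  rewrite -(@ltr_pXn2r _ 2) ?nnegrE ?ltW// expr1n -s2 ltr_pMl ?exprn_gt0//.
  by rewrite ltr1n.
have sN : 1 - s != 0 by rewrite subr_eq0 eq_sym lt_eqF.
pose v (i : 'I_p.+1) : R := (i == ord0)%:R - s.
(* The Householder factor [2 / |v|^2], by the value of [|v|^2] computed in [vv]. *)
pose c := (1 - s)^-1.
pose Q i j : R := (i == j)%:R - c * v i * v j.
have Qs i j : Q i j = Q j i by rewrite /Q eq_sym; ring.
have pick (F : 'I_p.+1 -> R) i : \sum_k (i == k)%:R * F k = F i.
  rewrite (bigD1 i)//= eqxx mul1r big1 ?addr0// => k ki.
  by rewrite eq_sym (negbTE ki) mul0r.
have vv : \sum_k v k ^+ 2 = 2 * (1 - s).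
  have -> : \sum_k v k ^+ 2 = \sum_k (((ord0 : 'I_p.+1) == k)%:R * (1 - 2 * s) + s ^+ 2).
    apply: eq_bigr => k _; rewrite /v eq_sym.
    by case: eqP => _ /=; ring.
  rewrite big_split /= pick sumr_const card_ord -[s ^+ 2 *+ _]mulr_natl s2; ring.
have QQ i j : \sum_k Q i k * Q k j = (i == j)%:R.
  have -> : \sum_k Q i k * Q k j = \sum_k ((i == k)%:R * Q k j) -
      c * v i * \sum_k ((j == k)%:R * v k) + c ^+ 2 * v i * v j * \sum_k v k ^+ 2.
    rewrite !mulr_sumr -sumrB -big_split /=; apply: eq_bigr => k _.
    by rewrite /Q [j == k]eq_sym; ring.
  rewrite !pick vv /Q /c; field; exact: sN.
have Q0 j : Q ord0 j = s.
  rewrite /Q [ord0 == j]eq_sym /v eqxx /c; case: eqP => _ /=; field; exact: sN.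
have Qsum j : j != ord0 -> \sum_i Q j i = 0.
  move=> jN; apply: (mulIf (lt0r_neq0 s0)); rewrite mul0r mulr_suml.
  rewrite (_ : \sum_i Q j i * s = \sum_k Q j k * Q k ord0); first by rewrite QQ (negbTE jN).
  by apply: eq_bigr => i _; rewrite [Q i ord0]Qs Q0.
exists (fun j i => (Q (lift ord0 j) i)%:C%C); split.
- by move=> j; rewrite -rmorph_sum /= Qsum// -lift0 eq_sym neq_lift.
- move=> j k.
  have -> : \sum_i (Q (lift ord0 j) i)%:C%C * ((Q (lift ord0 k) i)%:C%C)^* =
      (\sum_i Q (lift ord0 j) i * Q i (lift ord0 k))%:C%C :> C.
    rewrite rmorph_sum /=; apply: eq_bigr => i _.
    by rewrite conjc_realE -rmorphM (Qs i (lift ord0 k)).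
  by rewrite QQ (inj_eq lift_inj) rmorph_nat.
move=> a a0; exists (fun j => \sum_k a k * (Q k (lift ord0 j))%:C%C) => i.
(* The coordinates of [a] along the rows of [Q]. Row 0 is constant, so the coordinate at 0 vanishes
   with the sum of [a] and the remaining [p] rows suffice. *)
pose b l := \sum_k a k * (Q k l)%:C%C.
have b0 : b ord0 = 0.
  rewrite /b; under eq_bigr do rewrite Qs Q0.
  by rewrite -mulr_suml a0 mul0r.
have -> : \sum_j (\sum_k a k * (Q k (lift ord0 j))%:C%C) * (Q (lift ord0 j) i)%:C%C =
    \sum_l b l * (Q l i)%:C%C.
  by rewrite [RHS]big_ord_recl b0 mul0r add0r.
have -> : \sum_l b l * (Q l i)%:C%C = \sum_k a k * (\sum_l Q k l * Q l i)%:C%C.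
  under eq_bigr do rewrite mulr_suml.
  rewrite exchange_big /=; apply: eq_bigr => k _.
  rewrite rmorph_sum mulr_sumr /=; apply: eq_bigr => l _.
  by rewrite rmorphM mulrA.
under eq_bigr do rewrite QQ.
rewrite (bigD1 i)//= eqxx rmorph1 mulr1 big1 ?addr0// => k ki.
by rewrite (negbTE ki) rmorph0 mulr0.
Qed.

End SumZeroVectors.

(** * The radial and sum-zero vectors, their orthogonality and their span *)

Section ConcreteSystems.
Variables (R : realType) (d : nat).
Local Notation C := R[i].
Local Notation vertex := (seq 'I_d).
Local Notation L2 := (@l2 R vertex).
Hypothesis d0 : (0 < d)%N.
Local Notation sd := (Num.sqrt d%:R : R).
Implicit Types (x y z : vertex) (f g : vertex -> C) (a : 'I_d -> C).

Let sd0 : 0 < sd. Proof. by rewrite sqrtr_gt0 ltr0n. Qed.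
Let sdC : sd%:C%C != 0 :> C.
Proof. by rewrite (inj_eq (@complexI R) _ 0) gt_eqF. Qed.

Let pwS m : (sd ^- m.+1)%:C%C = (sd%:C%C)^-1 * (sd ^- m)%:C%C :> C.
Proof. by rewrite exprS invfM rmorphM fmorphV. Qed.

Let pwN m : (sd ^- m)%:C%C != 0 :> C.
Proof. by rewrite (inj_eq (@complexI R) _ 0) invr_eq0 expf_neq0// gt_eqF. Qed.

Lemma prefix_rcons_size x y i : (size x <= size y)%N -> prefix x (rcons y i) = prefix x y.
Proof. by move=> xy; rewrite !prefixE -cats1 takel_cat. Qed.

Lemma prefix_rcons_eq x y i j : size x = size y ->
  prefix (rcons x i) (rcons y j) = (x == y) && (i == j).
Proof.
move=> xy; rewrite prefixE size_rcons xy -(size_rcons y j) take_size eqseq_rcons.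
by rewrite [y == x]eq_sym [j == i]eq_sym.
Qed.

Lemma prefix_child x i j t : prefix (rcons x j) (rcons x i ++ t) = (j == i).
Proof.
by rewrite prefixE takel_cat ?size_rcons// -(size_rcons x i) take_size eqseq_rcons eqxx eq_sym.
Qed.

Lemma prefix_childP x y : prefix x y -> y <> x -> exists i t, y = rcons x i ++ t.
Proof.
move=> /prefixP[[|i t] ->]; first by rewrite cats0.
by move=> _; exists i, t; rewrite cat_rcons.
Qed.

Lemma radial_system : level_system 0 (@u_radial R d).
Proof.
split=> [m y ym|m y i ym|y//]; rewrite /u_radial.
- by rewrite add0n in ym; rewrite (negbTE ym) mulr0.
- by rewrite size_rcons ym add0n !eqxx !mulr1 pwS.
Qed.

Lemma vec_system x a : \sum_i a i = 0 -> level_system (size x).+1 (u_vec x a).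
Proof.
move=> a0; split=> [m y ym|m y i ym|y [yx]]; rewrite /u_vec.
- by rewrite big1 ?mulr0// => i _; rewrite (negbTE ym) andbF mulr0.
- rewrite size_rcons ym !addnS !addSn !eqxx pwS -mulrA; congr (_ * (_ * _)).
  apply: eq_bigr => j _; rewrite prefix_rcons_size// size_rcons ym.
  by rewrite addSn ltnS leq_addr.
under eq_bigr => i _.
  under eq_bigr => j _ do rewrite prefix_rcons_eq ?yx// size_rcons yx addn0 eqxx andbT.
  over.
rewrite -mulr_sumr exchange_big /=.
have [_|xy] := eqVneq x y; last first.
  by rewrite big1 ?mulr0// => j _; rewrite big1// => i _; rewrite mulr0.
apply: etrans (congr1 (fun w => _ * w) _) (mulr0 (sd ^- 0)%:C%C).
apply: etrans a0; apply: eq_bigr => j _.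
rewrite (bigD1 j)//= eqxx mulr1 big1 ?addr0// => i ij.
by rewrite eq_sym (negbTE ij) mulr0.
Qed.

Lemma u_vec_child x a m i t : size t = m ->
  u_vec x a m (rcons x i ++ t) = (sd ^- m)%:C%C * a i.
Proof.
move=> tm; rewrite /u_vec; congr (_ * _).
rewrite (bigD1 i)//= prefix_child eqxx size_cat size_rcons tm eqxx mulr1.
by rewrite big1 ?addr0// => j ji; rewrite prefix_child (negbTE ji) mulr0.
Qed.

Lemma u_vec_supp x a m y : ~~ prefix x y -> u_vec x a m y = 0.
Proof.
move=> xy; rewrite /u_vec big1 ?mulr0// => i _.
rewrite (_ : prefix (rcons x i) y = false) ?mulr0//; apply: contraNF xy.
by apply: prefix_trans; apply: prefix_rcons.
Qed.

Lemma vec_inner0 x a b : \sum_i a i = 0 -> \sum_i b i = 0 ->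
  inner (u_vec x a 0%N) (u_vec x b 0%N) = \sum_i a i * (b i)^*.
Proof.
move=> a0 b0; have aP := vec_system x a0; have [bs _ _] := vec_system x b0.
have bs0 y : size y != (size x).+1 -> u_vec x b 0%N y = 0.
  by move=> h; apply: bs; rewrite addn0.
rewrite (level_supp_inner bs0); last exact: system_l2 aP _.
rewrite big_level (bigD1_seq x) ?level_uniq ?mem_level//= [X in _ + X]big1_seq ?addr0.
  apply: eq_bigr => i _.
  by have := u_vec_child x a i (erefl (size [::])); have := u_vec_child x b i (erefl (size [::]));
    rewrite !cats0 !expr0 invr1 !mul1r => -> ->.
move=> y /andP[yx]; rewrite mem_level => /eqP ys; rewrite big1// => i _.
rewrite u_vec_supp ?mul0r// prefix_rcons_size ?ys//.
by rewrite prefixE -ys take_size.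
Qed.

Lemma radial_inner0 : inner (@u_radial R d 0%N) (@u_radial R d 0%N) = 1.
Proof.
have [rs _ _] := radial_system.
have rs0 y : size y != 0%N -> u_radial R 0 y = 0 by move=> h; apply: rs.
rewrite (level_supp_inner rs0); last exact: system_l2 radial_system _.
rewrite big_seq1; have -> : u_radial R 0 ([::] : vertex) = 1 by rewrite /u_radial /= invr1 mulr1.
by rewrite rmorph1 mulr1.
Qed.

Lemma u_vec_sum (I : finType) x (alpha : I -> 'I_d -> C) (c : I -> C) a m :
  (forall i, a i = \sum_j c j * alpha j i) ->
  u_vec x a m = \sum_j c j *: u_vec x (alpha j) m.
Proof.
move=> aE; apply/funext => y.
have -> : (\sum_j c j *: u_vec x (alpha j) m) y = \sum_j c j * u_vec x (alpha j) m y.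
  by elim/big_ind2: _ => // u1 v1 u2 v2 <- <-.
rewrite /u_vec; under [RHS]eq_bigr do rewrite mulrCA mulr_sumr.
rewrite -mulr_sumr exchange_big /=; congr (_ * _); apply: eq_bigr => i _.
by rewrite aE mulr_suml; apply: eq_bigr => j _; rewrite mulrA.
Qed.

Lemma embed_vec_sum (I : finType) x (alpha : I -> 'I_d -> C) (c : I -> C) a (g : nat -> C) :
  (forall i, a i = \sum_j c j * alpha j i) ->
  embed (u_vec x a) g = \sum_j embed (u_vec x (alpha j)) (c j *: g).
Proof.
move=> aE; apply/funext => y.
have S (F : I -> vertex -> C) : (\sum_j F j) y = \sum_j F j y.
  by elim/big_ind2: _ => // u1 v1 u2 v2 <- <-.
rewrite S /embed exchange_big /=; apply: eq_bigr => m _.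
rewrite (u_vec_sum _ _ aE) S mulr_sumr; apply: eq_bigr => j _.
by rewrite !scale_fctE; ring.
Qed.

(** The first level sums to zero by the third clause of [level_system], which has content only for
    [n > 0]; passing to the children multiplies the level sum by [d / sqrt d]. *)
Lemma system_level_sum n (u : nat -> vertex -> C) k : level_system n u -> (0 < n)%N ->
  \sum_(z <- level d (n + k)) u k z = 0.
Proof.
move=> [u0 u1 u2] n0; elim: k => [|k IH].
  case: n n0 u0 u1 u2 => // n _ u0 u1 u2; rewrite addn0 big_level big_seq big1// => y.
  by rewrite mem_level => /eqP yn; apply: u2; rewrite yn.
rewrite addnS big_level.
rewrite (_ : \sum_(y <- _) _ = \sum_(y <- level d (n + k)) (d%:R / sd%:C%C) * u k y).
  by rewrite -mulr_sumr IH mulr0.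
rewrite big_seq [RHS]big_seq; apply: eq_bigr => y; rewrite mem_level => /eqP yn.
under eq_bigr do rewrite u1//.
by rewrite sumr_const card_ord -[LHS]mulr_natl mulrA.
Qed.

(** On the level where [u_vec x a m] lives [g] is constant within the subtree of [x], and the level
    sum of [u_vec x a m] vanishes. *)
Lemma radial_on_orthogonal x a m g : \sum_i a i = 0 -> radial_on x g -> l2 g ->
  inner g (u_vec x a m) = 0.
Proof.
move=> a0 rg lg; have vP := vec_system x a0; have [v0 _ _] := vP.
rewrite (level_supp_inner (v0 m))//.
have [z0 [xz0 sz0]] : exists z0 : vertex, prefix x z0 /\ size z0 = ((size x).+1 + m)%N.
  exists (x ++ nseq m.+1 (Ordinal d0)); rewrite prefix_prefix; split=> //.
  by rewrite size_cat size_nseq addnS.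
rewrite (_ : \sum_(y <- _) _ = \sum_(y <- level d ((size x).+1 + m)) g z0 * (u_vec x a m y)^*).
  rewrite -mulr_sumr -rmorph_sum /=.
  by rewrite (system_level_sum _ vP)// rmorph0 mulr0.
rewrite big_seq [RHS]big_seq; apply: eq_bigr => y; rewrite mem_level => /eqP ys.
have [xy|xy] := boolP (prefix x y); last by rewrite u_vec_supp// rmorph0 !mulr0.
by rewrite (rg y z0)// ys sz0.
Qed.

(** When [y] is not a prefix of [x], its subtree lies inside the subtree of one child of [x] or
    meets none of them, so only the length of a vertex matters there. *)
Lemma u_vec_radial_on x y a m : ~~ prefix y x -> radial_on y (u_vec x a m).
Proof.
move=> yx z z' yz yz' zz; rewrite /u_vec; congr (_ * _); apply: eq_bigr => i _.
rewrite zz; congr (_ * (_ && _)%:R).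
have P w : prefix y w -> prefix (rcons x i) w = prefix (rcons x i) y.
  move=> yw; have [xy|xy] := leqP (size (rcons x i)) (size y).
    move: yw; rewrite !prefixE => /eqP <-; rewrite take_takel//.
  have xN : ~~ prefix (rcons x i) y.
    by apply/negP => /size_prefix; rewrite leqNgt xy.
  rewrite (negbTE xN); apply: contraNF yx => xw.
  rewrite size_rcons ltnS in xy; have xw' := prefix_trans (prefix_rcons x i) xw.
  move: yw xw'; rewrite !prefixE => /eqP yE /eqP xE.
  by rewrite -xE take_takel// yE.
by rewrite !P.
Qed.

Lemma u_radial_radial_on y m : radial_on y (@u_radial R d m).
Proof. by move=> z z' _ _ zz; rewrite /u_radial zz. Qed.

(** Of two distinct vertices at least one is not a prefix of the other, so one of the two vectors is
    radial on the subtree carrying the other. *)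
Lemma vec_vec_orthogonal x y a b m k : x <> y -> \sum_i a i = 0 -> \sum_i b i = 0 ->
  inner (u_vec x a m) (u_vec y b k) = 0.
Proof.
move=> xy a0 b0; have la := system_l2 (vec_system x a0) m; have lb := system_l2 (vec_system y b0) k.
have [yx|yx] := boolP (prefix y x); last first.
  by apply: radial_on_orthogonal => //; apply: u_vec_radial_on.
rewrite innerC// radial_on_orthogonal ?rmorph0//; apply: u_vec_radial_on.
apply/negP => xy'; apply: xy; move: yx xy' => /prefixP[s ->] /size_prefix.
by rewrite size_cat -{2}[size y]addn0 leq_add2l leqn0 => /nilP ->; rewrite cats0.
Qed.

Lemma radial_vec_orthogonal y b m k : \sum_i b i = 0 ->
  inner (@u_radial R d m) (u_vec y b k) = 0.
Proof.
move=> b0; apply: radial_on_orthogonal => //; first exact: u_radial_radial_on.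
exact: system_l2 radial_system _.
Qed.

(* The indicator of a level of the subtree of a child of y differs from 1/d times
   the indicator of the same level of the subtree of y by a vector of H_y. *)
Lemma tree_deltas (V : set (vertex -> C)) : linear_span V `<=` V ->
  (forall m, V (@u_radial R d m)) ->
  (forall x a m, \sum_i a i = 0 -> V (u_vec x a m)) ->
  forall x, V (delta R x).
Proof.
move=> VV Vr Vv x.
(* Level 0 gives the unit vector at [y]. All [m] are treated together because level [m] below a
   child is level [m + 1] below its parent. *)
pose E y m : vertex -> C := fun z => (prefix y z && (size z == size y + m)%N)%:R.
suff K y m : V (E y m).
  have -> : delta R x = E x 0%N; last exact: K.
  apply/funext => z; rewrite /delta /E addn0; congr (_%:R); congr nat_of_bool.
  apply/eqP/andP => [->|[/prefixP[s ->]]]; first by rewrite prefix_refl eqxx.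
  by rewrite size_cat -{2}[size x]addn0 eqn_add2l => /nilP ->; rewrite cats0.
have dC : d%:R != 0 :> C by rewrite pnatr_eq0 -lt0n.
elim/last_ind: y m => [|y i IH] m.
  have -> : E [::] m = ((sd ^- m)%:C%C)^-1 *: @u_radial R d m.
    apply/funext => z; by rewrite scale_fctE /u_radial mulKf ?pwN// /E prefix0s add0n.
  exact: subspaceZ.
pose a (j : 'I_d) : C := (j == i)%:R - d%:R^-1.
have a0 : \sum_j a j = 0.
  rewrite sumrB sumr_const card_ord -[X in _ - X]mulr_natl mulfV//.
  by rewrite (bigD1 i)//= eqxx big1 ?addr0 ?subrr// => j /negbTE ->.
have -> : E (rcons y i) m = ((sd ^- m)%:C%C)^-1 *: u_vec y a m + d%:R^-1 *: E y m.+1.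
  apply/funext => z.
  rewrite -[RHS]/(((sd ^- m)%:C%C)^-1 * u_vec y a m z + d%:R^-1 * E y m.+1 z).
  rewrite /u_vec mulKf; last exact: pwN.
  rewrite /E size_rcons addSn -addnS.
  have [zs|zs] := boolP (size z == size y + m.+1)%N; last first.
    rewrite !andbF mulr0 addr0 big1// => j _.
    by rewrite andbF mulr0.
  under eq_bigr do rewrite andbT.
  rewrite !andbT; have [yz|yz] := boolP (prefix y z); last first.
    have N j : prefix (rcons y j) z = false.
      by apply: contraNF yz; apply: prefix_trans; apply: prefix_rcons.
    by rewrite N mulr0 addr0 big1// => j _; rewrite N mulr0.
  have [|k [t zE]] := prefix_childP yz.
    by move=> zy; move: zs; rewrite zy -{1}[size y]addn0 eqn_add2l.
  rewrite zE; under eq_bigr do rewrite prefix_child.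
  rewrite prefix_child (bigD1 k)//= eqxx mulr1 big1 ?addr0 => [|j /negbTE ->]; last by rewrite mulr0.
  by rewrite /a eq_sym mulr1 subrK.
by apply: subspaceD => //; apply: subspaceZ => //; apply: Vv.
Qed.

Lemma u_vec_neq0 x a i : a i != 0 -> u_vec x a 0%N <> 0.
Proof.
move=> ai /(congr1 (fun f : vertex -> C => f (rcons x i))) /=.
have := u_vec_child x a i (erefl (size [::])); rewrite cats0 expr0 invr1 mul1r => ->.
by move=> h; rewrite h eqxx in ai.
Qed.

(** Any branch serves to read off a radial function; the one that always takes the first successor
    is used. *)
Lemma embed_radial_on g : radial_on [::] g ->
  g = embed (@u_radial R d) (fun m => ((sd ^- m)%:C%C)^-1 * g (nseq m (Ordinal d0))).
Proof.
move=> rg; apply/funext => y; rewrite (embed_level radial_system _ (erefl (0 + size y)%N)).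
rewrite /u_radial eqxx mulr1 mulrAC mulVf ?mul1r; last exact: pwN.
by apply: rg; rewrite ?prefix0s// size_nseq.
Qed.

(** The coefficients are [a i = f (x_i)]. The profile [g] is [f] along one branch through a child
    [x_j] with [f (x_j)] nonzero, divided by [f (x_j)]; proportionality recovers the other subtrees
    from this branch. *)
Lemma H_generator_embed x f : H_generators x f -> exists a (g : nat -> C),
  [/\ \sum_i a i = 0, l2 g & f = embed (u_vec x a) g].
Proof.
move=> [lf fx f0 fr [[j fj] fp]].
pose a i := f (rcons x i).
pose g m := ((sd ^- m)%:C%C)^-1 * (f (rcons x j ++ nseq m j) / f (rcons x j)).
have aP := vec_system x f0.
have fE : f = embed (u_vec x a) g.
  apply/funext => y; have [xy|xy] := boolP (prefix x y && (y != x)); last first.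
    have -> : f y = 0.
      apply: contrapT => /fx[xy' yx']; move: xy; rewrite xy' /=.
      by move/negP; apply; apply/eqP.
    have [yx|yx] := leqP (size y) (size x); first by rewrite (embed_below aP).
    rewrite (@embed_level _ _ _ _ aP _ (size y - (size x).+1)) ?subnKC//.
    rewrite u_vec_supp ?mulr0//; apply: contraNN xy => -> /=.
    by apply/eqP => e; rewrite e ltnn in yx.
  have [xy' /eqP yx] := andP xy; have [i [t yE]] := prefix_childP xy' yx.
  have ys : size y = ((size x).+1 + size t)%N by rewrite yE size_cat size_rcons.
  rewrite (embed_level aP _ ys) {2}yE u_vec_child// /g.
  rewrite (fp i j y (rcons x j ++ nseq (size t) j))//; last first.
  - by rewrite ys size_cat size_nseq size_rcons.
  - exact: prefix_prefix.
  - by rewrite yE prefix_prefix.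
  have := pwN (size t); move: ((sd ^- size t)%:C%C) => q qN.
  by have fjN : f (rcons x j) != 0 by [apply/eqP]; rewrite /a; field; rewrite qN fjN.
exists a, g; split=> //; apply: (embed_l2_inv d0 aP); last by rewrite -fE.
by apply: (@u_vec_neq0 _ _ j); apply/eqP.
Qed.

(** Generators must not vanish on all children, so they arise only from [g] with [g 0] nonzero. A
    sequence with [g 0 = 0] is written as [(g + delta 0) - delta 0], which is why the span is
    needed. *)
Lemma embed_H_space x a (g : nat -> C) : \sum_i a i = 0 -> l2 g ->
  H_space R (Some x) (embed (u_vec x a) g).
Proof.
move=> a0 lg; have aP := vec_system x a0.
have HH : linear_span (H_space R (Some x)) `<=` H_space R (Some x).
  exact: linear_span_subspace.
have [[i ai]|aN] := EM (exists i, a i <> 0); last first.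
  have -> : embed (u_vec x a) g = 0.
    apply/funext => y; rewrite /embed big1// => m _; rewrite /u_vec [X in _ * (_ * X)]big1 ?mulr0//.
    move=> i _; have -> : a i = 0 by apply: contrapT => ai; apply: aN; exists i.
    by rewrite mul0r.
  exact: subspace0.
have gen (h : nat -> C) : l2 h -> h 0%N <> 0 -> H_space R (Some x) (embed (u_vec x a) h).
  move=> lh h0; apply: sub_linear_span.
  have ev j t : embed (u_vec x a) h (rcons x j ++ t) = h (size t) * ((sd ^- size t)%:C%C * a j).
    by rewrite (@embed_level _ _ _ _ aP _ (size t)) ?u_vec_child// size_cat size_rcons.
  have ec j : embed (u_vec x a) h (rcons x j) = h 0%N * a j.
    by have := ev j [::]; rewrite cats0 expr0 invr1 mul1r.
  have dec j y : prefix (rcons x j) y -> exists t, y = rcons x j ++ t by move=> /prefixP.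
  split.
  - by case: (embed_l2_bound d0 aP lh).
  - move=> y yN; have xy : prefix x y.
      apply: contrapT => /negP xy; apply: yN; rewrite /embed big1// => m _.
      by rewrite u_vec_supp// mulr0.
    split=> // yx; apply: yN; rewrite yx (embed_below aP)//.
  - by under eq_bigr do rewrite ec; rewrite -mulr_sumr a0 mulr0.
  - move=> j y z /dec[t ->] /dec[s ->]; rewrite !size_cat => /addnI ts.
    by rewrite !ev ts.
  split; first by exists i; rewrite ec; apply/eqP; rewrite mulf_neq0//; apply/eqP.
  move=> j k y z; rewrite !ec => hk /dec[t ->] /dec[s ->].
  rewrite !size_cat !size_rcons => /addnI ts; rewrite !ev ts.
  have {}hk : h 0%N * a k != 0 by apply/eqP.
  move: hk; rewrite mulf_eq0 negb_or => /andP[h0' ak].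
  by move: ((sd ^- size s)%:C%C) => q; field; rewrite ak h0'.
have [g0|g0] := EM (g 0%N = 0); last by apply: gen.
have -> : g = (g + delta R 0%N) - delta R 0%N by rewrite addrK.
have ld := delta_l2 R 0%N.
rewrite embedB; apply: subspaceB => //; apply: gen => //.
- exact: l2D.
- rewrite -[(g + _) 0%N]/(g 0%N + delta R 0%N 0%N) g0 deltaxx add0r.
  exact/eqP/oner_neq0.
- by rewrite deltaxx; apply/eqP/oner_neq0.
Qed.

End ConcreteSystems.

(** * From a deficiency vector of J to the limit circle case *)

Section LimitCircleOfTree.
Variables (R : realType) (d : nat) (lam bet : nat -> R).
Local Notation C := R[i].
Local Notation vertex := (seq 'I_d).
Local Notation L2 := (@l2 R vertex).
Hypotheses (d0 : (0 < d)%N) (hlam : forall n, 0 < lam n).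
Local Notation sd := (Num.sqrt d%:R : R).
Local Notation bn n := (fun k => bet (n + k)%N).
Local Notation an n := (fun k => sd * lam (n + k)%N).

Lemma jacobi_weight_gt0 n k : 0 < sd * lam (n + k)%N.
Proof. by rewrite mulr_gt0// sqrtr_gt0 ltr0n. Qed.

Lemma jac_delta (b a : nat -> R) m :
  jac b a (delta R m) = fun k => jacobi_matrix b a k m.
Proof.
apply/funext => k; have ld := delta_l2 R m; have lc := jacobi_column_l2 b a k.
by rewrite -inner_jacobi_column// innerC// inner_delta -jacobi_matrix_sym.
Qed.

Lemma tree_action_delta (x : vertex) :
  tree_action lam bet (delta R x) = J_column lam bet x.
Proof.
apply/funext => y; have ld := delta_l2 R x; have lc := J_column_l2 lam bet y.
by rewrite -inner_J_column// innerC// inner_delta -J_column_sym.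
Qed.

Lemma J_op_level_supp k f : (forall y, size y != k -> f y = 0) ->
  J_op d lam bet (f, tree_action lam bet f).
Proof.
move=> f0; have JJ := @finsupp_subspace R _ (J_column lam bet (d := d)).
rewrite (level_expand f0).
elim: (level d k) => [|y s IH].
  rewrite !big_nil; have -> : tree_action lam bet (0 : vertex -> C) = 0.
    apply/funext => y; have := tree_action_lin lam bet (-1) (0 : vertex -> C) 0 y.
    by rewrite scaler0 addr0 mulN1r addNr.
  exact: (subspace0 JJ).
rewrite big_cons; have := subspace_lin (f y) JJ (finsupp_column (J_column lam bet (d := d)) y) IH.
congr (J_op _ _ _ (_, _)); apply/funext => z.
by rewrite tree_action_lin -tree_action_delta.
Qed.

(** The coefficient at [m] of the equation is [inner f (J (u m)) = z * inner f (u m)]. Since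
    [J (u m)] is a real three-term combination of neighbouring vectors, the same Jacobi matrix acts
    on the coefficients. *)
Lemma system_coef_jac (z : C) f n (u : nat -> vertex -> C) m : l2 f ->
  (forall x, tree_action lam bet f x = z * f x) -> level_system n u ->
  jac (bn n) (an n) (fun m => inner f (u m)) m = z * inner f (u m).
Proof.
move=> lf fz uP; have lu k := system_l2 uP k.
have lz : l2 (z *: f) by apply: l2Z.
have /(finsupp_adjoint (@J_column_l2 R d lam bet)) : [/\ l2 f, l2 (z *: f) &
    forall x, (z *: f) x = inner f (J_column lam bet x)].
  by split=> // x; rewrite inner_J_column// fz.
have [u0 _ _] := uP; have Ju := J_op_level_supp (u0 m).
have [_ lJu] := finsupp_sub (@J_column_l2 R d lam bet) Ju.
case=> _ _ /(_ _ Ju) /= E.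
have {E} <- : inner f (tree_action lam bet (u m)) = z * inner f (u m).
  by rewrite innerC// E -innerC// innerZl.
rewrite -(embed_delta uP m) (tree_action_embed lam bet d0 uP) jac_delta jacobi_columnE.
pose w : vertex -> C := if m is m'.+1 then (sd * lam (n + m')%N)%:C%C *: u m' else 0.
have lw : l2 w by rewrite /w; case: (m) => [|k]; [exact: l20|exact: l2Z].
have -> : embed u ((if m is j'.+1 then (sd * lam (n + j')%N)%:C%C *: delta R j' else 0) +
    (bet (n + m)%N)%:C%C *: delta R m + (sd * lam (n + m)%N)%:C%C *: delta R m.+1) =
    w + (bet (n + m)%N)%:C%C *: u m + (sd * lam (n + m)%N)%:C%C *: u m.+1.
  rewrite embedD embedD (embedZ _ _ (delta R m)) (embedZ _ _ (delta R m.+1)).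
  rewrite (embed_delta uP m) (embed_delta uP m.+1); congr (_ + _ + _).
  by rewrite /w; case: (m) => [|k]; rewrite ?embed0// embedZ (embed_delta uP).
have lm := l2Z (bet (n + m)%N)%:C%C (lu m).
have lS := l2Z (sd * lam (n + m)%N)%:C%C (lu m.+1).
rewrite (innerDr lf (l2D lw lm) lS) (innerDr lf lw lm) (innerZr _ lf (lu m)) (innerZr _ lf (lu m.+1)).
rewrite !conjc_realE /jac; congr (_ + _ + _).
rewrite /w; case: (m) => [|k]; first by rewrite inner0r.
by rewrite (innerZr _ lf (lu k)) conjc_realE.
Qed.

Lemma tree_limit_circle : ~ essentially_selfadjoint L2 (J_op d lam bet) ->
  forall n, limit_circle (bn n) (an n).
Proof.
move=> NE.
have [z [u [zi lu uN uz]]] := finsupp_deficiency (@J_column_l2 R d lam bet)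
  (@J_column_sym R d lam bet) NE.
have {}uz x : tree_action lam bet u x = z * u x by rewrite -inner_J_column// -uz.
(* Otherwise [u] is orthogonal to all level vectors, and by [tree_deltas] to every [delta x]. *)
have [n [v [m [vP vN]]]] : exists n v m, level_system n v /\ inner u (v m) <> 0 :> C.
  apply: contrapT => h; apply: uN; apply/funext => x.
  have lsys n v m : level_system n v -> [set f | l2 f /\ inner f u = 0] (v m).
    move=> vP; have lv := system_l2 vP m; split=> //.
    rewrite innerC//; apply/eqP; rewrite conjC_eq0; apply/eqP; apply: contrapT => hv.
    by apply: h; exists n, v, m.
  have [_] := tree_deltas d0 (subspace_inner0 lu) (fun m => lsys _ _ m (radial_system R d))
    (fun x a m a0 => lsys _ _ m (vec_system x a0)) x.
  rewrite innerC//; last exact: delta_l2.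
  by rewrite inner_delta => /eqP; rewrite conjC_eq0 => /eqP.
have lc : l2 (fun m => inner u (v m)) := system_coef_l2 d0 vP lu.
have cN : (fun m => inner u (v m)) <> 0 by move=> /(congr1 (fun f => f m)).
have [w [lw w0 sw]] := jacobi_deficiency_vector (jacobi_weight_gt0 n) zi lc cN
  (fun m => system_coef_jac m lu uz vP).
have lcn := jacobi_limit_circle (jacobi_weight_gt0 n) lw w0 sw.
move=> k; apply/(@limit_circle_tails R bet (fun k => sd * lam k) k (jacobi_weight_gt0 0)).
exact/(@limit_circle_tails R bet (fun k => sd * lam k) n (jacobi_weight_gt0 0)).
Qed.

End LimitCircleOfTree.

(** * Algebraic direct sums of operators *)

Section DirectSums.
Variables (R : realType) (T : choiceType) (I : eqType).
Local Notation C := R[i].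

Lemma pair_sum (J : Type) (s : seq J) (F G : J -> T -> C) :
  \sum_(x <- s) (F x, G x) = (\sum_(x <- s) F x, \sum_(x <- s) G x).
Proof. by elim: s => [|x s IH]; rewrite ?big_nil// !big_cons IH. Qed.

(** Grouping the terms of a linear combination by component produces the distinct indices that
    [sum_operator] asks for; each group stays in its component by linearity. *)
Lemma sum_operatorE (A : I -> graph R T) : (forall x, linear_span (A x) `<=` A x) ->
  sum_operator A = linear_span (\bigcup_(x in [set: I]) A x).
Proof.
move=> AA; apply/seteqP; split=> [p [s [F [G [_ FG p1 p2]]]]|p].
  have -> : p = \sum_(x <- s) (F x, G x) by rewrite pair_sum -p1 -p2; case: p {p1 p2}.
  apply: subspace_sum; first exact: linear_span_subspace.
  by move=> x xs; apply: sub_linear_span; exists x => //; apply: FG.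
move=> [n [c [q [Aq pE]]]].
have /choice[f fP] : forall i, exists x, A x (q i) by move=> i; have [x _ Ax] := Aq i; exists x.
pose Q x := \sum_(i <- enum 'I_n | f i == x) c i *: q i.
exists (undup [seq f i | i <- enum 'I_n]), (fun x => (Q x).1), (fun x => (Q x).2).
have AQ x : A x (Q x).
  rewrite /Q -big_filter; apply: subspace_sum => // i; rewrite mem_filter => /andP[/eqP <- _].
  exact: subspaceZ.
have E : p = \sum_(x <- undup [seq f i | i <- enum 'I_n]) Q x.
  rewrite pE /Q (exchange_big_dep xpredT) //= big_enum; apply: eq_bigr => i _.
  rewrite big_mkcond (bigD1_seq (f i)) ?undup_uniq//=; last first.
    by rewrite mem_undup; apply: map_f; rewrite mem_enum.
  by rewrite eqxx big1 ?addr0// => x /negbTE; rewrite eq_sym => ->.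
have E2 : p = (\sum_(x <- undup [seq f i | i <- enum 'I_n]) (Q x).1,
    \sum_(x <- undup [seq f i | i <- enum 'I_n]) (Q x).2).
  by rewrite E -pair_sum; apply: eq_bigr => x _; case: (Q x).
split; [exact: undup_uniq|move=> x _; have := AQ x; by case: (Q x)|by rewrite E2|by rewrite E2].
Qed.

Lemma domain_subspace (A : graph R T) : linear_span A `<=` A ->
  linear_span (domain A) `<=` domain A.
Proof.
move=> AA; apply: subspaceP; first by exists 0; apply: (subspace0 AA).
move=> a u v [u' Au] [v' Av]; exists (a *: u' + v').
exact: (subspace_lin a AA Au Av).
Qed.

Lemma domain_sum_operator (A : I -> graph R T) : (forall x, linear_span (A x) `<=` A x) ->
  domain (sum_operator A) = linear_span (\bigcup_(x in [set: I]) domain (A x)).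
Proof.
move=> AA; apply/seteqP; split=> [f [g [s [F [G [_ FG /= -> _]]]]]|].
  apply: subspace_sum; first exact: linear_span_subspace.
  by move=> x xs; apply: sub_linear_span; exists x => //; exists (G x); apply: FG.
rewrite sum_operatorE//; apply: linear_span_min; last exact/domain_subspace/linear_span_subspace.
move=> f [x _ [g Ag]]; exists g; apply: sub_linear_span; by exists x.
Qed.

End DirectSums.

(** * The component spaces as families of sequence spaces, and their orthogonality *)

Section TreeDecomposition.
Variables (R : realType) (p : nat).
Hypothesis p0 : (0 < p)%N.
Local Notation d := p.+1.
Local Notation C := R[i].
Local Notation vertex := (seq 'I_d).
Local Notation L2 := (@l2 R vertex).

Definition index_level (x : option vertex) : nat := if x is Some x then (size x).+1 else 0%N.

(** One description for all indices: a single copy for the radial space, [p = d - 1] copies for a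
    vertex, one per vector of an orthonormal basis of the sum-zero vectors. In the span defining
    [Jt_part], expanding [a] in that basis moves the scalars onto the pair of sequences, where
    linearity of the graph absorbs them. *)
Lemma H_space_family (x : option vertex) : exists (I : finType) (u : I -> nat -> vertex -> C),
  [/\ forall j, level_system (index_level x) (u j),
      forall j k, inner (u j 0%N) (u k 0%N) = (j == k)%:R,
      H_space R x = family_space u
    & forall Jt : nat -> graph R nat,
        Jt (index_level x) `<=` @l2 R nat `*` @l2 R nat ->
        linear_span (Jt (index_level x)) `<=` Jt (index_level x) ->
        Jt_part d Jt x = family_operator u (Jt (index_level x))].
Proof.
have d0 : (0 < d)%N by [].
case: x => [x|]; last first.
  exists 'I_1, (fun _ => @u_radial R d); split.
  - by move=> _; apply: radial_system.
  - by move=> j k; rewrite radial_inner0 (ord1 j) (ord1 k) eqxx.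
  - apply/seteqP; split=> [f [lf rf]|_ [phi [lphi ->]]].
      have fE := embed_radial_on d0 rf; set g := (fun _ => _) in fE.
      exists (fun=> g); split; last by rewrite /family_sum big_ord1.
      move=> _; apply: (embed_l2_inv d0 (radial_system R d)); last by rewrite -fE.
      move=> u0; have := radial_inner0 R d; rewrite u0 inner0l => /esym/eqP.
      by rewrite oner_eq0.
    rewrite /family_sum big_ord1; split; first by case: (embed_l2_bound d0 (radial_system R d) (lphi ord0)).
    by move=> y z _ _ yz; rewrite /embed yz; apply: eq_bigr => m _; rewrite /u_radial yz.
  - move=> Jt _ _; apply/seteqP; split=> [_ [q Aq <-]|_ [P [AP ->]]].
      by exists (fun=> q); split; rewrite // /family_sum !big_ord1.
    by rewrite /family_sum !big_ord1; exists (P ord0).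
have [alpha [a0 aO aT]] := sum_zero_basis R p0.
exists 'I_p, (fun j => u_vec x (alpha j)).
have uP j : level_system (size x).+1 (u_vec x (alpha j)) := vec_system x (a0 j).
have uO j k : inner (u_vec x (alpha j) 0%N) (u_vec x (alpha k) 0%N) = (j == k)%:R.
  by rewrite vec_inner0.
have sub a g : \sum_i a i = 0 -> exists c : 'I_p -> C,
    embed (u_vec x a) g = family_sum (fun j => u_vec x (alpha j)) (fun j => c j *: g).
  by move=> /aT[c aE]; exists c; apply: embed_vec_sum.
split=> //.
- apply/seteqP; split.
    apply: linear_span_min; last exact: family_space_subspace.
    move=> _ /(H_generator_embed d0)[a [g [a00 lg ->]]].
    have [c aE] := aT _ a00; exists (fun j => c j *: g).
    by split; [move=> j; apply: l2Z|apply: embed_vec_sum].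
  move=> _ [phi [lphi ->]].
  have HH : linear_span (H_space R (Some x)) `<=` H_space R (Some x).
    exact: linear_span_subspace.
  by apply: subspace_sum => // j _; apply: embed_H_space.
- move=> Jt Al AA; apply/seteqP; split.
    apply: linear_span_min.
      move=> _ [a a00 [q Aq <-]]; have [c aE] := aT _ a00.
      exists (fun j => c j *: q); split; first by move=> j; apply: subspaceZ.
      by congr pair; rewrite (embed_vec_sum _ _ aE).
    apply: subspaceP.
      exists (fun=> 0); split; first by move=> _; apply: subspace0.
      by congr pair; rewrite /family_sum big1// => j _; rewrite embed0.
    move=> c _ _ [P [AP ->]] [Q [AQ ->]].
    exists (fun j => c *: P j + Q j); split; first by move=> j; apply: subspace_lin.
    by congr pair; rewrite -family_sum_lin.
  move=> _ [P [AP ->]]; rewrite /family_sum -pair_sum.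
  apply: subspace_sum; first exact: linear_span_subspace.
  move=> j _; apply: sub_linear_span; exists (alpha j); first exact: a0.
  by exists (P j).
Qed.

(** The vectors [u_m] of all families belonging to one component. Their span is dense there, so
    orthogonality of components needs checking only on them. *)
Definition system_vectors (x : option vertex) : set (vertex -> C) :=
  if x is Some x then [set f | exists a m, \sum_i a i = 0 /\ f = u_vec x a m]
  else range (@u_radial R d).

Lemma H_space_system_vectors (x : option vertex) : H_space R x `<=` L2 /\
  H_space R x `<=` l2_closure (linear_span (system_vectors x)).
Proof.
have d0 : (0 < d)%N by [].
case: x => [x|]; last first.
  split=> [f []//|f [lf rf]].
  have fE := embed_radial_on d0 rf; set g := (fun _ => _) in fE.
  rewrite fE; apply: (system_span d0 (radial_system R d)).
  apply: (embed_l2_inv d0 (radial_system R d)); last by rewrite -fE.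
  move=> u0; have := radial_inner0 R d; rewrite u0 inner0l => /esym/eqP.
  by rewrite oner_eq0.
have Sl : system_vectors (Some x) `<=` L2.
  by move=> _ [a [m [a0 ->]]]; apply: system_l2 (vec_system x a0) _.
have cl := l2_closure_subspace (l2_span Sl) (@linear_span_subspace _ _ (system_vectors (Some x))).
have K : H_space R (Some x) `<=` l2_closure (linear_span (system_vectors (Some x))).
  apply: linear_span_min => // _ /(H_generator_embed d0)[a [g [a0 lg ->]]].
  have := system_span d0 (vec_system x a0) lg.
  by apply: l2_closureS; apply: linear_spanS => _ [m _ <-]; exists a, m.
by split=> // f /K[].
Qed.

Lemma system_vectors_sub x : system_vectors x `<=` L2.
Proof.
have d0 : (0 < d)%N by [].
case: x => [x|_ [m _ <-]]; last exact: system_l2 (radial_system R d) _.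
by move=> _ [a [m [a0 ->]]]; apply: system_l2 (vec_system x a0) _.
Qed.

Lemma system_vectors_orthogonal x y f g : x <> y ->
  system_vectors x f -> system_vectors y g -> inner f g = 0.
Proof.
have d0 : (0 < d)%N by [].
move=> xy xf yg; have [lf lg] := conj (system_vectors_sub xf) (system_vectors_sub yg).
case: x y xy xf yg => [x|] [y|] xy //=.
- move=> [a [m [a0 fE]]] [b [k [b0 gE]]]; rewrite fE gE.
  by apply: vec_vec_orthogonal => // e; apply: xy; rewrite e.
- move=> [a [m [a0 fE]]] [k _ gE]; rewrite innerC// fE -gE.
  by rewrite radial_vec_orthogonal// rmorph0.
- move=> [k _ gE] [a [m [a0 fE]]]; rewrite fE -gE.
  exact: radial_vec_orthogonal.
Qed.

Lemma H_space_orthogonal (x y : option vertex) f g : x <> y -> H_space R x f -> H_space R y g ->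
  inner f g = 0.
Proof.
move=> xy xf yg; have [_ /(_ f xf) cf] := H_space_system_vectors x.
have [Hl /(_ g yg) cg] := H_space_system_vectors y; have lg := Hl _ yg.
apply: (l2_closure_inner0 (l2_span (@system_vectors_sub x)) lg _ cf).
apply: span_inner0 => //; first exact: system_vectors_sub.
move=> f' xf'; have lf' := system_vectors_sub xf'.
rewrite innerC//; apply/eqP; rewrite conjC_eq0; apply/eqP.
apply: (l2_closure_inner0 (l2_span (@system_vectors_sub y)) lf' _ cg).
apply: span_inner0 => //; first exact: system_vectors_sub.
by move=> g' yg'; apply: system_vectors_orthogonal yg' xf' => // e; apply: xy.
Qed.

End TreeDecomposition.

(** The spectrum is the closure of the eigenvalues. Within the gap [e] around [z] the only possible
    eigenvalue is [z] itself, so no other point of that ball is a limit of eigenvalues. *)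
Lemma selfadjoint_discrete_spectrum (R : realType) (T : choiceType) (A : graph R T)
    (B : set (T -> R[i])) (mu : (T -> R[i]) -> R) :
  selfadjoint (@l2 R T) A ->
  (forall b, B b -> A (b, (mu b)%:C%C *: b)) ->
  (forall b, B b -> inner b b = 1) ->
  (forall b c, B b -> B c -> b <> c -> inner b c = 0) ->
  @l2 R T `<=` l2_closure (linear_span B) ->
  (forall z : R[i], exists2 e : R, 0 < e &
     forall b, B b -> normc (z - (mu b)%:C%C) < e -> (mu b)%:C%C = z) ->
  discrete_set (spectrum (@l2 R T) A).
Proof.
move=> sA BA B1 B0 BT iso.
have Bl : B `<=` @l2 R T by move=> b /BA /(selfadjoint_sub sA)[].
rewrite (selfadjoint_diagonal (fun _ => id) Bl B1 B0 BT sA erefl BA).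
rewrite diagonal_spectrum//; last 2 first.
- exact: l2_span.
- by move=> f [].
move=> z cz; have [e e0 eB] := iso z; split; first exact/mem_set.
exists [set w | normc (z - w) < e]; first by apply/nbhs_normcP; exists e.
apply/seteqP; split=> [w [/= zw /closure_normcP cw]|_ ->]; last first.
  by split=> //=; rewrite subrr normc_zero.
apply: normc_eps_eq => del del0.
(* The second bound keeps an eigenvalue near [w] within [e] of [z], which identifies it with [z];
   the first then makes [w] arbitrarily close to [z]. *)
have m0 : 0 < Num.min del (e - normc (z - w)) by rewrite lt_min del0 subr_gt0.
have [_ [b Bb <-]] := cw _ m0; rewrite lt_min => /andP[h1 h2].
have bz : (mu b)%:C%C = z.
  apply: eB => //; apply: le_lt_trans (_ : normc (z - w) + normc (w - (mu b)%:C%C) < e).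
    by rewrite -[X in normc X](subrKA w) normc_triangle.
  by move: h2; rewrite ltrBrDl.
by rewrite -bz ltW.
Qed.

(** * The operator assembled from arbitrary extensions of the Jacobi matrices *)

Section SelfadjointExtensions.
Variables (R : realType) (p : nat) (lam bet : nat -> R).
Hypotheses (p0 : (0 < p)%N) (hlam : forall n, 0 < lam n).
Local Notation d := p.+1.
Local Notation C := R[i].
Local Notation vertex := (seq 'I_d).
Local Notation L2 := (@l2 R vertex).
Local Notation sd := (Num.sqrt d%:R : R).
Local Notation bn n := (fun k => bet (n + k)%N).
Local Notation an n := (fun k => sd * lam (n + k)%N).
Hypothesis lc : forall n, limit_circle (bn n) (an n).
Variable Jt : nat -> graph R nat.
Hypothesis ext : forall n, selfadjoint_extension (@l2 R nat) (Jr d lam bet n) (Jt n).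

Let d0 : (0 < d)%N. Proof. by []. Qed.

Let formal n f g : Jt n (f, g) -> [/\ l2 f, l2 g & g = jac (bn n) (an n) f].
Proof. by move=> /(jacobi_extension_formal (ext n))[lf lg fg]; split=> //; apply/funext. Qed.

Let Js n : selfadjoint (@l2 R nat) (Jt n) := (ext n).2.
Let Jl n : Jt n `<=` @l2 R nat `*` @l2 R nat := selfadjoint_sub (Js n).
Let JJ n : linear_span (Jt n) `<=` Jt n := selfadjoint_subspace (Js n).

(** Each component inherits the eigenbasis of its sequence operator through [family_basis]. A single
    eigenvalue function [mu] serves all components, so that the bases can later be united. *)
Lemma Jt_part_eigenbasis : exists (B : option vertex -> set (vertex -> C)) (mu : (vertex -> C) -> R),
  forall x, [/\ selfadjoint (H_space R x) (Jt_part d Jt x)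
    /\ pure_point_spectrum (H_space R x) (Jt_part d Jt x),
    [/\ B x `<=` H_space R x, forall b, B x b -> inner b b = 1,
        forall b c, B x b -> B x c -> b <> c -> inner b c = 0
      & H_space R x `<=` l2_closure (linear_span (B x))],
    forall b, B x b -> Jt_part d Jt x (b, (mu b)%:C%C *: b),
    Jt_part d Jt x = diagonal_operator (H_space R x) (B x) mu
  & spectrum (H_space R x) (Jt_part d Jt x) = closure [set ((mu b)%:C%C : R[i]^o) | b in B x]].
Proof.
have /choice[D DP] : forall n, exists D : set (nat -> C) * ((nat -> C) -> R),
  [/\ forall b, D.1 b -> Jt n (b, (D.2 b)%:C%C *: b),
      forall b, D.1 b -> inner b b = 1,
      forall b c, D.1 b -> D.1 c -> b <> c -> inner b c = 0
    & @l2 R nat `<=` l2_closure (linear_span D.1)].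
  move=> n; have [B [mu [h1 h2 h3 h4 _]]] := limit_circle_spectrum (jacobi_weight_gt0 d0 hlam n) (@lc n) (ext n).
  by exists (B, mu).
(* The eigenvalue is read from the formal action on the tree, independently of the component;
   functions that are not eigenvectors for a real value get the default 0. *)
have /choice[mu muP] : forall f : vertex -> C, exists t : R,
    forall s : R, tree_action lam bet f = s%:C%C *: f -> tree_action lam bet f = t%:C%C *: f.
  move=> f; have [[t ft]|N] := EM (exists t : R, tree_action lam bet f = t%:C%C *: f).
    by exists t.
  by exists 0 => s fs; exfalso; apply: N; exists s.
have /choice[U UP] : forall x : option vertex, exists U : {I : finType & I -> nat -> vertex -> C},
  [/\ forall j, level_system (index_level x) (projT2 U j),
      forall j k, inner (projT2 U j 0%N) (projT2 U k 0%N) = (j == k)%:R,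
      H_space R x = family_space (projT2 U)
    & Jt_part d Jt x = family_operator (projT2 U) (Jt (index_level x))].
  move=> x; have [I [u [h1 h2 h3 h4]]] := H_space_family R p0 x.
  by exists (existT _ I u); split=> //; apply: h4.
exists (fun x => family_basis (projT2 (U x)) (D (index_level x)).1), mu => x.
have [uP uO -> ->] := UP x; have [BA B1 BO BT] := DP (index_level x).
set n := index_level x in uP uO BA B1 BO BT *.
set u := projT2 (U x) in uP uO *.
have muE j b : (D n).1 b -> mu (embed (u j) b) = (D n).2 b.
  move=> Bb; have [lb _ jb] := formal (BA _ Bb).
  set F := embed (u j) b.
  have FE : tree_action lam bet F = ((D n).2 b)%:C%C *: F.
    by rewrite (tree_action_embed lam bet d0 (uP j)) -jb embedZ.
  have := muP F _ FE; rewrite FE => /esym/eqP.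
  rewrite -subr_eq0 -scalerBl => /eqP h.
  have F1 : inner F F = 1 by rewrite (embed_inner d0 (uP j) (uP j))// uO eqxx B1// mul1r.
  have lF : l2 F by case: (embed_l2_bound d0 (uP j) lb).
  have := innerZl ((mu F)%:C%C - ((D n).2 b)%:C%C) lF lF.
  rewrite h inner0l F1 mulr1 => /esym/eqP; rewrite subr_eq0 => /eqP.
  exact: complexI.
have Bl : forall b, (D n).1 b -> l2 b by move=> b /BA /formal[].
split.
- split; first exact: (family_operator_selfadjoint d0 uP uO (Js n) BA B1 BO BT muE).
  exact: (family_pure_point d0 uP uO (Js n) BA B1 BO BT muE).
- split.
  + exact: (family_basis_sub (Js n) BA).
  + exact: (family_basis_normal d0 uP uO (Js n) BA B1).
  + exact: (family_basis_orthogonal d0 uP uO (Js n) BA BO).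
  + exact: (family_basis_total d0 uP (Js n) BA BT).
- exact: (family_basis_eigenvector d0 uP uO (Js n) BA B1 BO BT muE).
- exact: (family_operatorE d0 uP uO (Js n) BA B1 BO BT muE).
- exact: (family_spectrum d0 uP uO (Js n) BA B1 BO BT muE).
Qed.


(** The functions on which the sum acts as the formal tree action form a subspace containing every
    [u_m], because each extension contains the columns of its matrix. By [tree_deltas] it contains
    the unit vectors. *)
Lemma Jt_sum_column x : Jt_sum d Jt (delta R x, J_column lam bet x).
Proof.
have PP y : linear_span (Jt_part d Jt y) `<=` Jt_part d Jt y.
  have [I [u [_ _ _ h]]] := H_space_family R p0 y; rewrite h//.
  apply: subspaceP.
    exists (fun=> 0); split; first by move=> _; apply: subspace0.
    by congr pair; rewrite /family_sum big1// => j _; rewrite embed0.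
  move=> c _ _ [P [AP ->]] [Q [AQ ->]].
  exists (fun j => c *: P j + Q j); split; first by move=> j; apply: subspace_lin.
  by congr pair; rewrite -family_sum_lin.
rewrite /Jt_sum sum_operatorE// -tree_action_delta.
pose V := [set f : vertex -> C | linear_span (\bigcup_(y in [set: option vertex]) Jt_part d Jt y)
  (f, tree_action lam bet f)].
have SS := @linear_span_subspace _ _ (\bigcup_(y in [set: option vertex]) Jt_part d Jt y).
have Jm n m : Jt n (delta R m, jac (bn n) (an n) (delta R m)).
  by apply: (ext n).1; rewrite jac_delta; apply: finsupp_column.
suff : V (delta R x) by [].
apply: (tree_deltas d0).
- apply: subspaceP.
    rewrite /V /=; have -> : tree_action lam bet (0 : vertex -> C) = 0.
      apply/funext => y; have := tree_action_lin lam bet (-1) (0 : vertex -> C) 0 y.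
      by rewrite scaler0 addr0 mulN1r addNr.
    exact: (subspace0 SS).
  move=> c f g Vf Vg; have := subspace_lin c SS Vf Vg.
  rewrite /V /=; congr (linear_span _ (_, _)).
  by apply/funext => y; rewrite tree_action_lin.
- move=> m; apply: sub_linear_span; exists None => //.
  exists (delta R m, jac (bn 0) (an 0) (delta R m)); first exact: Jm.
  rewrite /= -(tree_action_embed lam bet d0 (radial_system R d)).
  by rewrite (embed_delta (radial_system R d)).
move=> y a m a0; apply: sub_linear_span; exists (Some y) => //; apply: sub_linear_span.
exists a => //.
exists (delta R m, jac (bn (size y).+1) (an (size y).+1) (delta R m)); first exact: Jm.
rewrite /= -(tree_action_embed lam bet d0 (vec_system y a0)).
by rewrite (embed_delta (vec_system y a0)).
Qed.

(** The algebraic sum lies between the eigenpairs of the united basis and its diagonal operator, so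
    [diagonal_op_closure] identifies its closure. Functionality, selfadjointness and spectrum are
    read off from the diagonal operator. *)
Theorem Jt_sum_spectrum :
  (forall x : option vertex,
     is_operator (H_space R x) (Jt_part d Jt x) /\
     pure_point_spectrum (H_space R x) (Jt_part d Jt x)) /\
  [/\ is_operator L2 (Jt_sum d Jt),
      domain (Jt_sum d Jt) =
        linear_span (\bigcup_(x in [set: option vertex]) domain (Jt_part d Jt x)),
      J_op d lam bet `<=` Jt_sum d Jt,
      selfadjoint_extension L2 (J_op d lam bet) (op_closure (Jt_sum d Jt))
    & spectrum L2 (op_closure (Jt_sum d Jt)) =
        closure (\bigcup_(x in [set: option vertex])
                   spectrum (H_space R x) (Jt_part d Jt x)) /\
      pure_point_spectrum L2 (op_closure (Jt_sum d Jt))].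
Proof.
have [B [mu BP]] := Jt_part_eigenbasis.
have op x : is_operator (H_space R x) (Jt_part d Jt x) by case: (BP x) => -[[]].
have PP x : linear_span (Jt_part d Jt x) `<=` Jt_part d Jt x by case: (op x).
have Hl x : H_space R x `<=` L2 by case: (H_space_system_vectors R x).
have BH x : B x `<=` H_space R x by case: (BP x) => _ [].
pose BB := \bigcup_(x in [set: option vertex]) B x.
have BBl : BB `<=` L2 by move=> b [x _ /BH /Hl].
have BB1 b : BB b -> inner b b = 1 by move=> [x _]; case: (BP x) => _ [_ + _ _] _ _ _; apply.
have cross (x y : option vertex) f g : x <> y -> H_space R x f -> H_space R y g -> inner f g = 0.
  exact: H_space_orthogonal.
have BB0 b c : BB b -> BB c -> b <> c -> inner b c = 0.
  move=> [x _ xb] [y _ yc] bc; have [xy|xy] := EM (x = y); last exact: (cross x y _ _ xy (BH _ _ xb) (BH _ _ yc)).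
  by rewrite -xy in yc; case: (BP x) => _ [_ _ + _] _ _ _; apply.
have BBT : L2 `<=` l2_closure (linear_span BB).
  apply: l2_total => // u lu uB; apply/funext => x.
  have HV y : H_space R y `<=` [set f | l2 f /\ inner f u = 0].
    move=> f Hf; split; first exact: Hl Hf.
    have [_ [_ _ _ /(_ f Hf) cf] _ _ _] := BP y.
    have Byl : B y `<=` L2 by move=> b /BH /Hl.
    apply: (l2_closure_inner0 (l2_span Byl) lu _ cf); apply: span_inner0 => // b Bb.
    by apply: uB; exists y.
  have Vd m : H_space R None (u_radial R (d := d) m).
    split; first exact: (system_l2 (radial_system R d) m).
    exact: u_radial_radial_on.
  have Vv (y : vertex) (a : 'I_d -> C) m : \sum_i a i = 0 -> H_space R (Some y) (u_vec y a m).
    move=> a0; rewrite -(embed_delta (vec_system y a0)).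
    exact: (embed_H_space d0 y a0 (delta_l2 R m)).
  have [_] := tree_deltas d0 (subspace_inner0 lu) (fun m => HV None _ (Vd m))
    (fun y a m a0 => HV (Some y) _ (Vv y a m a0)) x.
  rewrite innerC; last 2 first.
  - exact: lu.
  - exact: delta_l2.
  by rewrite inner_delta => /eqP; rewrite conjC_eq0 => /eqP.
have SE : Jt_sum d Jt = linear_span (\bigcup_(x in [set: option vertex]) Jt_part d Jt x).
  exact: sum_operatorE.
have SS : linear_span (Jt_sum d Jt) `<=` Jt_sum d Jt by rewrite SE; apply: linear_span_subspace.
have eig b : BB b -> Jt_sum d Jt (b, (mu b)%:C%C *: b).
  move=> [x _ xb]; rewrite SE; apply: sub_linear_span; exists x => //.
  by have [_ _ + _ _] := BP x; apply.
have L2L2 : linear_span L2 `<=` L2 by apply: l2_span.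
have Dl : linear_span (diagonal_operator L2 BB mu) `<=` diagonal_operator L2 BB mu.
  exact: diagonal_subspace.
(* Against a basis vector of the same component the coefficient identity is that of the component;
   against one of another component both sides vanish by orthogonality. *)
have SD : Jt_sum d Jt `<=` diagonal_operator L2 BB mu.
  rewrite SE; apply: linear_span_min => // -[f g] [x _ xfg].
  have [sub _ _] := op x; have [/= Hf Hg] := sub _ xfg.
  split; [exact: Hl Hf|exact: Hl Hg|move=> b [y _ yb] /=].
  have [xy|xy] := EM (x = y).
    rewrite -xy in yb; have [_ _ _ xE _] := BP x.
    by move: xfg; rewrite xE => -[_ _]; apply.
  by rewrite !(cross _ _ _ _ xy _ (BH _ _ yb)) ?mulr0.
have CE : op_closure (Jt_sum d Jt) = diagonal_operator L2 BB mu.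
  exact: diagonal_op_closure.
have sa : selfadjoint L2 (op_closure (Jt_sum d Jt)).
  rewrite CE; exact: diagonal_selfadjoint.
have JS : J_op d lam bet `<=` Jt_sum d Jt.
  apply: linear_span_min => // _ [x _ <-]; exact: Jt_sum_column.
have Sl : Jt_sum d Jt `<=` L2 `*` L2 by move=> q /SD[l1 l2' _].
split; first by move=> x; split=> //; case: (BP x) => -[].
split.
- split=> // f g h /SD Df /SD; have [[_ _ su] _ _] := sa; rewrite CE in su.
  exact: su Df.
- exact: domain_sum_operator.
- exact: JS.
- by split=> // q /JS; apply: sub_op_closure.
split.
  rewrite CE diagonal_spectrum//; last by move=> f [].
  apply/seteqP; split=> z /closure_normcP cz; apply/closure_normcP => e e0.
    have [_ [b [x _ xb] <-] zb] := cz e e0; exists (mu b)%:C%C => //.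
    exists x => //; have [_ _ _ _ ->] := BP x.
    by apply: subset_closure; exists b.
  have e2 : 0 < e / 2 by rewrite divr_gt0.
  have [w [x _ xw] zw] := cz _ e2; have [_ _ _ _ xE] := BP x.
  move: xw; rewrite xE => /closure_normcP/(_ _ e2)[_ [b xb <-] wb].
  exists (mu b)%:C%C; first by exists b => //; exists x.
  rewrite [e]splitr; apply: le_lt_trans (ltrD zw wb).
  by rewrite -[X in normc X](subrKA w) normc_triangle.
exists BB; split=> //.
move=> b Bb; split; first exact: BBl.
by apply: (orthonormal_eigenvector (BB1 _ Bb)); apply: sub_op_closure => //; apply: eig.
Qed.

End SelfadjointExtensions.

Theorem mainTheorem6 (R : realType) (d : nat) (lam bet : nat -> R)
    (hd : (2 <= d)%N) (hlam : forall n : nat, 0 < lam n)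
    (hJ : ~ essentially_selfadjoint (@l2 R (seq 'I_d)) (J_op d lam bet)) :
  (forall n : nat,
     [/\ ~ essentially_selfadjoint (@l2 R nat) (Jr d lam bet n),
         exists A : graph R nat,
           selfadjoint_extension (@l2 R nat) (Jr d lam bet n) A
       & forall A : graph R nat,
           selfadjoint_extension (@l2 R nat) (Jr d lam bet n) A ->
           discrete_set (spectrum (@l2 R nat) A)]) /\
  (forall Jt : nat -> graph R nat,
     (forall n : nat,
        selfadjoint_extension (@l2 R nat) (Jr d lam bet n) (Jt n)) ->
     (forall x : option (seq 'I_d),
        is_operator (H_space R x) (Jt_part d Jt x) /\
        pure_point_spectrum (H_space R x) (Jt_part d Jt x)) /\
     [/\ is_operator (@l2 R (seq 'I_d)) (Jt_sum d Jt),
         domain (Jt_sum d Jt) =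
           linear_span (\bigcup_(x in [set: option (seq 'I_d)])
                          domain (Jt_part d Jt x)),
         J_op d lam bet `<=` Jt_sum d Jt,
         selfadjoint_extension (@l2 R (seq 'I_d))
           (J_op d lam bet) (op_closure (Jt_sum d Jt))
       & spectrum (@l2 R (seq 'I_d)) (op_closure (Jt_sum d Jt)) =
           closure (\bigcup_(x in [set: option (seq 'I_d)])
                      spectrum (H_space R x) (Jt_part d Jt x)) /\
         pure_point_spectrum (@l2 R (seq 'I_d)) (op_closure (Jt_sum d Jt))]).
Proof.
(* Writing [d] as [p.+1] exposes the multiplicity [p] of the vertex components, positive because
   [d >= 2]. *)
case: d hd hJ => [//|p] p0 hJ; rewrite ltnS in p0.
have d0 : (0 < p.+1)%N by [].
have lc := tree_limit_circle d0 hlam hJ.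
have a0 := jacobi_weight_gt0 d0 hlam.
split=> [n|Jt ext]; last exact: (Jt_sum_spectrum p0 hlam lc ext).
split.
- exact: (limit_circle_not_esa (a0 n) (lc n)).
- exact: (limit_circle_extension (a0 n) (lc n)).
move=> A ext; have [B [mu [BA B1 B0 BT iso]]] := limit_circle_spectrum (a0 n) (lc n) ext.
exact: (selfadjoint_discrete_spectrum ext.2 BA B1 B0 BT iso).
Qed.
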